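(* Let $A\in\mathbb R^{n\times n}$ be quasiseparable of order $r_a$ with $\mathcal W(A)\subset\mathbb C^-$, let $F\in\mathbb R^{n\times n}$ be symmetric positive definite and quasiseparable of order $r_f$, and let $Q\in\mathbb R^{n\times n}$ be symmetric positive semidefinite and quasiseparable of order $r_q$. Let $X\in\mathbb R^{n\times n}$ be the symmetric positive semidefinite stabilizing solution of $$A^\top X+XA-XFX+Q=0.$$ Let $LL^\top=F$ be the Cholesky factorization of $F$ and assume $\mathcal W(L^{-1}AL)\subset\mathbb C^-$. Then the singular values of any $M\in\mathrm{Off}(X)$ satisfy $$\frac{\sigma_{ht+r_f+1}(M)}{\|X\|_2}\le\kappa(F)(1+\sqrt2)^2\,Z_h(E,-E),\qquad h=1,2,\dots,$$ where $$t=4r_a+6r_f+2r_q,\qquad E=\mathcal W(L^{-1}AL)+\left[-\tau-\sqrt{\tau^2+\|F\|_2\|Q\|_2},\ 0\right],\qquad \tau:=|\min\{\mathcal W(L^{-1}AL)\cap\mathbb R\}|.$$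
   Context: $\mathbb C^-=\{z\in\mathbb C:\Re(z)<0\}$. The numerical range is $\mathcal W(A)=\{x^HAx:\ x\in\mathbb C^n,\ \|x\|_2=1\}$. The sum of two subsets of $\mathbb C$ is the Minkowski sum. $\kappa(F)$ is the 2-norm condition number. In the Cholesky factorization $L$ is lower triangular. For an $n\times n$ matrix $M$, $\mathrm{Off}(M):=\{M(s+1:n,1:s): s=1,\dots,n-1\}\cup\{M(1:s,s+1:n): s=1,\dots,n-1\}$ (Matlab-like notation). $M$ is quasiseparable of order $r$ if $\max_{\widetilde M\in\mathrm{Off}(M)}\mathrm{rank}(\widetilde M)=r$. Under these assumptions the equation has a unique real symmetric positive semidefinite solution $X$, called the stabilizing solution since $A-FX$ is stable (eigenvalues with nonpositive real parts). Singular values are in nonincreasing order, with $\sigma_i(M)=0$ when $i$ exceeds the number of singular values of $M$. $Z_h(E,F):=\min_{g\in\mathcal R_{h,h}}\dfrac{\max_{z\in E}|g(z)|}{\min_{z\in F}|g(z)|}$ for subsets $E,F$ of $\mathbb C$, where $\mathcal R_{h,h}$ is the set of rational functions with numerator and denominator of degree at most $h$; $-E=\{-z:z\in E\}$. *)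

(* Defs.v *)
From HB Require Import structures.
From mathcomp Require Import all_boot all_order all_algebra.
From mathcomp Require Import sesquilinear spectral.
From mathcomp Require Import all_classical all_reals ereal.
From mathcomp Require Import complex.

Set Implicit Arguments.
Unset Strict Implicit.
Unset Printing Implicit Defensive.

Import Order.TTheory GRing.Theory Num.Theory.

Local Open Scope classical_set_scope.
Local Open Scope ring_scope.
Local Open Scope complex_scope.
Local Open Scope sesquilinear_scope.

Section RealMatrices.
Variable R : realType.

Definition symmetric_mx n (M : 'M[R]_n) := M^T = M.

Definition psd_mx n (M : 'M[R]_n) :=
  symmetric_mx M /\ forall x : 'cV[R]_n, 0 <= (x^T *m M *m x) 0 0.

Definition spd_mx n (M : 'M[R]_n) :=
  symmetric_mx M /\ forall x : 'cV[R]_n, x != 0 -> 0 < (x^T *m M *m x) 0 0.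

Definition norm2 n (x : 'cV[R]_n) : R := Num.sqrt (\sum_i x i 0 ^+ 2).

Definition opnorm2 p q (M : 'M[R]_(p, q)) : R :=
  sup [set norm2 (M *m x) | x in [set x : 'cV[R]_q | norm2 x = 1]].

Definition cond2 n (M : 'M[R]_n) : R := opnorm2 M * opnorm2 (invmx M).

(* [is_trig_mx] is the library's lower triangularity. No sign is imposed on the
   diagonal of L: flipping signs of columns of L changes L^-1 A L only by an
   orthogonal similarity, so its numerical range does not depend on them. *)
Definition cholesky n (F L : 'M[R]_n) := is_trig_mx L /\ L *m L^T = F.

Definition toC p q (M : 'M[R]_(p, q)) : 'M[R[i]]_(p, q) :=
  map_mx (real_complex R) M.

Definition numrange n (A : 'M[R[i]]_n) : set R[i] :=
  [set (x ^t* *m A *m x) 0 0 |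
     x in [set x : 'cV[R[i]]_n | sqrtC (\sum_i `|x i 0| ^+ 2) = 1]].

Definition Cminus : set R[i] := [set z | complex.Re z < 0].

(* The list has length q, whereas a p x q matrix has min(p, q) singular values:
   the q - min(p, q) extra entries are zeros, which agrees with the convention
   that sing_val M i = 0 when i exceeds the number of singular values. *)
Definition sing_vals p q (M : 'M[R]_(p, q)) : seq R :=
  sort >=%R [seq Num.sqrt (complex.Re (spectral_diag (toC (M^T *m M)) 0 j))
            | j <- enum 'I_q].

(* Numbered from 1. *)
Definition sing_val p q (M : 'M[R]_(p, q)) (i : nat) : R :=
  nth 0 (sing_vals M) i.-1.

(* The two injections for the splitting {1..n} = {1..s} + {s+1..n}. *)
Definition head_idx n (s : 'I_n) (i : 'I_s) : 'I_n :=
  cast_ord (subnKC (ltnW (ltn_ord s))) (lshift (n - s) i).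

Definition tail_idx n (s : 'I_n) (i : 'I_(n - s)) : 'I_n :=
  cast_ord (subnKC (ltnW (ltn_ord s))) (rshift s i).

Definition lower_block n (M : 'M[R]_n) (s : 'I_n) : 'M[R]_(n - s, s) :=
  mxsub (@tail_idx n s) (@head_idx n s) M.

Definition upper_block n (M : 'M[R]_n) (s : 'I_n) : 'M[R]_(s, n - s) :=
  mxsub (@head_idx n s) (@tail_idx n s) M.

(* [Off M B] reads "B belongs to Off(M)"; an inductive family because the blocks
   have different sizes. *)
Inductive Off n (M : 'M[R]_n) : forall p q, 'M[R]_(p, q) -> Prop :=
| Off_lower (s : 'I_n) of (0 < s)%N : Off M (lower_block M s)
| Off_upper (s : 'I_n) of (0 < s)%N : Off M (upper_block M s).

Definition quasiseparable n (M : 'M[R]_n) (r : nat) :=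
  \max_(s < n | (0 < s)%N)
    maxn (\rank (lower_block M s)) (\rank (upper_block M s)) = r.

Definition stable_mx n (M : 'M[R]_n) :=
  forall z : R[i], eigenvalue (toC M) z -> complex.Re z <= 0.

Definition stabilizing_solution n (A F Q X : 'M[R]_n) :=
  [/\ psd_mx X,
      A^T *m X + X *m A - X *m F *m X + Q = 0
    & stable_mx (A - F *m X)].

(* p / q is an irreducible fraction of type (h, h). *)
Definition ratfun (h : nat) (p q : {poly R[i]}) :=
  [/\ (size p <= h.+1)%N, (size q <= h.+1)%N, q != 0 & coprimep p q].

(* |p / q| on the Riemann sphere: the value at a pole is +oo. *)
Definition ratfun_abs (p q : {poly R[i]}) (z : R[i]) : \bar R :=
  if root q z then +oo%E else (ComplexField.Normc.normc (p.[z] / q.[z]))%:E.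

(* Written with sup / inf; on compact sets the inner extrema are attained.
   The side conditions only discard the g whose quotient is +oo or undefined
   (sup = +oo or inf = 0): without them 0 / 0 and +oo / +oo would evaluate to 0
   in \bar R. *)
Definition zolotarev (h : nat) (E F : set R[i]) : \bar R :=
  ereal_inf [set r : \bar R | exists p q : {poly R[i]},
    let M := ereal_sup [set ratfun_abs p q z | z in E] in
    let m := ereal_inf [set ratfun_abs p q z | z in F] in
    [/\ ratfun h p q, (M < +oo)%E, (0 < m)%E & r = (M / m)%E]].

(* min(W cap R); [inf] is the minimum when W is compact and meets the real axis,
   as the numerical range of a real matrix of positive size does. *)
Definition real_min (W : set R[i]) : R := inf [set x : R | W x%:C].

End RealMatrices.

(* Main.v *)
(* With Y = L^T X L, B = L^-1 A L and C = L^T Q L the equation becomes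
   B^T Y + Y B - Y^2 + C = 0. Its (2,1) block is the Sylvester equation
     (B22 - Y22)^T Y21 + Y21 (B11 - Y11) = - (B12^T Y11 + Y22 B21 + C21),
   whose right-hand side has rank at most 2 ra + 3 rf + rq = t / 2, because
   L^-1 A L keeps the rank of the upper block of A; X21 differs from
   L22^-T Y21 L11^-1 by a matrix of rank at most rf. Evaluating the equation at
   an eigenvector of Y gives |Y| <= sqrt (|F| |Q|), so B - Y and its compressions
   have their numerical range in E.

   If E is a K-spectral set for these compressions, then for every rational g of
   degree h the function g^2, of degree 2 h, produces an approximation of rank
   h t with relative error K^2 rho^2, where rho is the quotient of g in the
   definition of Z_h. Only the case kappa (1 + sqrt 2)^2 rho < 1 matters, since
   singular values never exceed |X|, and there K^2 rho^2 <= (1 + sqrt 2)^2 rho as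
   soon as K <= (1 + sqrt 2)^2. The factor two gained in the rank thus replaces
   the sharp Crouzeix--Palencia constant by any K < 5.8, and we take K = 5.

   For that constant no boundary values are needed. If w_j are outer normals times
   step lengths at nodes s_j of a convex polygon around E, the matrices
   w_j (s_j - A)^-1 + (w_j (s_j - A)^-1)^* are positive and sum to about 2 Re c,
   so S = sum f(s_j) (...) has norm at most 2 |c| max |f|, while
   S ~ c f(A) + g(A)^* for g(z) = sum conj(f(s_j)) w_j / (s_j - z). The same
   estimate for scalars gives |g| <= 3 |c| inside E. With T = f(A) this bounds
   c^* T T^* T = T S^* T - (f g f)(A), hence |T|^3 by 2 K^2 + 3 K if K is the best
   spectral constant, and therefore K <= 3 up to the discretization error. That
   the sums approximate c f(A), with the same c for all A, follows from the
   telescoping of primitives and from the homotopy A |-> z0 + t (A - z0). *)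

Require Import Defs.
From HB Require Import structures.
From mathcomp Require Import all_boot all_order all_algebra.
From mathcomp Require Import sesquilinear spectral.
From mathcomp Require Import all_classical all_reals ereal.
From mathcomp Require Import complex.
From mathcomp Require Import ring lra zify.

Import Order.TTheory GRing.Theory Num.Theory.
Local Open Scope classical_set_scope.
Local Open Scope ring_scope.
Local Open Scope complex_scope.
Local Open Scope sesquilinear_scope.

Set Implicit Arguments.
Unset Strict Implicit.
Unset Printing Implicit Defensive.

(** * Norms of complex vectors and matrices *)

Section Modulus.
Variable R : realType.
Notation C := R[i].
Implicit Types (x y z : C) (a : R).

(* [complex.Re] with codomain literally R, which keeps rewriting robust. *)
Definition re z : R := complex.Re z.

Definition cabs z : R := Num.sqrt (complex.Re z ^+ 2 + complex.Im z ^+ 2).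

Lemma cabsE z : `|z| = (cabs z)%:C.
Proof. exact: normc_def. Qed.

Lemma normc_cabs z : ComplexField.Normc.normc z = cabs z.
Proof. by case: z. Qed.

Lemma cabs_ge0 z : 0 <= cabs z.
Proof. exact: sqrtr_ge0. Qed.

Lemma cabs2 z : cabs z ^+ 2 = complex.Re z ^+ 2 + complex.Im z ^+ 2.
Proof. by rewrite sqr_sqrtr // addr_ge0 ?sqr_ge0. Qed.

Lemma cabsM x y : cabs (x * y) = cabs x * cabs y.
Proof. by apply: complexI; rewrite rmorphM /= -!cabsE normrM. Qed.

Lemma cabsV x : cabs x^-1 = (cabs x)^-1.
Proof. by apply: complexI; rewrite fmorphV /= -!cabsE normfV. Qed.

Lemma cabsX x k : cabs (x ^+ k) = cabs x ^+ k.
Proof. by apply: complexI; rewrite rmorphXn /= -!cabsE normrX. Qed.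

Lemma cabsD x y : cabs (x + y) <= cabs x + cabs y.
Proof. by rewrite -lecR rmorphD /= -!cabsE ler_normD. Qed.

Lemma cabsN x : cabs (- x) = cabs x.
Proof. by apply: complexI; rewrite -!cabsE normrN. Qed.

Lemma cabsB x y : cabs (x - y) <= cabs x + cabs y.
Proof. by rewrite -(cabsN y) cabsD. Qed.

Lemma cabs_distrC x y : cabs (x - y) = cabs (y - x).
Proof. by rewrite -cabsN opprB. Qed.

Lemma cabsJ x : cabs x^*%C = cabs x.
Proof. by case: x => a b; rewrite /cabs /= sqrrN. Qed.

Lemma cabs0 : cabs 0 = 0.
Proof. by rewrite /cabs /= expr0n /= addr0 sqrtr0. Qed.

Lemma cabs1 : cabs 1 = 1.
Proof. by rewrite /cabs /= expr1n expr0n /= addr0 sqrtr1. Qed.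

Lemma cabs_real a : cabs a%:C = `|a|.
Proof. by rewrite /cabs /= expr0n /= addr0 sqrtr_sqr. Qed.

Lemma cabs_eq0 z : (cabs z == 0) = (z == 0).
Proof. by rewrite -(inj_eq (@complexI R)) -cabsE normr_eq0. Qed.

Lemma cabs_gt0 z : (0 < cabs z) = (z != 0).
Proof. by rewrite lt_def cabs_ge0 andbT cabs_eq0. Qed.

Lemma cabs_sum (I : Type) (r : seq I) (P : pred I) (F : I -> C) :
  cabs (\sum_(i <- r | P i) F i) <= \sum_(i <- r | P i) cabs (F i).
Proof.
elim/big_rec2: _ => [|i a x _ h]; first by rewrite cabs0.
by apply: le_trans (cabsD _ _) _; rewrite lerD2l.
Qed.

Lemma reD x y : re (x + y) = re x + re y.
Proof. by case: x; case: y. Qed.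

Lemma reN x : re (- x) = - re x.
Proof. by case: x. Qed.

Lemma reB x y : re (x - y) = re x - re y.
Proof. by case: x; case: y. Qed.

Lemma reJ x : re x^*%C = re x.
Proof. by case: x. Qed.

Lemma reMr a x : re (a%:C * x) = a * re x.
Proof. by case: x => u v /=; rewrite mul0r subr0. Qed.

Lemma re_sum (I : Type) (r : seq I) (P : pred I) (F : I -> C) :
  re (\sum_(i <- r | P i) F i) = \sum_(i <- r | P i) re (F i).
Proof.
apply: (big_morph (fun z : C => re z)); last by [].
exact: reD.
Qed.

Lemma re_le_cabs z : re z <= cabs z.
Proof.
apply: le_trans (ler_norm _) _; rewrite -sqrtr_sqr ler_wsqrtr //.
by rewrite lerDl sqr_ge0.
Qed.

Lemma mulJc z : z^*%C * z = (cabs z ^+ 2)%:C.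
Proof. by rewrite mulrC -sqr_normc cabsE rmorphXn. Qed.

Lemma invc_cabs z : z^-1 = (cabs z ^- 2)%:C * z^*%C.
Proof. by rewrite invc_norm cabsE fmorphV rmorphXn. Qed.

Lemma complex_phase z : exists2 u : C, cabs u = 1 & u * z = (cabs z)%:C.
Proof.
have [->|z0] := eqVneq z 0; first by exists 1; rewrite ?cabs1 // mulr0 cabs0.
have cz : cabs z != 0 by rewrite cabs_eq0.
exists (z^*%C / (cabs z)%:C).
  by rewrite cabsM cabsV cabs_real (ger0_norm (cabs_ge0 z)) cabsJ divff.
rewrite mulrAC mulJc -fmorphV -rmorphM /= expr2 -mulrA divff ?mulr1 //.
Qed.

End Modulus.

Section Vectors.
Variable R : realType.
Notation C := R[i].

Definition vn n (x : 'cV[C]_n) : R := Num.sqrt (\sum_i cabs (x i 0) ^+ 2).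

Definition ip n (x y : 'cV[C]_n) : C := (x^t* *m y) 0 0.

Lemma ipE n (x y : 'cV[C]_n) : ip x y = \sum_i (x i 0)^*%C * y i 0.
Proof. by rewrite /ip mxE; apply: eq_bigr => i _; rewrite !mxE. Qed.

Lemma vn_ge0 n (x : 'cV[C]_n) : 0 <= vn x.
Proof. exact: sqrtr_ge0. Qed.

Lemma vn2 n (x : 'cV[C]_n) : vn x ^+ 2 = \sum_i cabs (x i 0) ^+ 2.
Proof. by rewrite sqr_sqrtr // sumr_ge0 // => i _; rewrite sqr_ge0. Qed.

Lemma ipxx n (x : 'cV[C]_n) : ip x x = (vn x ^+ 2)%:C.
Proof.
rewrite ipE vn2 rmorph_sum /=; apply: eq_bigr => i _; exact: mulJc.
Qed.

Lemma ipDl n (x y z : 'cV[C]_n) : ip (x + y) z = ip x z + ip y z.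
Proof. by rewrite /ip linearD /= map_mxD mulmxDl mxE. Qed.

Lemma ipDr n (x y z : 'cV[C]_n) : ip x (y + z) = ip x y + ip x z.
Proof. by rewrite /ip mulmxDr mxE. Qed.

Lemma ipZl n c (x y : 'cV[C]_n) : ip (c *: x) y = c^*%C * ip x y.
Proof. by rewrite /ip linearZ /= map_mxZ -scalemxAl mxE. Qed.

Lemma ipZr n c (x y : 'cV[C]_n) : ip x (c *: y) = c * ip x y.
Proof. by rewrite /ip -scalemxAr mxE. Qed.

Lemma ipNl n (x y : 'cV[C]_n) : ip (- x) y = - ip x y.
Proof. by rewrite -scaleN1r ipZl rmorphN1 mulN1r. Qed.

Lemma ipNr n (x y : 'cV[C]_n) : ip x (- y) = - ip x y.
Proof. by rewrite -scaleN1r ipZr mulN1r. Qed.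

Lemma ipBr n (x y z : 'cV[C]_n) : ip x (y - z) = ip x y - ip x z.
Proof. by rewrite ipDr ipNr. Qed.

Lemma ipJ n (x y : 'cV[C]_n) : (ip x y)^*%C = ip y x.
Proof.
rewrite !ipE rmorph_sum; apply: eq_bigr => i _.
by rewrite rmorphM /= conjcK mulrC.
Qed.

Lemma ctrM m n p (A : 'M[C]_(m, n)) (B : 'M[C]_(n, p)) :
  (A *m B)^t* = B^t* *m A^t*.
Proof. by rewrite trmx_mul map_mxM. Qed.

Lemma ctrD m n (A B : 'M[C]_(m, n)) : (A + B)^t* = A^t* + B^t*.
Proof. by rewrite linearD /= map_mxD. Qed.

Lemma ctrB m n (A B : 'M[C]_(m, n)) : (A - B)^t* = A^t* - B^t*.
Proof. by rewrite linearB /= map_mxB. Qed.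

Lemma ctrZ m n c (A : 'M[C]_(m, n)) : (c *: A)^t* = c^*%C *: A^t*.
Proof. by rewrite linearZ /= map_mxZ. Qed.

Lemma ctr_sum m n (I : Type) (r : seq I) (P : pred I) (F : I -> 'M[C]_(m, n)) :
  (\sum_(i <- r | P i) F i)^t* = \sum_(i <- r | P i) (F i)^t*.
Proof. by rewrite raddf_sum /= raddf_sum. Qed.

Lemma ip_adj m n (A : 'M[C]_(m, n)) (x : 'cV[C]_m) (y : 'cV[C]_n) :
  ip x (A *m y) = ip (A^t* *m x) y.
Proof. by rewrite /ip ctrM trmxCK mulmxA. Qed.

Lemma vn0 n : vn (0 : 'cV[C]_n) = 0.
Proof.
rewrite /vn big1 ?sqrtr0 // => i _; by rewrite mxE cabs0 expr0n.
Qed.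

Lemma vnZ n c (x : 'cV[C]_n) : vn (c *: x) = cabs c * vn x.
Proof.
rewrite /vn -[cabs c](ger0_norm (cabs_ge0 c)) -sqrtr_sqr -sqrtrM ?sqr_ge0 //.
rewrite mulr_sumr; congr Num.sqrt; apply: eq_bigr => i _.
by rewrite mxE cabsM exprMn.
Qed.

Lemma vn_eq0 n (x : 'cV[C]_n) : (vn x == 0) = (x == 0).
Proof.
apply/idP/idP => [/eqP h|/eqP ->]; last by rewrite vn0.
have : vn x ^+ 2 = 0 by rewrite h expr0n.
rewrite vn2 => /eqP; rewrite psumr_eq0; last by move=> i _; rewrite sqr_ge0.
move/allP => hx; apply/eqP/matrixP => i j; rewrite ord1 mxE.
have := hx i (mem_index_enum i); rewrite /= sqrf_eq0 cabs_eq0.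
by move/eqP.
Qed.

Lemma vn_gt0 n (x : 'cV[C]_n) : (0 < vn x) = (x != 0).
Proof. by rewrite lt_def vn_ge0 andbT vn_eq0. Qed.

Lemma vnN n (x : 'cV[C]_n) : vn (- x) = vn x.
Proof. by rewrite -scaleN1r vnZ cabsN cabs1 mul1r. Qed.

(** The squares of [B * a i - P * b i] sum to [B * (A * B - P ^+ 2)]. This settles [B > 0]; for
    [B = 0] all [b i] vanish. *)
Lemma real_cauchy_schwarz (I : finType) (a b : I -> R) :
  (\sum_i a i * b i) ^+ 2 <= (\sum_i a i ^+ 2) * (\sum_i b i ^+ 2).
Proof.
set P := \sum_i a i * b i; set A := \sum_i a i ^+ 2; set B := \sum_i b i ^+ 2.
have B0 : 0 <= B by apply: sumr_ge0 => i _; rewrite sqr_ge0.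
have : 0 <= \sum_i (B * a i - P * b i) ^+ 2.
  by apply: sumr_ge0 => i _; rewrite sqr_ge0.
have -> : \sum_i (B * a i - P * b i) ^+ 2 = B * (A * B - P ^+ 2).
  transitivity (\sum_i (B ^+ 2 * a i ^+ 2 - 2 * B * P * (a i * b i)
                        + P ^+ 2 * b i ^+ 2)).
    by apply: eq_bigr => i _; ring.
  by rewrite big_split sumrB /= -!mulr_sumr -/A -/B -/P; ring.
have [B1|] := ltrP 0 B; first by rewrite pmulr_rge0 // subr_ge0.
move=> B1 _; have BE : B = 0 by apply/le_anti; rewrite B1 B0.
have b0 i : b i = 0.
  apply/eqP; rewrite -sqrf_eq0.
  move/eqP: BE; rewrite psumr_eq0 => [|j _]; last by rewrite sqr_ge0.
  by move/allP/(_ i (mem_index_enum i)).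
have -> : P = 0 by apply: big1 => i _; rewrite b0 mulr0.
by rewrite expr0n /= BE mulr0.
Qed.

Lemma cauchy_schwarz n (x y : 'cV[C]_n) : cabs (ip x y) <= vn x * vn y.
Proof.
rewrite ipE; apply: le_trans (cabs_sum _ _ _) _.
under eq_bigr do rewrite cabsM cabsJ.
rewrite -ler_sqr ?nnegrE ?mulr_ge0 ?vn_ge0 //; last first.
  by apply: sumr_ge0 => i _; rewrite mulr_ge0 ?cabs_ge0.
by rewrite exprMn !vn2 real_cauchy_schwarz.
Qed.

Lemma vnD n (x y : 'cV[C]_n) : vn (x + y) <= vn x + vn y.
Proof.
rewrite -ler_sqr ?nnegrE ?addr_ge0 ?vn_ge0 //.
have -> : vn (x + y) ^+ 2 = re (ip (x + y) (x + y)) by rewrite ipxx.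
rewrite ipDl !ipDr !reD !ipxx -(ipJ x y) reJ /=.
have := le_trans (re_le_cabs _) (cauchy_schwarz x y); nra.
Qed.

Lemma vn_sum n (I : Type) (r : seq I) (P : pred I) (F : I -> 'cV[C]_n) :
  vn (\sum_(i <- r | P i) F i) <= \sum_(i <- r | P i) vn (F i).
Proof.
elim/big_rec2: _ => [|i a x _ h]; first by rewrite vn0.
by apply: le_trans (vnD _ _) _; rewrite lerD2l.
Qed.

Lemma vn_dual n (x : 'cV[C]_n) (b : R) : 0 <= b ->
  (forall y, vn y = 1 -> cabs (ip y x) <= b) -> vn x <= b.
Proof.
move=> b0 h; have [->|x0] := eqVneq x 0; first by rewrite vn0.
have vx : 0 < vn x by rewrite vn_gt0.
have := h ((vn x)^-1%:C *: x); rewrite vnZ cabs_real ger0_norm ?invr_ge0 ?vn_ge0 //.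
rewrite mulVf ?gt_eqF // => /(_ erefl).
rewrite ipZl ipxx conjc_real -rmorphM /= cabs_real ger0_norm; last first.
  by rewrite mulr_ge0 ?invr_ge0 ?sqr_ge0 ?vn_ge0.
by rewrite expr2 mulKf // gt_eqF.
Qed.

(** The complex estimates need only upper bounds of operator norms, so a relation takes the place of
    a supremum; it is meaningful for empty dimensions too. *)
Definition opb m n (A : 'M[C]_(m, n)) (c : R) :=
  forall x : 'cV[C]_n, vn (A *m x) <= c * vn x.

Lemma opb_le m n (A : 'M[C]_(m, n)) c d : opb A c -> c <= d -> opb A d.
Proof.
by move=> h cd x; apply: le_trans (h x) _; rewrite ler_wpM2r ?vn_ge0.
Qed.

Lemma opbD m n (A B : 'M[C]_(m, n)) c d : opb A c -> opb B d -> opb (A + B) (c + d).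
Proof.
move=> hA hB x; rewrite mulmxDl; apply: le_trans (vnD _ _) _.
by rewrite mulrDl lerD.
Qed.

Lemma opbN m n (A : 'M[C]_(m, n)) c : opb A c -> opb (- A) c.
Proof. by move=> hA x; rewrite mulNmx vnN. Qed.

Lemma opbB m n (A B : 'M[C]_(m, n)) c d : opb A c -> opb B d -> opb (A - B) (c + d).
Proof. by move=> hA hB; apply: opbD => //; apply: opbN. Qed.

Lemma opbM m n p (A : 'M[C]_(m, n)) (B : 'M[C]_(n, p)) c d :
  0 <= c -> opb A c -> opb B d -> opb (A *m B) (c * d).
Proof.
move=> c0 hA hB x; rewrite -mulmxA; apply: le_trans (hA _) _.
by rewrite -mulrA ler_wpM2l.
Qed.

Lemma opbZ m n (A : 'M[C]_(m, n)) z c : opb A c -> opb (z *: A) (cabs z * c).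
Proof.
by move=> hA x; rewrite -scalemxAl vnZ -mulrA ler_wpM2l ?cabs_ge0.
Qed.

Lemma opb_scalar n (z : C) : opb (z%:M : 'M[C]_n) (cabs z).
Proof. by move=> x; rewrite mul_scalar_mx vnZ. Qed.

Lemma opb0 m n : opb (0 : 'M[C]_(m, n)) 0.
Proof. by move=> x; rewrite mul0mx mul0r vn0. Qed.

Lemma opb_sum m n (I : Type) (r : seq I) (P : pred I) (F : I -> 'M[C]_(m, n))
    (c : I -> R) :
  (forall i, P i -> opb (F i) (c i)) ->
  opb (\sum_(i <- r | P i) F i) (\sum_(i <- r | P i) c i).
Proof.
move=> h; elim/big_rec2: _ => [|i a x Pi hx]; first exact: opb0.
by apply: opbD => //; apply: h.
Qed.

Lemma opb_adj m n (A : 'M[C]_(m, n)) c : 0 <= c -> opb A c -> opb (A^t*) c.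
Proof.
move=> c0 hA y; apply: vn_dual; first by rewrite mulr_ge0 ?vn_ge0.
move=> x x1; rewrite ip_adj trmxCK.
apply: le_trans (cauchy_schwarz _ _) _; rewrite ler_wpM2r ?vn_ge0 //.
by have := hA x; rewrite x1 mulr1.
Qed.

Lemma opb_exists m n (A : 'M[C]_(m, n)) : exists2 c, 0 <= c & opb A c.
Proof.
exists (\sum_j vn (col j A)); first by apply: sumr_ge0 => j _; rewrite vn_ge0.
move=> x.
have -> : A *m x = \sum_j x j 0 *: col j A.
  apply/matrixP => i k; rewrite ord1 mxE summxE.
  by apply: eq_bigr => j _; rewrite !mxE mulrC.
apply: le_trans (vn_sum _ _ _) _; rewrite mulr_suml; apply: ler_sum => j _.
rewrite vnZ mulrC ler_wpM2l ?vn_ge0 //.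
rewrite -ler_sqr ?nnegrE ?cabs_ge0 ?vn_ge0 // vn2 (bigD1 j) //= lerDl.
by apply: sumr_ge0 => i _; rewrite sqr_ge0.
Qed.

Lemma opb_unit m n (A : 'M[C]_(m, n)) c :
  (forall x, vn x = 1 -> vn (A *m x) <= c) -> opb A c.
Proof.
move=> h x; have [->|x0] := eqVneq x 0; first by rewrite mulmx0 !vn0 mulr0.
have vx : 0 < vn x by rewrite vn_gt0.
have := h ((vn x)^-1%:C *: x); rewrite vnZ cabs_real ger0_norm ?invr_ge0 ?vn_ge0 //.
rewrite mulVf ?gt_eqF // => /(_ erefl); rewrite -scalemxAr vnZ cabs_real.
by rewrite ger0_norm ?invr_ge0 ?vn_ge0 // ler_pdivrMl // mulrC.
Qed.

End Vectors.

(** * Riemann sums of resolvents along polygons *)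

Section Resolvents.
Variable R : realType.
Notation C := R[i].
Implicit Types (O : set C) (z : C).

Definition cvx O := forall z1 z2 (t : R), O z1 -> O z2 -> 0 <= t <= 1 ->
  O (t%:C * z1 + (1 - t)%:C * z2).

Definition num_in n (A : 'M[C]_n) O := forall x, vn x = 1 -> O (ip x (A *m x)).

(** For a unit [nv] and positive [d], the line through [s] with outer normal [nv] has all of [O] on
    its inner side, at distance at least [d]. *)
Definition sep O (nv : C) (s : C) (d : R) :=
  forall z, O z -> d <= re (nv^*%C * (s - z)).

(** Boundedness below makes the kernel trivial, which in finite dimension is invertibility. *)
Lemma lower_bound_inv n (B : 'M[C]_n.+1) (d : R) : 0 < d ->
  (forall x : 'cV[C]_n.+1, vn x = 1 -> d <= vn (B *m x)) ->
  B \is a GRing.unit /\ opb B^-1 d^-1.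
Proof.
move=> d0 h.
have hB (x : 'cV[C]_n.+1) : d * vn x <= vn (B *m x).
  have [->|x0] := eqVneq x 0; first by rewrite mulmx0 !vn0 mulr0.
  have vx : 0 < vn x by rewrite vn_gt0.
  have := h ((vn x)^-1%:C *: x).
  rewrite vnZ cabs_real ger0_norm ?invr_ge0 ?vn_ge0 //.
  rewrite mulVf ?gt_eqF // => /(_ erefl); rewrite -scalemxAr vnZ cabs_real.
  by rewrite ger0_norm ?invr_ge0 ?vn_ge0 // ler_pdivlMl // mulrC.
have uB : B \is a GRing.unit.
  rewrite -[_ \is a _]/(B \in unitmx) unitmxE unitfE -det_tr.
  apply/det0P => -[v v0 hv].
  have := hB v^T; rewrite -[B *m _]trmxK trmx_mul trmxK hv trmx0 vn0.
  rewrite leNgt => /negP; apply; rewrite mulr_gt0 // vn_gt0.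
  by rewrite -(inj_eq (@trmx_inj _ _ _)) trmxK trmx0.
split=> // x; have := hB (B^-1 *m x).
rewrite mulmxA -[B *m B^-1]/(B * B^-1) divrr // mul1mx.
by rewrite -ler_pdivlMl.
Qed.

(** For a unit vector [x], [ip x ((s%:M - A) *m x)] is [s] minus a point of the numerical range, so
    separation bounds its modulus below by [d], and Cauchy--Schwarz transfers this to the norm. *)
Lemma resolvent_bound n (A : 'M[C]_n.+1) O nv s d : 0 < d -> cabs nv = 1 ->
  sep O nv s d -> num_in A O ->
  (s%:M - A) \is a GRing.unit /\ opb (s%:M - A)^-1 d^-1.
Proof.
move=> d0 nv1 hs hA; apply: lower_bound_inv => // x x1.
apply: le_trans (hs _ (hA x x1)) _; apply: le_trans (re_le_cabs _) _.
rewrite cabsM cabsJ nv1 mul1r.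
have -> : s - ip x (A *m x) = ip x ((s%:M - A) *m x).
  by rewrite mulmxBl mul_scalar_mx ipBr ipZr ipxx x1 expr1n mulr1.
by apply: le_trans (cauchy_schwarz _ _) _; rewrite x1 mul1r.
Qed.

Lemma sep_dist O nv s d z : cabs nv = 1 -> sep O nv s d -> O z -> d <= cabs (s - z).
Proof.
move=> nv1 hs Oz; apply: le_trans (hs _ Oz) _; apply: le_trans (re_le_cabs _) _.
by rewrite cabsM cabsJ nv1 mul1r.
Qed.

Lemma num_in_line n (A : 'M[C]_n.+1) O z0 (t : R) : cvx O -> O z0 -> 0 <= t <= 1 ->
  num_in A O -> num_in (z0%:M + t%:C *: (A - z0%:M)) O.
Proof.
move=> cO Oz t01 hA x x1.
have -> : ip x ((z0%:M + t%:C *: (A - z0%:M)) *m x)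
    = t%:C * ip x (A *m x) + (1 - t)%:C * z0.
  rewrite mulmxDl -scalemxAl mulmxBl !mul_scalar_mx !(ipDr, ipZr, ipNr).
  by rewrite ipxx x1 expr1n rmorphB rmorph1; ring.
by apply: cO => //; apply: hA.
Qed.

Lemma invrB_eq n (X Y : 'M[C]_n.+1) : X \is a GRing.unit -> Y \is a GRing.unit ->
  X^-1 - Y^-1 = X^-1 * (Y - X) * Y^-1.
Proof.
by move=> uX uY; rewrite mulrBr mulVr // mulrBl mul1r mulrK.
Qed.

(* A closed polygon, cut into the steps [s j -> s' j] indexed by J, whose
   supporting line at [s j] has unit outer normal [nv j]; [r j] is the length of
   the step. Closedness is expressed by the telescoping property. *)
Record contour O (d h L D : R) (J : finType) (s s' nv : J -> C) (r : J -> R)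
    : Prop := Contour {
  ct_tele : forall (V : zmodType) (F : C -> V), \sum_j F (s' j) = \sum_j F (s j);
  ct_h : 0 <= h;
  ct_step : forall j, s' j = s j + 'i%C * ((r j)%:C * nv j);
  ct_nv : forall j, cabs (nv j) = 1;
  ct_r : forall j, 0 <= r j <= h;
  ct_len : \sum_j r j <= L;
  ct_bnd : forall j, cabs (s j) <= D /\ cabs (s' j) <= D;
  ct_sep : forall j, sep O (nv j) (s j) d }.

Lemma opbMr n (A B : 'M[C]_n.+1) c e :
  0 <= c -> opb A c -> opb B e -> opb (A * B) (c * e).
Proof. exact: opbM. Qed.

Section Contour.
Variables (O : set C) (d h L D : R) (J : finType).
Variables (s s' nv : J -> C) (r : J -> R).
Hypothesis ct : contour O d h L D s s' nv r.
Hypothesis d0 : 0 < d.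

Let w j := (r j)%:C * nv j.

Lemma ct_w j : cabs (w j) = r j.
Proof.
have /andP[r0 _] := ct_r ct j.
by rewrite /w cabsM cabs_real (ct_nv ct) mulr1 ger0_norm.
Qed.

(** The step from [s j] to [s' j] is orthogonal to [nv j], so it stays on the same line. *)
Lemma ct_sep' j : sep O (nv j) (s' j) d.
Proof.
move=> z Oz; rewrite (ct_step ct) addrAC mulrDr reD.
have -> : (nv j)^*%C * ('i%C * ((r j)%:C * nv j)) =
    ((r j) * (cabs (nv j)) ^+ 2)%:C * 'i%C.
  by rewrite rmorphM /= -mulJc; ring.
by rewrite reMr [re _]/= mulr0 addr0; apply: (ct_sep ct).
Qed.

(** The matrix moves from [z0] to [A] in [M] steps. One step changes the sum by [1 / M] times a
    weighted sum of [R1 * B * R0]. With the resolvent [R0'] at the end of the contour step in place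
    of [R1], that sum telescopes to 0, and the replacement costs [h + b / M] times two resolvent
    bounds. *)
Lemma resolvent_homotopy n (A : 'M[C]_n.+1) z0 (b : R) (M : nat) :
  cvx O -> O z0 -> num_in A O -> 0 <= b -> opb (A - z0%:M) b -> (0 < M)%N ->
  opb (\sum_j w j *: ((s j)%:M - A)^-1 - (\sum_j w j / (s j - z0))%:M)
    (L * b / d ^+ 3 * (h + b / M%:R)).
Proof.
move=> cO Oz hA b0 hb M0.
pose B := A - z0%:M.
pose At (k : nat) : 'M[C]_n.+1 := z0%:M + (k%:R / M%:R : R)%:C *: B.
have M0' : 0 < M%:R :> R by rewrite ltr0n.
have AtW k : (k <= M)%N -> num_in (At k) O.
  move=> kM; apply: num_in_line => //.
  by rewrite divr_ge0 ?ler0n //= ler_pdivrMr // mul1r ler_nat.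
pose u k := \sum_j w j *: ((s j)%:M - At k)^-1.
have u0 : u 0%N = (\sum_j w j / (s j - z0))%:M.
  rewrite /u raddf_sum /=; apply: eq_bigr => j _.
  rewrite /At mul0r scale0r addr0 -raddfB /= scalar_mxM -mul_scalar_mx.
  congr (_ *m _); have nz : s j - z0 != 0.
    rewrite -cabs_gt0; apply: lt_le_trans d0 _.
    exact: sep_dist (ct_nv ct j) (ct_sep ct j) Oz.
  have un : ((s j - z0)%:M : 'M[C]_n.+1) \is a GRing.unit.
    by rewrite -[_ \is a _]/(_ \in unitmx) unitmxE det_scalar unitrX // unitfE.
  apply: (mulrI un); rewrite divrr //.
  by rewrite -[_ * _]/(_ *m _) -scalar_mxM divff.
have uM : u M = \sum_j w j *: ((s j)%:M - A)^-1.
  apply: eq_bigr => j _; rewrite /At divff ?gt_eqF // rmorph1 scale1r /B.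
  by rewrite [z0%:M + _]addrC subrK.
rewrite -u0 -uM -(telescope_sumr _ (leq0n M)) big_mkord.
have step (k : 'I_M) : opb (u k.+1 - u k) (L * b / d ^+ 3 * (h + b / M%:R) / M%:R).
  have rb j : (forall k, (k <= M)%N -> (s j)%:M - At k \is a GRing.unit
      /\ opb ((s j)%:M - At k)^-1 d^-1).
    by move=> l lM; exact: resolvent_bound d0 (ct_nv ct j) (ct_sep ct j) (AtW _ lM).
  have rb' j : (forall k, (k <= M)%N -> ((s' j)%:M - At k) \is a GRing.unit
      /\ opb ((s' j)%:M - At k)^-1 d^-1).
    by move=> l lM; exact: resolvent_bound d0 (ct_nv ct j) (ct_sep' _) (AtW _ lM).
  have kM := ltn_ord k; have kM' := ltnW kM.
  pose e : C := (M%:R^-1 : R)%:C.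
  have AtB : At k.+1 - At k = e *: B.
    rewrite /At opprD addrACA subrr add0r -scalerBl -rmorphB /= -mulrBl.
    by rewrite -natrB // subSnn mul1r.
  (* Times ['i], each term is [B] times the drop of the resolvent from [s j] to [s' j], so
     closedness of the contour makes the sum vanish. *)
  have tele0 : \sum_j w j *: (((s' j)%:M - At k)^-1 * B * ((s j)%:M - At k)^-1) = 0.
    have cB j : GRing.comm B ((s' j)%:M - At k)^-1.
      apply: commrV; apply: commrB; first exact: comm_mx_scalar.
      apply: commrD; first exact: comm_mx_scalar.
      by rewrite /GRing.comm -scalerAr -scalerAl.
    have E j : 'i%C *: (w j *: (((s' j)%:M - At k)^-1 * B * ((s j)%:M - At k)^-1))
       = B * (((s j)%:M - At k)^-1 - ((s' j)%:M - At k)^-1).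
      have [us _] := rb j _ kM'; have [us' _] := rb' j _ kM'.
      have st : (s' j)%:M - At k - ((s j)%:M - At k)
          = ('i%C * w j) *: (1 : 'M[C]_n.+1).
        by rewrite (ct_step ct) raddfD /= opprB addrA subrK addrAC subrr add0r
                   -scalemx1.
      have -> : ((s j)%:M - At k)^-1 - ((s' j)%:M - At k)^-1
          = ((s' j)%:M - At k)^-1 * (('i%C * w j) *: 1) * ((s j)%:M - At k)^-1.
        by rewrite -st -[LHS]opprB invrB_eq // -mulNr -mulrN opprB.
      by rewrite -scalerAr mulr1 -scalerAl -scalerAr scalerA [B * (_ / _)]mulrA (cB j).
    have i0 : 'i%C != 0 :> C by rewrite eq_complex /= oner_eq0 andbF.
    apply: (scalerI i0); rewrite scaler0 scaler_sumr.
    under eq_bigr do rewrite E.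
    rewrite -mulr_sumr sumrB.
    by rewrite (ct_tele ct (fun z => (z%:M - At k)^-1)) subrr mulr0.
  pose R1 j := ((s j)%:M - At k.+1)^-1; pose R0 j := ((s j)%:M - At k)^-1.
  pose R0' j := ((s' j)%:M - At k)^-1.
  (* Subtracting the vanishing sum creates the small difference [R1 j - R0' j]. *)
  have -> : u k.+1 - u k = \sum_j e *: (w j *: ((R1 j - R0' j) * B * R0 j)).
    transitivity (\sum_j (w j *: R1 j - w j *: R0 j) -
       e *: \sum_j w j *: (R0' j * B * R0 j)).
      by rewrite tele0 scaler0 subr0 sumrB.
    rewrite scaler_sumr -sumrB; apply: eq_bigr => j _.
    have [us _] := rb j _ kM'; have [us' _] := rb j _ kM.
    have -> : (R1 j - R0' j) * B * R0 j = R1 j * B * R0 j - R0' j * B * R0 j.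
      by rewrite mulrBl [LHS]mulrBl.
    rewrite [in RHS]scalerBr [in RHS]scalerBr -[w j *: R1 j - _]scalerBr.
    congr (_ - _).
    have -> : R1 j - R0 j = R1 j * (e *: B) * R0 j.
      have YX : (s j)%:M - At k - ((s j)%:M - At k.+1) = e *: B.
        by rewrite -AtB opprB [LHS]addrC addrA subrK.
      by rewrite /R1 /R0 (invrB_eq us' us) YX.
    by rewrite -scalerAr -scalerAl !scalerA [w j * e]mulrC.
  have -> : L * b / d ^+ 3 * (h + b / M%:R) / M%:R
      = cabs e * (L * (d^-1 * (h + b / M%:R) * d^-1 * b * d^-1)).
  rewrite /e cabs_real ger0_norm ?invr_ge0 ?ler0n //.
    by field; rewrite !gt_eqF.
  have di : 0 <= d^-1 by rewrite invr_ge0 ltW.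
  have hM : 0 <= h + b / M%:R.
    by rewrite addr_ge0 ?(ct_h ct) // divr_ge0 // ler0n.
  apply: (@opb_le _ _ _ _
    (\sum_j cabs e * (r j * (d^-1 * (h + b / M%:R) * d^-1 * b * d^-1)))); last first.
    rewrite -mulr_sumr ler_wpM2l ?cabs_ge0 // -mulr_suml.
    by rewrite ler_wpM2r ?(ct_len ct) // !mulr_ge0.
  apply: opb_sum => j _; rewrite -(ct_w j).
  have /andP[rj0 rjh] := ct_r ct j.
  have [us ns] := rb j _ kM; have [us' ns'] := rb' j _ kM'.
  have [_ ns0] := rb j _ kM'.
  have RR : R1 j - R0' j = R1 j * (('i%C * w j)%:M + e *: B) * R0' j.
    rewrite /R1 /R0' (invrB_eq us us').
    have -> // : (s' j)%:M - At k - ((s j)%:M - At k.+1)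
     = ('i%C * w j)%:M + e *: B :> 'M[C]_n.+1.
    rewrite -AtB (ct_step ct j : s' j = s j + 'i%C * w j) raddfD /=.
    move: ('i%C * _)%:M (s j)%:M (At k) (At k.+1) => X Y a' b'.
    rewrite opprB [Y + X]addrC -!addrA. congr (X + _).
    by rewrite [LHS]addrCA [Y + (_ - _)]addrCA subrr addr0 addrC.
  have f0 : opb (('i%C * w j)%:M + e *: B) (h + b / M%:R).
    apply: opbD.
      apply: (@opb_le _ _ _ _ (cabs ('i%C * w j))); first exact: opb_scalar.
      by rewrite cabsM ct_w /cabs /= expr0n expr1n add0r sqrtr1 mul1r.
    have := opbZ e hb.
    by rewrite mulrC /e cabs_real ger0_norm ?invr_ge0 ?ler0n.
  have f1 := opbMr di ns f0.
  have f2 := opbMr (mulr_ge0 di hM) f1 ns'.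
  rewrite RR; apply: opbZ; apply: opbZ.
  have f3 := opbMr (mulr_ge0 (mulr_ge0 di hM) di) f2 hb.
  exact: (opbMr (mulr_ge0 (mulr_ge0 (mulr_ge0 di hM) di) b0) f3 ns0).
have -> : L * b / d ^+ 3 * (h + b / M%:R) =
    \sum_(k < M) L * b / d ^+ 3 * (h + b / M%:R) / M%:R.
  by rewrite sumr_const card_ord -[RHS]mulr_natr divfK // gt_eqF.
by apply: opb_sum => k _; apply: step.
Qed.
End Contour.
End Resolvents.

(** * The Cauchy formula for Riemann sums, with uniform error bounds *)

Section CauchyFormula.
Variable R : realType.
Notation C := R[i].
Implicit Types (O : set C) (z : C) (Q : {poly C}).

Lemma mul_scalar_mxr n c (A : 'M[C]_n.+1) : c%:M * A = c *: A.
Proof. exact: mul_scalar_mx. Qed.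

(** [K] is fixed before the dimension and the matrix; this uniformity lets the Cauchy formula hold
    with one error constant for [A] and for scalars. *)
Lemma poly_opb Q (D : R) : 0 <= D ->
  exists2 K, 0 <= K & forall n (A : 'M[C]_n.+1), opb A D -> opb (horner_mx A Q) K.
Proof.
move=> D0; elim/poly_ind: Q => [|Q c [K K0 hK]].
  by exists 0 => // n A _; rewrite rmorph0; apply: opb0.
exists (K * D + cabs c); first by rewrite addr_ge0 ?mulr_ge0 ?cabs_ge0.
move=> n A hA; rewrite rmorphD rmorphM /= horner_mx_X horner_mx_C.
apply: opbD; last exact: opb_scalar.
by apply: opbMr => //; apply: hK.
Qed.

Lemma poly_bounded Q (D : R) : 0 <= D ->
  exists2 K, 0 <= K & forall z, cabs z <= D -> cabs Q.[z] <= K.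
Proof.
move=> D0; elim/poly_ind: Q => [|Q c [K K0 hK]].
  by exists 0 => // z _; rewrite horner0 cabs0.
exists (K * D + cabs c); first by rewrite addr_ge0 ?mulr_ge0 ?cabs_ge0.
move=> z hz; rewrite hornerMXaddC; apply: le_trans (cabsD _ _) _.
by rewrite lerD2r cabsM ler_pM ?cabs_ge0 // hK.
Qed.

Lemma poly_lipschitz Q (D : R) : 0 <= D ->
  exists2 K, 0 <= K & forall a b, cabs a <= D -> cabs b <= D ->
    cabs (Q.[b] - Q.[a]) <= K * cabs (b - a).
Proof.
move=> D0; elim/poly_ind: Q => [|Q c [K K0 hK]].
  by exists 0 => // a b _ _; rewrite !horner0 subrr cabs0 mul0r.
have [B B0 hB] := poly_bounded Q D0.
exists (K * D + B); first by rewrite addr_ge0 ?mulr_ge0.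
move=> a b ha hb; rewrite !hornerMXaddC.
have -> : Q.[b] * b + c - (Q.[a] * a + c) = (Q.[b] - Q.[a]) * b + Q.[a] * (b - a).
  by ring.
apply: le_trans (cabsD _ _) _; rewrite !cabsM mulrDl mulrAC.
have h1 : cabs (Q.[b] - Q.[a]) * cabs b <= K * cabs (b - a) * D.
  by rewrite ler_pM ?cabs_ge0 // hK.
have h2 : cabs Q.[a] * cabs (b - a) <= B * cabs (b - a).
  by rewrite ler_wpM2r ?cabs_ge0 // hB.
exact: lerD.
Qed.

Lemma poly_taylor Q (D : R) : 0 <= D ->
  exists2 K, 0 <= K & forall a b, cabs a <= D -> cabs b <= D ->
    cabs (Q.[b] - Q.[a] - (b - a) * Q^`().[a]) <= K * cabs (b - a) ^+ 2.
Proof.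
move=> D0; elim/poly_ind: Q => [|Q c [K K0 hK]].
  by exists 0 => // a b _ _; rewrite deriv0 !horner0 mulr0 !subr0 cabs0 mul0r.
have [B B0 hB] := poly_bounded Q^`() D0.
exists (K * D + B); first by rewrite addr_ge0 ?mulr_ge0.
move=> a b ha hb; rewrite derivMXaddC !hornerMXaddC hornerD hornerMX.
set T := Q.[b] - Q.[a] - (b - a) * Q^`().[a].
have -> : Q.[b] * b + c - (Q.[a] * a + c) - (b - a) * (Q.[a] + Q^`().[a] * a)
    = T * b + Q^`().[a] * (b - a) ^+ 2.
  by rewrite /T; ring.
apply: le_trans (cabsD _ _) _; rewrite cabsM.
rewrite [cabs (_ * _ ^+ 2)]cabsM cabsX mulrDl mulrAC.
have h1 : cabs T * cabs b <= K * cabs (b - a) ^+ 2 * D.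
  by rewrite ler_pM ?cabs_ge0 // hK.
have h2 : cabs Q^`().[a] * cabs (b - a) ^+ 2 <= B * cabs (b - a) ^+ 2.
  by rewrite ler_wpM2r ?sqr_ge0 // hB.
exact: lerD.
Qed.

Lemma poly_primitive Q : exists P : {poly C}, P^`() = Q.
Proof.
exists (\poly_(i < (size Q).+1) (Q`_i.-1 / i%:R)).
apply/polyP => i; rewrite coef_deriv coef_poly ltnS /=.
case: ltnP => [_|/leq_sizeP ->//]; last by rewrite mul0rn.
by rewrite -[LHS]mulr_natr divfK // pnatr_eq0.
Qed.

(** With a primitive [P] of [Q], the increments of [P] along the contour telescope to 0, and each
    differs from ['i] times a term of the sum by a Taylor remainder of order
    [r j ^+ 2 <= h * r j]. *)
Lemma contour_poly_small Q (D : R) : 0 <= D ->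
  exists2 K, 0 <= K & forall O (d h L : R) (J : finType) (s s' nv : J -> C)
    (r : J -> R), contour O d h L D s s' nv r ->
    cabs (\sum_j (r j)%:C * nv j * Q.[s j]) <= K * h * L.
Proof.
move=> D0; have [P PQ] := poly_primitive Q.
have [K K0 hK] := poly_taylor P D0; exists K => // O d h L J s s' nv r ct.
have i1 : cabs 'i%C = 1 :> R by rewrite /cabs /= expr0n expr1n add0r sqrtr1.
have -> : cabs (\sum_j (r j)%:C * nv j * Q.[s j])
    = cabs (\sum_j (P.[s' j] - P.[s j] - (s' j - s j) * Q.[s j])).
  rewrite sumrB sumrB (ct_tele ct (fun z => P.[z])) subrr add0r cabsN.
  rewrite -[LHS]mul1r -i1 -cabsM mulr_sumr; congr cabs.
  apply: eq_bigr => j _; rewrite (ct_step ct) [s j + _]addrC addrK.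
  by rewrite mulrA.
apply: le_trans (cabs_sum _ _ _) _.
apply: (@le_trans _ _ (\sum_j K * h * r j)); last first.
  rewrite -mulr_sumr ler_wpM2l ?(ct_len ct) // mulr_ge0 //.
  exact: (ct_h ct).
apply: ler_sum => j _; have /andP[r0 rh] := ct_r ct j.
have [sD sD'] := ct_bnd ct j.
have st : s' j - s j = 'i%C * ((r j)%:C * nv j).
  by rewrite (ct_step ct) addrAC subrr add0r.
have cst : cabs (s' j - s j) = r j.
  by rewrite st !cabsM i1 mul1r (ct_nv ct) mulr1 cabs_real ger0_norm.
rewrite -PQ.
apply: le_trans (hK _ _ sD sD') _; rewrite cst expr2 mulrA.
by rewrite ler_wpM2r // ler_wpM2l.
Qed.

(** Induction along Horner's scheme: [s (s - A)^-1 = 1 + A (s - A)^-1] turns a factor [s j] into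
    [A], and the term 1 leaves a Riemann sum of a polynomial over a closed contour, which is
    small. *)
Lemma contour_resolvent_poly Q (d L D : R) : 0 < d -> 0 <= D -> 0 <= L ->
  exists2 K, 0 <= K & forall O h (J : finType) (s s' nv : J -> C)
    (r : J -> R), contour O d h L D s s' nv r ->
    forall n (A : 'M[C]_n.+1), num_in A O -> opb A D ->
    opb (\sum_j ((r j)%:C * nv j * Q.[s j]) *: ((s j)%:M - A)^-1
      - horner_mx A Q * \sum_j ((r j)%:C * nv j) *: ((s j)%:M - A)^-1) (K * h).
Proof.
move=> d0 D0 L0; elim/poly_ind: Q => [|Q c [K K0 hK]].
  exists 0 => // O h J s s' nv r ct n A _ _; rewrite mul0r.
  rewrite rmorph0 mul0r subr0 big1; first exact: opb0.
  by move=> j _; rewrite horner0 mulr0 scale0r.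
have [K1 K10 hK1] := contour_poly_small Q D0.
exists (K1 * L + D * K); first by rewrite addr_ge0 // mulr_ge0.
move=> O h J s s' nv r ct n A An AD.
rewrite rmorphD rmorphM /= horner_mx_X horner_mx_C.
set u := \sum_j ((r j)%:C * nv j) *: _.
have {hK} h1 := hK _ _ _ _ _ _ _ ct _ _ An AD; move: h1.
set v := \sum_j ((r j)%:C * nv j * Q.[s j]) *: _ => h1.
have -> : \sum_j ((r j)%:C * nv j * (Q * 'X + c%:P).[s j]) *: ((s j)%:M - A)^-1
  - (horner_mx A Q * A + c%:M) * u =
  (\sum_j (r j)%:C * nv j * Q.[s j])%:M + A * (v - horner_mx A Q * u).
  have -> : \sum_j ((r j)%:C * nv j * (Q * 'X + c%:P).[s j]) *: ((s j)%:M - A)^-1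
     = (\sum_j (r j)%:C * nv j * Q.[s j])%:M + A * v + c *: u.
    rewrite raddf_sum /u /v scaler_sumr mulr_sumr -!big_split /=.
    apply: eq_bigr => j _; rewrite hornerMXaddC.
    have [us _] := resolvent_bound d0 (ct_nv ct j) (ct_sep ct j) An.
    have sR : s j *: ((s j)%:M - A)^-1 = 1 + A * ((s j)%:M - A)^-1.
      rewrite -[LHS]mul_scalar_mxr -{1}[(s j)%:M](subrK A).
      by rewrite mulrDl mulrV.
    rewrite mulrDr mulrA scalerDl -[_ *: _^-1 in LHS]scalerA sR.
    rewrite scalerDr scalemx1 -scalerAr scalerA [c * _]mulrC.
    by [].
  rewrite mulrDl mul_scalar_mxr mulrBr.
  have cA : horner_mx A Q * A = A * horner_mx A Q.
    exact: comm_horner_mx.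
  rewrite cA mulrA.
  move: (c *: u) (A * v) (A * _ * u) (_%:M) => X Y Z T.
  by rewrite opprD [- Z - X]addrC addrA addrK addrA.
rewrite mulrDl; apply: opbD.
  apply: (@opb_le _ _ _ _ (cabs (\sum_j (r j)%:C * nv j * Q.[s j]))).
    exact: opb_scalar.
  by rewrite mulrAC; apply: (hK1 _ _ _ _ _ _ _ _ _ ct).
by rewrite -mulrA; apply: opbMr.
Qed.

(** The factor in front of [horner_mx A Q] plays the role of 2 pi and depends only on the contour
    and [z0]. Its value is never computed; a lower bound for its real part is enough later. *)
Lemma cauchy_formula Q (d L D : R) : 0 < d -> 0 <= D -> 0 <= L ->
  exists2 K, 0 <= K & forall O h (J : finType) (s s' nv : J -> C)
    (r : J -> R), contour O d h L D s s' nv r -> 0 < h -> cvx O ->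
    forall z0, O z0 -> cabs z0 <= D ->
    forall n (A : 'M[C]_n.+1), num_in A O -> opb A D ->
    opb (\sum_j ((r j)%:C * nv j * Q.[s j]) *: ((s j)%:M - A)^-1
      - (\sum_j (r j)%:C * nv j / (s j - z0)) *: horner_mx A Q) (K * h).
Proof.
move=> d0 D0 L0; have [K K0 hK] := contour_resolvent_poly Q d0 D0 L0.
have [K1 K10 hK1] := poly_opb Q D0.
pose e := L * (D + D) / d ^+ 3.
have e0 : 0 <= e.
  apply: divr_ge0; last by rewrite exprn_ge0 // ltW.
  by apply: mulr_ge0 => //; apply: addr_ge0.
exists (K + K1 * (e * 2)).
  by apply: addr_ge0 => //; apply: mulr_ge0 => //; apply: mulr_ge0.
move=> O h J s s' nv r ct h0 cO z0 Oz z0D n A An AD.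
have h1 := hK _ _ _ _ _ _ _ ct _ _ An AD.
have zD : opb (A - z0%:M) (D + D).
  by apply: opbB => //; apply: opb_le z0D; apply: opb_scalar.
(* Enough homotopy steps to bring their contribution [(D + D) / M] below [h]. *)
pose M := (Num.bound ((D + D) / h)).+1.
have hM : (D + D) / M%:R <= h.
  rewrite ler_pdivrMr ?ltr0n // -ler_pdivrMl // mulrC.
  apply: ltW; apply: lt_le_trans (archi_boundP _) _.
    by rewrite divr_ge0 ?addr_ge0 // ltW.
  by rewrite ler_nat.
have h2 := resolvent_homotopy ct d0 cO Oz An (addr_ge0 D0 D0) zD (ltn0Sn _ : 0 < M)%N.
have h3 : opb (\sum_j ((r j)%:C * nv j) *: ((s j)%:M - A)^-1
    - (\sum_j (r j)%:C * nv j / (s j - z0))%:M) (e * 2 * h).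
  apply: opb_le h2 _; rewrite -/e -[e * 2 * h]mulrA ler_wpM2l //.
  by rewrite [2 * h]mulr_natl mulr2n lerD2l.
set c := \sum_j _ / _ in h3 *.
set u := \sum_j _ *: _ in h3 h1 *.
set v := \sum_j _ *: _ in h1 *.
have -> : v - c *: horner_mx A Q =
    (v - horner_mx A Q * u) + horner_mx A Q * (u - c%:M).
  rewrite mulrBr addrA subrK; congr (_ - _).
  by rewrite -scalemx1 -scalerAr mulr1.
rewrite mulrDl -mulrA; apply: opbD => //.
apply: opbMr => //; exact: hK1.
Qed.

End CauchyFormula.

(** * Approximation by polynomials *)

Section Runge.
Variable R : realType.
Notation C := R[i].
Implicit Types (O : set C) (f g : C -> C).

Lemma hmxD n (A : 'M[C]_n.+1) (P Q : {poly C}) :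
  horner_mx A (P + Q) = horner_mx A P + horner_mx A Q.
Proof. exact: rmorphD. Qed.

Lemma hmxB n (A : 'M[C]_n.+1) (P Q : {poly C}) :
  horner_mx A (P - Q) = horner_mx A P - horner_mx A Q.
Proof. exact: rmorphB. Qed.

Lemma hmxM n (A : 'M[C]_n.+1) (P Q : {poly C}) :
  horner_mx A (P * Q) = horner_mx A P * horner_mx A Q.
Proof. exact: rmorphM. Qed.

Lemma cabsB2 (x y : C) :
  cabs (x - y) ^+ 2 = cabs x ^+ 2 - 2 * re (y^*%C * x) + cabs y ^+ 2.
Proof.
by case: x => a b; case: y => u v; rewrite !cabs2 /re /=; ring.
Qed.

Lemma opb_closed m n (A : 'M[C]_(m, n)) (k a : R) : 0 <= a ->
  (forall e, 0 < e -> opb A (k + a * e)) -> opb A k.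
Proof.
move=> a0 h x; apply/ler_addgt0Pr => e e0.
pose b := a * vn x + 1.
have b0 : 0 < b by rewrite ltr_wpDl // mulr_ge0 ?vn_ge0.
have := h (e / b) (divr_gt0 e0 b0) x; rewrite mulrDl => /le_trans; apply.
rewrite lerD2l; have -> : a * (e / b) * vn x = e * (a * vn x / b) by ring.
rewrite ler_piMr ?(ltW e0) // ler_pdivrMr // mul1r.
by rewrite /b lerDl ler01.
Qed.

(** A Bernoulli-type inequality, [q ^+ m * (1 + m (1 - q)) <= 1] by induction, combined with the
    Archimedean property. *)
Lemma expr_small (q e : R) : 0 <= q < 1 -> 0 < e -> exists m, q ^+ m <= e.
Proof.
move=> /andP[q0 q1] e0.
have q1' : 0 < 1 - q by rewrite subr_gt0.
have H m : q ^+ m * (1 + m%:R * (1 - q)) <= 1.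
  elim: m => [|m IH]; first by rewrite expr0 mul0r addr0 mulr1.
  apply: le_trans IH; rewrite exprSr -mulrA ler_wpM2l ?exprn_ge0 //.
  rewrite -natr1 -subr_ge0.
  have -> : 1 + m%:R * (1 - q) - q * (1 + (m%:R + 1) * (1 - q))
    = (m%:R + 1) * (1 - q) ^+ 2 by ring.
  by rewrite mulr_ge0 ?sqr_ge0 // addr_ge0 ?ler0n.
pose m := Num.bound (e^-1 / (1 - q)).
have hm : e^-1 <= m%:R * (1 - q).
  rewrite -ler_pdivrMr //; apply: ltW; apply: archi_boundP.
  by rewrite divr_ge0 ?invr_ge0 ?ltW.
exists m; have := H m; have qm : 0 <= q ^+ m by rewrite exprn_ge0.
have h1 : 1 <= m%:R * (1 - q) * e by rewrite -ler_pdivrMr // mul1r.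
move=> h2; have h3 : q ^+ m * (m%:R * (1 - q)) <= 1 by nra.
nra.
Qed.

(** [O] is a [c]-spectral set for [A], tested on polynomials only; other functions are reached
    through [approx]. *)
Definition spec_bound O n (A : 'M[C]_n.+1) (c : R) := forall P : {poly C},
  (forall z, O z -> cabs P.[z] <= 1) -> opb (horner_mx A P) c.

(* T plays the role of f(A) for a uniform limit f of polynomials on O. *)
Definition approx O n (A : 'M[C]_n.+1) f (T : 'M[C]_n.+1) := forall e : R, 0 < e ->
  exists P : {poly C}, (forall z, O z -> cabs (P.[z] - f z) <= e) /\
    opb (horner_mx A P - T) e.

Section Approx.
Variables (O : set C) (n : nat) (A : 'M[C]_n.+1).

Lemma spec_bound_scale c P (M : R) : 0 < M -> spec_bound O A c ->
  (forall z, O z -> cabs P.[z] <= M) -> opb (horner_mx A P) (c * M).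
Proof.
move=> M0 hc hP; have := hc (M^-1%:C *: P).
have cM : cabs (M^-1%:C) = M^-1 by rewrite cabs_real ger0_norm // invr_ge0 ltW.
have h z : O z -> cabs (M^-1%:C *: P).[z] <= 1.
  by move=> Oz; rewrite hornerZ cabsM cM ler_pdivrMl // mulr1 hP.
move=> /(_ h) /(opbZ M%:C); rewrite horner_mxZ scalerA -rmorphM /= divff ?gt_eqF //.
by rewrite scale1r cabs_real ger0_norm 1?ltW // mulrC.
Qed.

Lemma approx_poly P : approx O A (fun z => P.[z]) (horner_mx A P).
Proof.
move=> e e0; exists P; split=> [z _|]; first by rewrite subrr cabs0 ltW.
by rewrite subrr; apply: (opb_le (@opb0 R _ _)); apply: ltW.
Qed.

Lemma approx_ext f g T : (forall z, O z -> f z = g z) -> approx O A f T ->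
  approx O A g T.
Proof.
move=> fg hf e e0; have [P [h1 h2]] := hf e e0; exists P; split=> // z Oz.
by rewrite -fg // h1.
Qed.

Lemma approxD f g T S : approx O A f T -> approx O A g S ->
  approx O A (fun z => f z + g z) (T + S).
Proof.
move=> hf hg e e0; have e2 : 0 < e / 2 by rewrite divr_gt0.
have [P [h1 h2]] := hf _ e2; have [Q [h3 h4]] := hg _ e2.
exists (P + Q); rewrite [e]splitr; split=> [z Oz|].
  rewrite hornerD opprD addrACA; apply: le_trans (cabsD _ _) _.
  by rewrite lerD ?h1 ?h3.
rewrite hmxD; move: (horner_mx A P) (horner_mx A Q) h2 h4 => U V h2 h4.
have -> : U + V - (T + S) = (U - T) + (V - S) by rewrite opprD addrACA.
exact: opbD h2 h4.
Qed.

Lemma approxM f g T S (a b : R) : 0 <= a -> 0 <= b ->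
  (forall z, O z -> cabs (f z) <= a) -> (forall z, O z -> cabs (g z) <= b) ->
  approx O A f T -> approx O A g S -> approx O A (fun z => f z * g z) (T * S).
Proof.
move=> a0 b0 fa gb hf hg e e0.
have [t t0 hT] := opb_exists T; have [s s0 hS] := opb_exists S.
(* As [e' <= 1], the error is at most [e' * (1 + a + b)] for the values and [e' * (1 + s + t)] for
   the matrices; [K] majorizes both factors. *)
pose K := a + b + t + s + 1.
have K0 : 0 < K by rewrite ltr_wpDl // !addr_ge0.
pose e' := Num.min 1 (e / K).
have e'0 : 0 < e' by rewrite lt_min ltr01 divr_gt0.
have e'1 : e' <= 1 by rewrite ge_min lexx.
have e'e : e' * K <= e by rewrite -ler_pdivlMr // ge_min lexx orbT.
have [P [h1 h2]] := hf _ e'0; have [Q [h3 h4]] := hg _ e'0.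
exists (P * Q); split=> [z Oz|].
  rewrite hornerM.
  have -> : P.[z] * Q.[z] - f z * g z =
     (P.[z] - f z) * (Q.[z] - g z) + (P.[z] - f z) * g z + f z * (Q.[z] - g z).
    by ring.
  apply: le_trans (cabsD _ _) _; rewrite [cabs (f z * _)]cabsM.
  have := cabsD ((P.[z] - f z) * (Q.[z] - g z)) ((P.[z] - f z) * g z).
  rewrite [cabs (_ * (_ - _))]cabsM [cabs ((_ - _) * g z)]cabsM.
  have := h1 _ Oz; have := h3 _ Oz; have := fa _ Oz; have := gb _ Oz.
  have := cabs_ge0 (P.[z] - f z); have := cabs_ge0 (Q.[z] - g z).
  have := cabs_ge0 (f z); have := cabs_ge0 (g z).
  move: (cabs (_ + _)) (cabs (P.[z] - f z)) (cabs (Q.[z] - g z))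
    (cabs (f z)) (cabs (g z)).
  move=> X p q F G G0 F0 q0 p0 Gb Fa qe pe hX.
  have pq : p * q <= e' * 1 by rewrite ler_pM // (le_trans qe).
  have pG : p * G <= e' * b by rewrite ler_pM.
  have Fq : F * q <= a * e' by rewrite ler_pM.
  by rewrite /K in e'e; nra.
rewrite hmxM; move: (horner_mx A P) (horner_mx A Q) h2 h4 => U V h2 h4.
have -> : U * V - T * S = (U - T) * (V - S) + (U - T) * S + T * (V - S).
  by rewrite -mulrDr subrK mulrBl mulrBr addrA subrK.
have e'0' := ltW e'0.
apply: (@opb_le _ _ _ _ (e' * e' + e' * s + t * e')).
  apply: opbD; first apply: opbD.
  - exact: (opbMr e'0' h2 h4).
  - exact: (opbMr e'0' h2 hS).
  - exact: (opbMr t0 hT h4).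
have : e' * e' <= e' * 1 by rewrite ler_wpM2l // ltW.
by rewrite /K in e'e; nra.
Qed.

Lemma approx_sum (J : finType) (F : J -> C -> C) (T : J -> 'M[C]_n.+1) :
  (forall j, approx O A (F j) (T j)) ->
  approx O A (fun z => \sum_j F j z) (\sum_j T j).
Proof.
move=> h; rewrite /index_enum; elim: (Finite.enum _) => [|j r IH].
  rewrite big_nil; have := @approx_poly 0; rewrite rmorph0; apply: approx_ext => z _.
  by rewrite big_nil horner0.
rewrite big_cons; apply: approx_ext (approxD (h j) IH) => z _ /=.
by rewrite big_cons.
Qed.

Lemma approxZ c f T : approx O A f T -> approx O A (fun z => c * f z) (c *: T).
Proof.
move=> hf e e0; pose k := cabs c + 1.
have k0 : 0 < k by rewrite ltr_wpDl ?cabs_ge0.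
have ck : cabs c * (e / k) <= e.
  rewrite mulrA ler_pdivrMr // [cabs c * e]mulrC; apply: ler_wpM2l; first exact: ltW.
  by rewrite /k lerDl ler01.
have [P [h1 h2]] := hf _ (divr_gt0 e0 k0).
exists (c *: P); split=> [z Oz|].
  rewrite hornerZ -mulrBr cabsM; apply: le_trans ck.
  by rewrite ler_wpM2l ?cabs_ge0 ?h1.
rewrite horner_mxZ -scalerBr; apply: opb_le ck; exact: opbZ.
Qed.

(** The approximating polynomial is bounded by [M + e] on [O]; the spectral bound applies to it, and
    then [e] tends to 0. *)
Lemma approx_bound c f T (M : R) : 0 <= c -> 0 <= M -> spec_bound O A c ->
  approx O A f T -> (forall z, O z -> cabs (f z) <= M) -> opb T (c * M).
Proof.
move=> c0 M0 hc hf fM; apply: (@opb_closed _ _ _ _ (c + 1)).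
  by rewrite addr_ge0.
move=> e e0; have [P [h1 h2]] := hf e e0.
have hP z : O z -> cabs P.[z] <= M + e.
  move=> Oz; rewrite -[P.[z]](subrK (f z)) addrC.
  by apply: le_trans (cabsD _ _) _; rewrite lerD ?fM ?h1.
have Me : 0 < M + e by rewrite ltr_wpDl.
have h3 := spec_bound_scale Me hc hP.
have -> : T = horner_mx A P - (horner_mx A P - T) by rewrite opprB addrC subrK.
have -> : c * M + (c + 1) * e = c * (M + e) + e by ring.
exact: opbB.
Qed.

(* 1/(s - z) is expanded in powers of z - (s - r nv), with r so large that the
   disc of radius r centred at s - r nv contains O. *)
Lemma approx_resolvent nv s (d D c : R) : 0 < d -> cabs nv = 1 -> sep O nv s d ->
  num_in A O -> (forall z, O z -> cabs z <= D) -> 0 <= D -> spec_bound O A c ->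
  0 <= c -> approx O A (fun z => (s - z)^-1) (s%:M - A)^-1.
Proof.
move=> d0 nv1 hs An OD D0 hc c0 e e0.
(* The squared distance from [z] to [s - r nv] is at most [(D + cabs s) ^+ 2 - 2 r d + r ^+ 2]; this
   [r] makes it at most [r ^+ 2 - r d = r ^+ 2 * q]. The summand [d] ensures [0 < r] and
   [0 <= q]. *)
pose r := (D + cabs s) ^+ 2 / d + d.
have r0 : 0 < r by rewrite ltr_wpDl // divr_ge0 ?sqr_ge0 // ltW.
have rd : (D + cabs s) ^+ 2 <= r * d.
  by rewrite /r mulrDl divfK ?gt_eqF // lerDl mulr_ge0 // ltW.
have dr : d <= r by rewrite /r lerDr divr_ge0 ?sqr_ge0 // ltW.
pose q := 1 - d / r.
have q01 : 0 <= q < 1.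
  rewrite /q subr_ge0 ler_pdivrMr // mul1r dr /=.
  by rewrite ltrBlDr ltrDl divr_gt0.
have nv0 : nv != 0 by rewrite -cabs_eq0 nv1 oner_eq0.
have ru0 : r%:C * nv != 0.
  by rewrite mulf_neq0 // -cabs_eq0 cabs_real normr_eq0 gt_eqF.
pose w : {poly C} := (r%:C * nv)^-1 *: ('X - (s - r%:C * nv)%:P).
have wq z : O z -> cabs w.[z] ^+ 2 <= q.
  move=> Oz; rewrite /w hornerZ hornerXsubC cabsM cabsV cabsM nv1 mulr1.
  rewrite cabs_real (ger0_norm (ltW r0)) exprMn exprVn ler_pdivrMl ?exprn_gt0 //.
  have -> : r ^+ 2 * q = r ^+ 2 - r * d.
    by rewrite /q; field; rewrite gt_eqF.
  have E : cabs (z - (s - r%:C * nv)) ^+ 2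
      = cabs (s - z) ^+ 2 - 2 * r * re (nv^*%C * (s - z)) + r ^+ 2.
    have -> : z - (s - r%:C * nv) = - (s - z - r%:C * nv) by ring.
    rewrite cabsN (cabsB2 (s - z)) cabsM nv1 mulr1 cabs_real (ger0_norm (ltW r0)).
    have -> : (r%:C * nv)^*%C = r%:C * nv^*%C.
      by case: (nv) => u v /=; congr (_ +i* _); ring.
    by rewrite -mulrA reMr mulrA.
  have sz : cabs (s - z) ^+ 2 <= r * d.
    apply: le_trans rd; rewrite ler_sqr ?nnegrE ?cabs_ge0 ?addr_ge0 ?cabs_ge0 //.
    by apply: le_trans (cabsB _ _) _; rewrite addrC lerD2r OD.
  by rewrite E; have := hs _ Oz; nra.
have [us us'] := resolvent_bound d0 nv1 hs An.
pose k := d^-1 + d^-1 * c.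
have di : 0 < d^-1 by rewrite invr_gt0.
have k0 : 0 < k by rewrite ltr_wpDr // mulr_ge0 // ltW.
have [m qm] := expr_small q01 (divr_gt0 e0 k0).
(* A truncated geometric series, of even length because [q] bounds the square of [cabs w.[z]]. *)
pose P := (r%:C * nv)^-1 *: \sum_(i < m.*2) w ^+ i.
have PE : (s%:P - 'X) * P = 1 - w ^+ m.*2.
  rewrite -[1](expr1n _ m.*2) subrXX.
  under eq_bigr do rewrite expr1n mul1r.
  rewrite /P -scalerAr scalerAl; congr (_ * _).
  have k1 : (r%:C * nv)^-1 *: (r%:C * nv)%:P = 1 :> {poly C}.
    by rewrite -mul_polyC -polyCM mulVf.
  rewrite /w polyCB !scalerBr k1.
  move: (_ *: s%:P) (_ *: 'X) => X Y; ring.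
have wm z : O z -> cabs (w ^+ m.*2).[z] <= e / k.
  move=> Oz; apply: le_trans qm; rewrite horner_exp cabsX -mul2n exprM.
  by rewrite lerXn2r ?nnegrE ?sqr_ge0 ?wq //; case/andP: q01.
exists P; split=> [z Oz|].
  have sz := sep_dist nv1 hs Oz.
  have sz0 : s - z != 0 by rewrite -cabs_gt0 (lt_le_trans d0).
  have -> : P.[z] - (s - z)^-1 = - ((w ^+ m.*2).[z] / (s - z)).
    apply: (mulfI sz0); rewrite mulrBr divff // mulrN mulrCA divff // mulr1.
    have := congr1 (horner^~ z) PE.
    rewrite !(hornerM, hornerD, hornerN, hornerC, hornerX).
    by move=> ->; rewrite hornerE addrAC subrr add0r.
  rewrite cabsN cabsM cabsV.
  apply: (@le_trans _ _ (e / k * d^-1)).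
    rewrite ler_pM ?cabs_ge0 ?invr_ge0 ?cabs_ge0 ?wm //.
    by rewrite lef_pV2 ?posrE // (lt_le_trans d0).
  have -> : e / k * d^-1 = e * (d^-1 / k) by ring.
  by rewrite ler_piMr ?(ltW e0) // ler_pdivrMr // mul1r /k lerDl mulr_ge0 // ltW.
have hw : opb (horner_mx A (w ^+ m.*2)) (c * (e / k)).
  by apply: spec_bound_scale => //; rewrite divr_gt0.
have E : horner_mx A P - (s%:M - A)^-1 = - ((s%:M - A)^-1 * horner_mx A (w ^+ m.*2)).
  apply: (mulrI us); rewrite mulrBr mulrV // mulrN mulrA mulrV // mul1r.
  have := congr1 (horner_mx A) PE; rewrite hmxM !hmxB horner_mx_C horner_mx_X.
  by move=> ->; rewrite rmorph1 addrAC subrr add0r.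
suff : opb (- ((s%:M - A)^-1 * horner_mx A (w ^+ m.*2))) e by rewrite -E.
apply: opbN; apply: (@opb_le _ _ _ _ (d^-1 * (c * (e / k)))).
  by apply: opbMr => //; apply: ltW.
have -> : d^-1 * (c * (e / k)) = e * (d^-1 * c / k) by ring.
by rewrite ler_piMr ?(ltW e0) // ler_pdivrMr // mul1r /k lerDr ltW.
Qed.

End Approx.
End Runge.

(** * The Crouzeix--Palencia argument *)

Section PositiveKernel.
Variable R : realType.
Notation C := R[i].

Lemma scalar_invr n (a : C) : a != 0 -> (a%:M : 'M[C]_n.+1)^-1 = (a^-1)%:M.
Proof.
move=> a0; have un : (a%:M : 'M[C]_n.+1) \is a GRing.unit.
  by rewrite -[_ \is a _]/(_ \in unitmx) unitmxE det_scalar unitrX // unitfE.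
apply: (mulrI un); rewrite divrr // mul_scalar_mxr -[(a^-1)%:M]scalemx1.
by rewrite scalerA divff // scale1r.
Qed.

Lemma horner_mx_scalar n (z : C) (P : {poly C}) :
  horner_mx (z%:M : 'M[C]_n.+1) P = (P.[z])%:M.
Proof.
elim/poly_ind: P => [|P c IH]; first by rewrite rmorph0 horner0 raddf0.
rewrite hmxD hmxM horner_mx_X horner_mx_C IH hornerMXaddC raddfD /=.
by rewrite mul_scalar_mxr -[z%:M]scalemx1 scalerA scalemx1.
Qed.

Lemma opb_scalar1 (c : C) e : opb (c%:M : 'M[C]_1) e -> cabs c <= e.
Proof.
move=> /(_ (const_mx 1)); rewrite mul_scalar_mx vnZ.
have -> : vn (const_mx 1 : 'cV[C]_1) = 1.
  by rewrite /vn big_ord1 mxE cabs1 expr1n sqrtr1.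
by rewrite !mulr1.
Qed.

(** A phase turns [y] into [y'] so that the mixed value becomes its modulus; nonnegativity of the
    form at [x - y'] then gives the bound, with the arithmetic mean in place of the geometric
    one. *)
Lemma psd_cauchy_schwarz n (H : 'M[C]_n) (x y : 'cV[C]_n) : H^t* = H ->
  (forall v, 0 <= re (ip v (H *m v))) ->
  cabs (ip y (H *m x)) <= (re (ip x (H *m x)) + re (ip y (H *m y))) / 2.
Proof.
move=> HH Hp; have [u u1 hu] := complex_phase (ip y (H *m x)).
pose y' := u^*%C *: y.
have h1 : ip y' (H *m x) = (cabs (ip y (H *m x)))%:C by rewrite ipZl conjcK.
have h2 : ip x (H *m y') = (cabs (ip y (H *m x)))%:C.
  by rewrite ip_adj HH -ipJ h1 conjc_real.
have h3 : ip y' (H *m y') = ip y (H *m y).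
  rewrite -scalemxAr ipZl ipZr conjcK mulrA [u * _]mulrC mulJc u1.
  by rewrite expr1n mul1r.
have := Hp (x - y'); rewrite mulmxBr ipBr ipDl ipNl ipDl ipNl h1 h2 h3.
rewrite !(reB, reD, reN) /re /=.
move: (complex.Re (ip x _)) (complex.Re (ip y _)) (cabs _) => a b c.
by lra.
Qed.

(** Termwise Cauchy--Schwarz for the positive forms leaves only diagonal values, whose sums at [x]
    and at [y] are at most [t]; the [H j] may fail to commute. *)
Lemma sum_psd_bound n (J : finType) (H : J -> 'M[C]_n) (p : J -> C) (B t : R) :
  (forall j, (H j)^t* = H j) -> (forall j v, 0 <= re (ip v (H j *m v))) ->
  (forall j, cabs (p j) <= B) -> 0 <= B -> 0 <= t ->
  (forall x, vn x = 1 -> \sum_j re (ip x (H j *m x)) <= t) ->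
  opb (\sum_j p j *: H j) (B * t).
Proof.
move=> HH Hp pB B0 t0 ht; apply: opb_unit => x x1.
apply: vn_dual; first by rewrite mulr_ge0.
move=> y y1; rewrite mulmx_suml.
have -> : ip y (\sum_j p j *: H j *m x) = \sum_j p j * ip y (H j *m x).
  rewrite /ip mulmx_sumr summxE; apply: eq_bigr => j _.
  by rewrite -scalemxAl -scalemxAr mxE.
apply: le_trans (cabs_sum _ _ _) _.
apply: (@le_trans _ _
    (\sum_j B * ((re (ip x (H j *m x)) + re (ip y (H j *m y))) / 2))).
  apply: ler_sum => j _; rewrite cabsM ler_pM ?cabs_ge0 //.
  exact: psd_cauchy_schwarz.
rewrite -mulr_sumr ler_wpM2l // -mulr_suml big_split /=.
by have := ht _ x1; have := ht _ y1; lra.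
Qed.

Lemma sep_form n (A : 'M[C]_n) O nv s (d : R) y : 0 <= d -> sep O nv s d ->
  num_in A O -> 0 <= re (nv^*%C * ip y ((s%:M - A) *m y)).
Proof.
move=> d0 hs An; have [->|y0] := eqVneq y 0.
  by rewrite mulmx0 /ip mulmx0 mxE mulr0.
have vy : 0 < vn y by rewrite vn_gt0.
pose v := (vn y)^-1%:C *: y.
have v1 : vn v = 1.
  by rewrite vnZ cabs_real ger0_norm ?invr_ge0 ?vn_ge0 // mulVf // gt_eqF.
have -> : y = (vn y)%:C *: v.
  by rewrite /v scalerA -rmorphM /= divff ?scale1r // gt_eqF.
rewrite -scalemxAr ipZl ipZr conjc_real !(mulrCA nv^*%C) !reMr.
apply: mulr_ge0; first exact: vn_ge0.
apply: mulr_ge0; first exact: vn_ge0.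
apply: le_trans d0 _.
have -> : ip v ((s%:M - A) *m v) = s - ip v (A *m v).
  by rewrite mulmxBl mul_scalar_mx ipBr ipZr ipxx v1 expr1n mulr1.
exact: (hs _ (An _ v1)).
Qed.

Section Kernel.
Variables (O : set C) (d h L D : R) (J : finType).
Variables (s s' nv : J -> C) (r : J -> R).
Hypothesis ct : contour O d h L D s s' nv r.
Hypothesis d0 : 0 < d.
Variables (n : nat) (A : 'M[C]_n.+1).
Hypothesis An : num_in A O.

(** With [x = (s j - A) y] the form is, up to conjugation, [r j] times
    [(nv j)^* ip y ((s j - A) y)], whose real part is nonnegative by separation. *)
Lemma kernel_form_ge0 j x :
  0 <= re (ip x ((((r j)%:C * nv j) *: ((s j)%:M - A)^-1) *m x)).
Proof.
have [us _] := resolvent_bound d0 (ct_nv ct j) (ct_sep ct j) An.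
pose y := ((s j)%:M - A)^-1 *m x.
have xy : x = ((s j)%:M - A) *m y.
  by rewrite /y mulmxA -[_ *m _^-1]/(_ * _^-1) mulrV // mul1mx.
rewrite -scalemxAl ipZr -/y {1}xy -ipJ -mulrA reMr.
have /andP[r0 _] := ct_r ct j; apply: mulr_ge0 => //.
rewrite -reJ rmorphM /= conjcK.
exact: (sep_form _ (ltW d0) (ct_sep ct j) An).
Qed.

(** The adjoint undoes the conjugation of [p j], so the total is the combination with coefficients
    [p j] of the positive matrices [a j + (a j)^t*]. *)
Lemma kernel_sum_bound (p : J -> C) (B t : R) :
  (forall j, cabs (p j) <= B) -> 0 <= B -> 0 <= t ->
  (forall x, vn x = 1 ->
    re (ip x ((\sum_j ((r j)%:C * nv j) *: ((s j)%:M - A)^-1) *m x)) <= t) ->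
  opb (\sum_j ((r j)%:C * nv j * p j) *: ((s j)%:M - A)^-1
     + (\sum_j ((r j)%:C * nv j * (p j)^*%C) *: ((s j)%:M - A)^-1)^t*) (B * (2 * t)).
Proof.
move=> pB B0 t0 ht.
pose a j := ((r j)%:C * nv j) *: ((s j)%:M - A)^-1.
have fa j x : re (ip x ((a j + (a j)^t*) *m x)) = 2 * re (ip x (a j *m x)).
  rewrite mulmxDl ipDr reD [ip x ((a j)^t* *m x)]ip_adj trmxCK -ipJ reJ.
  by ring.
have -> : \sum_j ((r j)%:C * nv j * p j) *: ((s j)%:M - A)^-1
     + (\sum_j ((r j)%:C * nv j * (p j)^*%C) *: ((s j)%:M - A)^-1)^t*
   = \sum_j p j *: (a j + (a j)^t*).
  rewrite ctr_sum -big_split /=; apply: eq_bigr => j _.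
  have key (w q : C) (X : 'M[C]_n.+1) : ((w * q^*%C) *: X)^t* = q *: (w *: X)^t*.
    by rewrite !ctrZ scalerA rmorphM /= conjcK mulrC.
  by rewrite scalerDr key /a scalerA [p j * _]mulrC.
apply: sum_psd_bound => //.
- by move=> j; rewrite ctrD trmxCK addrC.
- by move=> j v; rewrite fa mulr_ge0 // kernel_form_ge0.
- by rewrite mulr_ge0.
- move=> x x1; under eq_bigr do rewrite fa.
  rewrite -mulr_sumr ler_wpM2l //.
  have := ht _ x1; rewrite mulmx_suml /ip mulmx_sumr summxE re_sum.
  by [].
Qed.

End Kernel.
End PositiveKernel.

(** * Contours around a set and the size of the Cauchy kernel *)

Section SpectralConstant.
Variable R : realType.
Notation C := R[i].
Implicit Types (O : set C).

(** The constants precede the step length [h], because the error constant of [cauchy_formula]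
    depends on [d], [L] and [D], and [h] is adapted to it afterwards. The lower bound [l] of the
    length keeps the Cauchy factor away from 0. *)
Definition poly_contours O (eta : R) := exists d L D l : R,
  [/\ 0 < d, 0 <= L, 0 <= D & 0 < l] /\
  forall h, 0 < h -> exists (J : finType) (s s' nv : J -> C) (r : J -> R),
    [/\ contour O d h L D s s' nv r, l <= \sum_j r j
      & forall j, exists2 z, O z & cabs (s j - z) <= eta].

Lemma contour_leD O (d h L D D' : R) (J : finType) (s s' nv : J -> C) (r : J -> R) :
  D <= D' -> contour O d h L D s s' nv r -> contour O d h L D' s s' nv r.
Proof.
move=> DD [a1 a2 a3 a4 a5 a6 a7 a8]; split=> // j.
by have [b1 b2] := a7 j; split; [exact: le_trans b1 _ | exact: le_trans b2 _].
Qed.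

(** Two uses of Cauchy--Schwarz, for [|T x|^2 <= |T^* T x|] and [|T^* T x|^2 <= |T x| |T T^* T x|].
    This stands for the norm identity [|T T^* T| = |T|^3] without a maximizing vector. *)
Lemma vn_cube n (T : 'M[C]_n) (x : 'cV[C]_n) : vn x = 1 ->
  vn (T *m x) ^+ 3 <= vn (T *m (T^t* *m (T *m x))).
Proof.
move=> x1; have [->|Tx0] := eqVneq (vn (T *m x)) 0.
  by rewrite expr0n /= vn_ge0.
have v0 : 0 < vn (T *m x) by rewrite lt_def Tx0 vn_ge0.
have h1 : vn (T *m x) ^+ 2 <= vn (T^t* *m (T *m x)).
  have := cauchy_schwarz x (T^t* *m (T *m x)).
  rewrite ip_adj trmxCK ipxx cabs_real ger0_norm ?sqr_ge0 // x1.
  by rewrite mul1r.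
have h2 : vn (T^t* *m (T *m x)) ^+ 2 <= vn (T *m x) * vn (T *m (T^t* *m (T *m x))).
  have := cauchy_schwarz (T *m x) (T *m (T^t* *m (T *m x))).
  by rewrite ip_adj ipxx cabs_real ger0_norm ?sqr_ge0.
rewrite -(ler_pM2l v0); apply: le_trans h2.
by rewrite -exprS (exprM _ 2 2) lerXn2r ?nnegrE ?sqr_ge0 ?vn_ge0.
Qed.

Section Kernel.
Variables (O : set C) (d h L D : R) (J : finType).
Variables (s s' nv : J -> C) (r : J -> R).
Hypothesis ct : contour O d h L D s s' nv r.
Hypothesis d0 : 0 < d.

Lemma kernel_re j z : re ((r j)%:C * nv j / (s j - z)) =
  r j * (re ((nv j)^*%C * (s j - z)) / cabs (s j - z) ^+ 2).
Proof.
rewrite invc_cabs -mulrA [nv j * _]mulrCA !reMr mulrC [in RHS]mulrC; congr (_ * _).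
by rewrite mulrC; congr (_ * _); rewrite -reJ rmorphM /= conjcK.
Qed.

Lemma kernel_re_ge0 j z : O z -> 0 <= re ((r j)%:C * nv j / (s j - z)).
Proof.
move=> Oz; rewrite kernel_re; have /andP[r0 _] := ct_r ct j.
apply: mulr_ge0 => //; apply: divr_ge0; last exact: sqr_ge0.
apply: le_trans (ltW d0) _; exact: (ct_sep ct).
Qed.

(** By [kernel_re], separation bounds the numerator of each real part below by [d], and [D + D]
    bounds the distance in the denominator. *)
Lemma kernel_sum_re z l : O z -> cabs z <= D -> l <= \sum_j r j ->
  l * (d / (D + D) ^+ 2) <= re (\sum_j (r j)%:C * nv j / (s j - z)).
Proof.
move=> Oz zD lr.
have D20 : 0 <= d / (D + D) ^+ 2 by rewrite divr_ge0 ?sqr_ge0 // ltW.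
apply: le_trans (ler_wpM2r D20 lr) _; rewrite mulr_suml re_sum.
apply: ler_sum => j _; rewrite kernel_re; have /andP[r0 _] := ct_r ct j.
apply: ler_wpM2l => //.
have x0 : 0 < cabs (s j - z).
  exact: lt_le_trans d0 (sep_dist (ct_nv ct j) (ct_sep ct j) Oz).
have xD : cabs (s j - z) <= D + D.
  by apply: le_trans (cabsB _ _) _; have [h1 _] := ct_bnd ct j; apply: lerD.
apply: (@ler_pM _ d _ ((D + D) ^+ 2)^-1 _); first exact: ltW.
- by rewrite invr_ge0 sqr_ge0.
- exact: (ct_sep ct).
- rewrite lef_pV2 ?posrE ?exprn_gt0 //; last exact: lt_le_trans xD.
  by rewrite lerXn2r ?nnegrE ?(ltW x0) // (le_trans (ltW x0)).
Qed.

Lemma resolvent_scalar z j : O z ->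
  ((s j)%:M - z%:M : 'M[C]_1)^-1 = ((s j - z)^-1)%:M.
Proof.
move=> Oz; rewrite -raddfB scalar_invr // -cabs_gt0.
exact: lt_le_trans d0 (sep_dist (ct_nv ct j) (ct_sep ct j) Oz).
Qed.

(** A number is treated as a matrix of size 1, so the matrix Cauchy formula yields the scalar one
    with the same factor [c]. *)
Lemma kernel_sum_scalar z (p : J -> C) (c q : C) (e : R) : O z ->
  opb (\sum_j (p j) *: ((s j)%:M - z%:M : 'M[C]_1)^-1 - c *: q%:M) e ->
  cabs (\sum_j p j / (s j - z) - c * q) <= e.
Proof.
move=> Oz he; apply: opb_scalar1; rewrite raddfB raddf_sum /=.
suff -> : \sum_j (p j / (s j - z))%:M = \sum_j (p j) *: ((s j)%:M - z%:M : 'M[C]_1)^-1.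
  by rewrite -scale_scalar_mx.
by apply: eq_bigr => j _; rewrite resolvent_scalar // scale_scalar_mx.
Qed.

End Kernel.
End SpectralConstant.

Section SpectralImprove.
Variable R : realType.
Notation C := R[i].
Variables (O : set C) (z0 : C) (D : R).
Hypothesis cO : cvx O.
Hypothesis Oz0 : O z0.
Hypothesis OD : forall z, O z -> cabs z <= D.
Variables (n : nat) (A : 'M[C]_n.+1).
Hypothesis An : num_in A O.
Hypothesis AD : opb A D.

Let D0 : 0 <= D.
Proof. exact: le_trans (cabs_ge0 _) (OD Oz0). Qed.

Lemma num_in_scalar z : O z -> num_in (z%:M : 'M[C]_1) O.
Proof.
by move=> Oz x x1; rewrite mul_scalar_mx ipZr ipxx x1 expr1n mulr1.
Qed.

Section Step.
Variables (P : {poly C}) (c0 : R).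
Hypothesis c05 : 5 <= c0.
Hypothesis hc : spec_bound O A c0.
Hypothesis hP : forall z, O z -> cabs P.[z] <= 1.
Variables (d h L D1 e : R) (J : finType) (s s' nv : J -> C) (r : J -> R).
Hypothesis ct : contour O d h L D1 s s' nv r.
Hypothesis d0 : 0 < d.
Hypothesis Ps : forall j, cabs P.[s j] <= 11 / 10.

Let w j := (r j)%:C * nv j.
Let c := \sum_j w j / (s j - z0).
Let v z := \sum_j w j * P.[s j] / (s j - z).
Let u z := \sum_j w j / (s j - z).
Let V := \sum_j (w j * P.[s j]) *: ((s j)%:M - A)^-1.
Let U := \sum_j w j *: ((s j)%:M - A)^-1.
Let g z := \sum_j w j * (P.[s j])^*%C / (s j - z).
Let G := \sum_j (w j * (P.[s j])^*%C) *: ((s j)%:M - A)^-1.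
Let T : 'M[C]_n.+1 := horner_mx A P.

Hypothesis e0 : 0 < e.
Hypothesis ec : 100 * e <= re c.
Hypothesis vP : forall z, O z -> cabs (v z - c * P.[z]) <= e.
Hypothesis u1 : forall z, O z -> cabs (u z - c) <= e.
Hypothesis VP : opb (V - c *: T) e.
Hypothesis U1 : opb (U - c%:M) e.

Let cc : 100 * e <= cabs c.
Proof. exact: le_trans ec (re_le_cabs _). Qed.

Let rc : re c <= cabs c.
Proof. exact: re_le_cabs. Qed.

(** [v z + (g z)^*] combines the values [P.[s j]] with nonnegative weights
    [2 * re (w j / (s j - z))], hence is at most [11 / 10 * (2 * re (u z))]. As [u z] is near [c]
    and [v z] near [c * P.[z]], the total is [32 / 10 * (cabs c + e)]; the 4 leaves room for [e]. *)
Lemma conj_transform_bound z : O z -> cabs (g z) <= 4 * cabs c.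
Proof.
move=> Oz.
have E : v z + (g z)^*%C = \sum_j P.[s j] * (2 * re (w j / (s j - z)))%:C.
  rewrite /v /g rmorph_sum -big_split; apply: eq_bigr => j _.
  have -> : (2 * re (w j / (s j - z)))%:C = w j / (s j - z) + (w j / (s j - z))^*%C.
    by case: (w j / _) => a b; rewrite /re /=; simpc; congr (_ +i* _); ring.
  rewrite mulrDr mulrAC [_ * P.[s j]]mulrC; congr (_ + _).
  by rewrite mulrAC rmorphM /= conjcK mulrC.
have h1 : cabs (v z + (g z)^*%C) <= 11 / 10 * (2 * re (u z)).
  rewrite E; apply: le_trans (cabs_sum _ _ _) _.
  rewrite /u re_sum !mulr_sumr; apply: ler_sum => j _.
  have k0 := kernel_re_ge0 ct d0 j Oz.
  rewrite cabsM cabs_real ger0_norm ?mulr_ge0 //.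
  by apply: ler_pM; rewrite ?cabs_ge0 ?mulr_ge0.
have h2 : re (u z) <= cabs c + e.
  rewrite -[u z](subrK c) reD addrC; apply: lerD; first exact: re_le_cabs.
  exact: le_trans (re_le_cabs _) (u1 Oz).
have h3 : cabs (v z) <= e + cabs c.
  rewrite -[v z](subrK (c * P.[z])); apply: le_trans (cabsD _ _) _.
  apply: lerD; first exact: vP.
  by rewrite cabsM ler_piMr ?cabs_ge0 // hP.
have h4 : cabs (g z) <= cabs (v z + (g z)^*%C) + cabs (v z).
  rewrite -[cabs (g z)]cabsJ -{1}[(g z)^*%C](addKr (v z)) addrC.
  exact: cabsB.
apply: le_trans h4 _; apply: le_trans (lerD h1 h3) _.
by move: h2 cc; move: (re (u z)) (cabs c) => a b; move: e0; lra.
Qed.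

(* Crouzeix--Palencia, in the form of Ransford and Schwenninger: up to an error
   of size e, c T = S - G^* with S := V + G^* of norm at most 2.2 (|c| + e), and
   T G T is the value at A of P g P, which is at most 4 |c| on O. Hence
   |T|^3 = |T T^* T| <= (2.5 c0^2 + 4 c0), which is below (0.9 c0)^3. *)
Lemma spec_step : opb T (9 / 10 * c0).
Proof.
have c00 : 0 <= c0 by apply: le_trans c05.
have e0' := ltW e0.
have hS : opb (V + G^t*) (11 / 10 * (2 * (re c + e))).
  apply: (kernel_sum_bound ct d0 An Ps).
  - by lra.
  - by move: e0' ec; lra.
  - move=> x x1; have -> : ip x (U *m x) = ip x ((U - c%:M) *m x) + c.
      by rewrite mulmxBl mul_scalar_mx ipBr ipZr ipxx x1 expr1n mulr1 subrK.
    rewrite reD addrC lerD2l; apply: le_trans (re_le_cabs _) _.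
    apply: le_trans (cauchy_schwarz _ _) _; rewrite x1 mul1r.
    by have := U1 x; rewrite x1 mulr1.
(* [G] combines resolvents, so it is a limit of polynomials in [A]. Bounding the product as one
   function of [A] costs a single factor [c0]. *)
have hTGT : opb (T * (G * T)) (c0 * (4 * cabs c)).
  have apP := approx_poly O A P.
  have apG : approx O A g G.
    have := @approx_sum _ O _ A J (fun j z => w j * (P.[s j])^*%C * (s j - z)^-1)
       (fun j => (w j * (P.[s j])^*%C) *: ((s j)%:M - A)^-1).
    apply=> j; apply: approxZ.
    exact: (approx_resolvent d0 (ct_nv ct j) (ct_sep ct j) An OD D0 hc c00).
  have c40 : 0 <= 4 * cabs c by rewrite mulr_ge0 ?cabs_ge0.
  have apGP := approxM c40 ler01 conj_transform_bound hP apG apP.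
  have gP z : O z -> cabs (g z * P.[z]) <= 4 * cabs c.
    move=> Oz; rewrite cabsM -[4 * _]mulr1.
    by apply: ler_pM; rewrite ?cabs_ge0 // ?conj_transform_bound // hP.
  have ap := approxM ler01 c40 hP gP apP apGP.
  apply: (approx_bound c00 c40 hc ap) => z Oz.
  rewrite cabsM -[4 * _]mul1r.
  by apply: ler_pM; rewrite ?cabs_ge0 // ?gP // hP.
have hT : opb T c0 by apply: hc.
have hSa : opb ((V + G^t*)^t*) (11 / 10 * (2 * (re c + e))).
  apply: opb_adj => //.
  by move: e0' ec; lra.
have hEa : opb ((V - c *: T)^t*) e by apply: opb_adj.
have hb : 0 <= 11 / 10 * (2 * (re c + e)).
  by move: e0' ec; lra.
have E : c^*%C *: (T * (T^t* * T)) =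
   T * ((V + G^t*)^t* * T) - T * (G * T) - T * ((V - c *: T)^t* * T).
  rewrite -!mulrBr -!mulrBl ctrD ctrB ctrZ trmxCK addrK.
  by rewrite opprB addrC subrK -scalerAl -scalerAr.
have hall : opb (c^*%C *: (T * (T^t* * T)))
   (c0 * (11 / 10 * (2 * (re c + e)) * c0) + c0 * (4 * cabs c) + c0 * (e * c0)).
  rewrite E; apply: opbB; first apply: opbB.
  - exact: (opbMr c00 hT (opbMr hb hSa hT)).
  - exact: hTGT.
  - exact: (opbMr c00 hT (opbMr e0' hEa hT)).
apply: opb_unit => x x1; rewrite leNgt; apply/negP => hx.
have := hall x; rewrite x1 mulr1 -scalemxAl vnZ cabsJ.
have mulE (X Y : 'M[C]_n.+1) y : (X * Y) *m y = X *m (Y *m y) by rewrite mulmxA.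
rewrite !mulE.
have h3 := vn_cube T x1.
have cp : 0 < cabs c by apply: lt_le_trans cc; rewrite mulr_gt0.
have h4 : (9 / 10 * c0) ^+ 3 <= vn (T *m (T^t* *m (T *m x))).
  apply: le_trans h3; rewrite lerXn2r ?nnegrE ?vn_ge0 ?(ltW hx) //.
  by rewrite mulr_ge0.
move=> h5.
have h6 : cabs c * (9 / 10 * c0) ^+ 3 <= cabs c * (c0 * (5 / 2 * c0 + 4)).
  apply: le_trans (ler_wpM2l (ltW cp) h4) _; apply: le_trans h5 _.
  have -> : c0 * (11 / 10 * (2 * (re c + e)) * c0) + c0 * (4 * cabs c) + c0 * (e * c0)
    = c0 * (c0 * (22 / 10 * (re c + e) + e) + 4 * cabs c) by field.
  rewrite [leRHS]mulrCA; apply: ler_wpM2l => //.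
  have -> : cabs c * (5 / 2 * c0 + 4) = c0 * (5 / 2 * cabs c) + 4 * cabs c by field.
  rewrite lerD2r; apply: ler_wpM2l => //.
  by move: cc rc; lra.
move: h6; rewrite ler_pM2l // => h6.
have h7 : c0 * ((9 / 10) ^+ 3 * c0 ^+ 2) <= c0 * (5 / 2 * c0 + 4).
  apply: le_trans h6.
  have -> // : (9 / 10 * c0) ^+ 3 = c0 * ((9 / 10) ^+ 3 * c0 ^+ 2) by ring.
move: h7; rewrite ler_pM2l; last by apply: lt_le_trans c05.
(* What remains is [729 / 1000 * c0 ^+ 2 <= 5 / 2 * c0 + 4]; since [5 * c0 <= c0 ^+ 2], it would
   force [c0 < 4]. *)
have -> : (9 / 10 : R) ^+ 3 = 729 / 1000 by field.
have h8 : 5 * c0 <= c0 ^+ 2 by rewrite expr2 ler_wpM2r.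
by move: c05 h8; move: (c0 ^+ 2) => q; lra.
Qed.

End Step.

(** The parameters are chosen in order: [eta] from the Lipschitz constant of [P], so that [P] is at
    most 11/10 at the nodes; then the contour constants; then the Cauchy error constants for [P] and
    for 1; finally [h]. *)
Lemma spec_improve (c0 : R) :
  (forall eta, 0 < eta -> poly_contours O eta) -> 5 <= c0 ->
  spec_bound O A c0 -> spec_bound O A (9 / 10 * c0).
Proof.
move=> hct c05 hc P hP.
have [Lp Lp0 hLp] := poly_lipschitz P (addr_ge0 D0 ler01).
pose eta := Num.min 1 (1 / 10 / (Lp + 1)).
have Lp1 : 0 < Lp + 1 by rewrite ltr_wpDl.
have eta0 : 0 < eta by rewrite lt_min ltr01 !divr_gt0.
have eta1 : eta <= 1 by rewrite ge_min lexx.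
have etaL : Lp * eta <= 1 / 10.
  have : eta * (Lp + 1) <= 1 / 10 by rewrite -ler_pdivlMr // ge_min lexx orbT.
  by have := ltW eta0; nra.
have [d [L [D' [l [[d0 L0 D'0 l0] hJ]]]]] := hct _ eta0.
pose D1 := D' + D + 1.
have D10 : 0 <= D1 by rewrite !addr_ge0.
have DD1 : D <= D1 by rewrite /D1 addrAC lerDr addr_ge0.
have [K K0 hK] := cauchy_formula P d0 D10 L0.
have [K1 K10 hK1] := cauchy_formula (1 : {poly C}) d0 D10 L0.
have D1p : 0 < D1 by rewrite ltr_wpDl // addr_ge0.
(* The lower bound for [re c] given by [kernel_sum_re]; hence [e := k0 / 100] satisfies
   [100 * e <= re c]. *)
pose k0 := l * (d / (D1 + D1) ^+ 2).
have k00 : 0 < k0 by rewrite mulr_gt0 // divr_gt0 // exprn_gt0 // addr_gt0.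
pose e := k0 / 100; have e0 : 0 < e by rewrite divr_gt0.
pose h := e / (K + K1 + 1).
have KK : 0 < K + K1 + 1 by rewrite ltr_wpDl // addr_ge0.
have h0 : 0 < h by rewrite divr_gt0.
have hKK : (K + K1 + 1) * h = e by rewrite /h mulrC divfK // gt_eqF.
have Kh : K * h <= e by rewrite -hKK ler_wpM2r ?(ltW h0) // -addrA lerDl addr_ge0.
have K1h : K1 * h <= e.
  by rewrite -hKK ler_wpM2r ?(ltW h0) // addrAC lerDr addr_ge0.
have [J [s [s' [nv [r [ct' lr near_O]]]]]] := hJ h h0.
have ct : contour O d h L D1 s s' nv r.
  by apply: contour_leD ct'; rewrite /D1 -addrA lerDl addr_ge0.
have Ps j : cabs P.[s j] <= 11 / 10.
  have [z Oz sz] := near_O j.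
  have zD := OD Oz.
  have sD : cabs (s j) <= D + 1.
    rewrite -[s j](subrK z) addrC; apply: le_trans (cabsD _ _) _.
    by apply: lerD => //; apply: le_trans sz _.
  have zD' : cabs z <= D + 1 by apply: le_trans zD _; rewrite lerDl ler01.
  rewrite -[P.[s j]](subrK P.[z]); apply: le_trans (cabsD _ _) _.
  have := hLp _ _ zD' sD; have := hP _ Oz.
  have : Lp * cabs (s j - z) <= Lp * eta by rewrite ler_wpM2l.
  by lra.
have z0D : cabs z0 <= D1 by apply: le_trans (OD Oz0) _.
have AD1 : opb A D1 by apply: opb_le AD _.
have scal z : O z -> num_in (z%:M : 'M[C]_1) O /\ opb (z%:M : 'M[C]_1) D1.
  move=> Oz; split; first exact: num_in_scalar.
  apply: (@opb_le _ _ _ _ (cabs z)); first exact: opb_scalar.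
  by apply: le_trans (OD Oz) _.
have hv := hK _ _ _ _ _ _ _ ct h0 cO _ Oz0 z0D.
have hu := hK1 _ _ _ _ _ _ _ ct h0 cO _ Oz0 z0D.
apply: (spec_step c05 hc hP ct d0 Ps e0).
- rewrite /e mulrC divfK ?pnatr_eq0 //.
  exact: (kernel_sum_re ct d0 Oz0 z0D lr).
- move=> z Oz; have [sz1 sz2] := scal z Oz.
  apply: (kernel_sum_scalar ct d0 Oz); apply: opb_le Kh.
  by have := hv _ _ sz1 sz2; rewrite horner_mx_scalar.
- move=> z Oz; have [sz1 sz2] := scal z Oz.
  rewrite -[X in _ - X]mulr1; apply: (kernel_sum_scalar ct d0 Oz); apply: opb_le K1h.
  have := hu _ _ sz1 sz2; rewrite horner_mx_scalar hornerC.
  by under eq_bigr do rewrite hornerC mulr1.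
- by apply: opb_le Kh; apply: hv.
- apply: opb_le K1h; have := hu _ _ An AD1.
  under eq_bigr do rewrite hornerC mulr1.
  by rewrite rmorph1 scalemx1.
Qed.

End SpectralImprove.

(** * From some finite spectral constant to the constant 5 *)

Section SpectralPoly.
Variable R : realType.
Notation C := R[i].

Definition fatten (O : set C) (eta : R) : set C :=
  [set y | exists2 z, O z & cabs (y - z) <= eta].

Lemma fatten_cvx O eta : cvx O -> cvx (fatten O eta).
Proof.
move=> cO y1 y2 t [z1 O1 h1] [z2 O2 h2] t01.
exists (t%:C * z1 + (1 - t)%:C * z2); first exact: cO.
have -> : t%:C * y1 + (1 - t)%:C * y2 - (t%:C * z1 + (1 - t)%:C * z2)
   = t%:C * (y1 - z1) + (1 - t)%:C * (y2 - z2) by ring.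
apply: le_trans (cabsD _ _) _; rewrite !cabsM !cabs_real.
case/andP: t01 => t0 t1; rewrite !ger0_norm ?subr_ge0 //.
have -> : eta = t * eta + (1 - t) * eta by ring.
by apply: lerD; apply: ler_wpM2l; rewrite ?subr_ge0.
Qed.

Lemma spec_bound_le (O : set C) n (A : 'M[C]_n.+1) c1 c2 :
  c1 <= c2 -> spec_bound O A c1 -> spec_bound O A c2.
Proof. by move=> h12 h P hP; apply: opb_le h12; apply: h. Qed.

(** Provides a finite constant from which improvement can start. The nodes around [O0] lie in the
    fattened set, where [P] is at most 1, so the Cauchy sum is at most [L / d]. The step length
    depends on [P] and makes the error at most 1, but the resulting constant is free of [P]. *)
Lemma spec_apriori (O0 : set C) z0 (D eta : R) n (A : 'M[C]_n.+1) :
  cvx O0 -> O0 z0 -> (forall z, O0 z -> cabs z <= D) -> num_in A O0 -> opb A D ->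
  poly_contours O0 eta -> exists2 c, 0 <= c & spec_bound (fatten O0 eta) A c.
Proof.
move=> cO Oz OD An AD [d [L [D' [l [[d0 L0 D'0 l0] hJ]]]]].
have D0 : 0 <= D by apply: le_trans (cabs_ge0 _) (OD _ Oz).
pose D1 := D' + D + 1.
have D1p : 0 < D1 by rewrite ltr_wpDl // addr_ge0.
have DD1 : D <= D1 by rewrite /D1 addrAC lerDr addr_ge0.
pose k0 := l * (d / (D1 + D1) ^+ 2).
have k00 : 0 < k0 by rewrite mulr_gt0 // divr_gt0 // exprn_gt0 // addr_gt0.
have Ld : 0 <= L / d + 1 by rewrite addr_ge0 // divr_ge0 // ltW.
exists ((L / d + 1) / k0); first by rewrite divr_ge0 // ltW.
move=> P hP; have [K K0 hK] := cauchy_formula P d0 (ltW D1p) L0.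
have K1 : 0 < K + 1 by rewrite ltr_wpDl.
have h0 : 0 < (K + 1)^-1 by rewrite invr_gt0.
have [J [s [s' [nv [r [ct' lr near_O]]]]]] := hJ _ h0.
have ct : contour O0 d (K + 1)^-1 L D1 s s' nv r.
  by apply: contour_leD ct'; rewrite /D1 -addrA lerDl addr_ge0.
have z0D : cabs z0 <= D1 by apply: le_trans (OD _ Oz) _.
have := hK _ _ _ _ _ _ _ ct h0 cO _ Oz z0D _ _ An (opb_le AD DD1).
have := kernel_sum_re ct d0 Oz z0D lr.
set c := \sum_j _ / _; set V := \sum_j _ => hc hV.
have hV' : opb V (L / d).
  apply: (@opb_le _ _ _ _ (\sum_j r j * d^-1)); last first.
    by rewrite -mulr_suml ler_wpM2r ?(ct_len ct) // invr_ge0 ltW.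
  apply: opb_sum => j _.
  have [_ us] := resolvent_bound d0 (ct_nv ct j) (ct_sep ct j) An.
  have /andP[r0 _] := ct_r ct j.
  apply: (opb_le (opbZ _ us)); rewrite ler_wpM2r ?invr_ge0 ?(ltW d0) //.
  rewrite !cabsM (ct_nv ct) mulr1 cabs_real ger0_norm // ler_piMr //.
  exact: hP (near_O j).
have cc : k0 <= cabs c by apply: le_trans hc (re_le_cabs _).
have c0 : 0 < cabs c by apply: lt_le_trans cc.
have hcT : opb (c *: horner_mx A P) (L / d + 1).
  have -> : c *: horner_mx A P = V - (V - c *: horner_mx A P).
    by rewrite opprB addrC subrK.
  apply: opbB => //; apply: opb_le hV _.
  by rewrite ler_pdivrMr // mul1r lerDl.
have -> : horner_mx A P = c^-1 *: (c *: horner_mx A P).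
  by rewrite scalerA mulVf ?scale1r // -cabs_gt0.
apply: (opb_le (opbZ _ hcT)); rewrite cabsV mulrC ler_wpM2l //.
by rewrite lef_pV2 ?posrE.
Qed.

(** [(9 / 10) ^+ k * c] falls below 5 after finitely many improvements; the maximum with 5 keeps
    each of them applicable. *)
Lemma spec_bound_improve5 (O : set C) n (A : 'M[C]_n.+1) c :
  (forall c0, 5 <= c0 -> spec_bound O A c0 -> spec_bound O A (9 / 10 * c0)) ->
  0 <= c -> spec_bound O A c -> spec_bound O A 5.
Proof.
move=> imp c0 hc.
have H k : spec_bound O A (Num.max 5 ((9 / 10) ^+ k * c)).
  elim: k => [|k IH].
    by apply: spec_bound_le hc; rewrite expr0 mul1r le_max lexx orbT.
  have := imp _ _ IH; rewrite le_max lexx => /(_ isT); apply: spec_bound_le.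
  rewrite maxr_pMr; last by lra.
  by rewrite ge_max exprS -mulrA !le_max lexx orbT andbT; apply/orP; left; lra.
have [k hk] : exists k, (9 / 10 : R) ^+ k <= 5 / (c + 1).
  apply: expr_small; first by apply/andP; split; lra.
  by rewrite divr_gt0 // ltr_wpDl.
apply: spec_bound_le (H k); rewrite ge_max lexx /=.
have c1 : 0 < c + 1 by rewrite ltr_wpDl.
rewrite ler_pdivlMr // in hk; apply: le_trans hk.
by rewrite ler_wpM2l ?lerDl // exprn_ge0 //; lra.
Qed.

(** The existence of contours is a hypothesis here, supplied later by [polygon_contours]. It serves
    twice: around [O0] for a finite constant on the fattened set, and around the fattened set for
    lowering it to 5. *)
Lemma spectral_poly (O0 : set C) z0 (D eta : R) n (A : 'M[C]_n.+1) :
  (forall (O : set C) z (B e : R), cvx O -> O z -> (forall y, O y -> cabs y <= B) ->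
    0 < e -> poly_contours O e) ->
  cvx O0 -> O0 z0 -> (forall z, O0 z -> cabs z <= D) -> num_in A O0 -> 0 < eta ->
  spec_bound (fatten O0 eta) A 5.
Proof.
move=> hct cO Oz OD An eta0.
have D0 : 0 <= D by apply: le_trans (cabs_ge0 _) (OD _ Oz).
have [a a0 Aa] := opb_exists A.
pose D1 := D + a + eta.
have DD1 : D <= D1 by rewrite /D1 -addrA lerDl addr_ge0 // ltW.
have aD1 : a <= D1 by rewrite /D1 addrAC lerDr addr_ge0 // ltW.
have sub z : O0 z -> fatten O0 eta z.
  by move=> Oz'; exists z => //; rewrite subrr cabs0 ltW.
have OD1 z : fatten O0 eta z -> cabs z <= D1.
  move=> [y Oy zy]; rewrite -[z](subrK y); apply: le_trans (cabsD _ _) _.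
  rewrite addrC /D1 -addrA; apply: lerD; first exact: OD.
  by apply: le_trans zy _; rewrite lerDr.
have [c c0 hc] := spec_apriori cO Oz (fun z h => le_trans (OD z h) DD1) An
  (opb_le Aa aD1) (hct _ _ _ _ cO Oz OD eta0).
apply: spec_bound_improve5 c0 hc => c1 c15 h1.
apply: (spec_improve (fatten_cvx cO) (sub _ Oz) OD1) h1 => //.
- by move=> x x1; apply: sub; apply: An.
- exact: opb_le Aa aD1.
- by move=> e e0; apply: hct e0; [exact: fatten_cvx | exact: (sub _ Oz) | exact: OD1].
Qed.

End SpectralPoly.

(** * Polygons around convex sets *)

Section PolygonContours.
Variable R : realType.
Notation C := R[i].

(* Starting from i, take square roots with positive real part. *)
Lemma small_root_of_unity (eta : R) : 0 < eta -> exists N (zeta : C),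
  [/\ zeta ^+ N.+1 = 1, cabs zeta = 1, 0 < complex.Im zeta & cabs (zeta - 1) <= eta].
Proof.
move=> eta0.
have H k : exists N (a b : R), [/\ (a +i* b) ^+ N.+1 = 1, a ^+ 2 + b ^+ 2 = 1,
    0 <= a /\ 0 < b & 1 - a <= (1 / 2) ^+ k].
  elim: k => [|k [N [a [b [h1 h2 [a0 b0] h3]]]]].
    exists 3, 0, 1; split=> //; last by rewrite subr0 expr0.
      by rewrite -[4%N]/(2 * 2)%N exprM sqr_i -signr_odd expr0.
    by rewrite expr0n expr1n /= add0r.
  pose a' := Num.sqrt ((1 + a) / 2).
  have a1 : 0 < (1 + a) / 2 by rewrite divr_gt0 // ltr_wpDr.
  have a'0 : 0 < a' by rewrite sqrtr_gt0.
  have a'2 : a' ^+ 2 = (1 + a) / 2 by rewrite sqr_sqrtr // ltW.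
  pose b' := b / (2 * a').
  have b'0 : 0 < b' by rewrite divr_gt0 // mulr_gt0.
  have b'2 : b' ^+ 2 = (1 - a) / 2.
    rewrite /b' expr_div_n exprMn a'2.
    have -> : b ^+ 2 = (1 - a) * (1 + a) by move: h2; lra.
    by field; lra.
  have ab : (a' +i* b') ^+ 2 = a +i* b.
    rewrite expr2; simpc; congr (_ +i* _).
      by rewrite -!expr2 a'2 b'2; field.
    by rewrite /b'; field; rewrite gt_eqF.
  exists (2 * N.+1).-1, a', b'; split.
  - by rewrite prednK ?muln_gt0 // exprM ab.
  - by rewrite a'2 b'2; field.
  - by split=> //; apply: ltW.
  (* The half-angle relation [(1 - a') * (1 + a') = (1 - a) / 2] at least halves [1 - a]. *)
  - rewrite exprS; have : (1 - a') * (1 + a') = (1 - a) / 2.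
      by rewrite -subr_sqr expr1n a'2; field.
    have a'1 : a' <= 1.
      rewrite -ler_sqr ?nnegrE ?(ltW a'0) // a'2 expr1n.
      have : a ^+ 2 <= 1 ^+ 2 by rewrite expr1n -h2 lerDl sqr_ge0.
      by rewrite ler_sqr ?nnegrE //; lra.
    by nra.
have e2 : 0 < eta ^+ 2 / 2 by rewrite divr_gt0 // exprn_gt0.
have [k hk] := @expr_small R (1 / 2) (eta ^+ 2 / 2) ltac:(apply/andP; split; lra) e2.
have [N [a [b [h1 h2 [a0 b0] h3]]]] := H k.
exists N, (a +i* b); split=> //.
  by rewrite /cabs /= h2 sqrtr1.
rewrite -ler_sqr ?nnegrE ?cabs_ge0 ?(ltW eta0) // cabs2 /=.
have -> : (a - 1) ^+ 2 + (b - 0) ^+ 2 = (a ^+ 2 + b ^+ 2) + 1 - 2 * a by ring.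
by rewrite h2; lra.
Qed.

Lemma near_maximizer (O : set C) (z0 u : C) (B e : R) : O z0 ->
  (forall z, O z -> cabs z <= B) -> 0 < e -> cabs u = 1 ->
  exists2 z, O z & forall y, O y -> re (u^*%C * y) <= re (u^*%C * z) + e.
Proof.
move=> Oz OB e0 u1.
pose S : set R := [set re (u^*%C * z) | z in O].
have hS : has_sup S.
  split; first by exists (re (u^*%C * z0)), z0.
  exists B => _ [z Oz' <-]; apply: le_trans (re_le_cabs _) _.
  by rewrite cabsM cabsJ u1 mul1r OB.
have [_ [z Oz' <-] hz] := sup_adherent e0 hS.
exists z => // y Oy; rewrite -lerBlDr; apply: ltW; apply: le_lt_trans hz.
by rewrite lerD2r; apply: (ub_le_sup hS.2); exists y.
Qed.

(** Cramer's rule for the outer normal [- 'i * e] of an edge in the directions [w] and [w * zeta],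
    with determinant [complex.Im zeta]. For an edge between support vertices of these directions
    both coefficients are nonnegative. *)
Lemma edge_normal (w zeta e : C) : cabs w = 1 -> cabs zeta = 1 ->
  - 'i%C * (complex.Im zeta)%:C * e = (re ((w * zeta)^*%C * e))%:C * w
     + (- re (w^*%C * e))%:C * (w * zeta).
Proof.
move=> w1 z1; pose E := w^*%C * e.
have eE : e = w * E by rewrite /E mulrA [w * _]mulrC mulJc w1 expr1n mul1r.
have -> : (w * zeta)^*%C * e = zeta^*%C * E.
  by rewrite rmorphM /= /E -mulrA mulrCA mulrA.
rewrite -/E {1}eE.
have -> : (re (zeta^*%C * E))%:C * w + (- re E)%:C * (w * zeta)
   = w * ((re (zeta^*%C * E))%:C + (- re E)%:C * zeta) by ring.
rewrite mulrCA; congr (_ * _); case: (zeta) (E) => c s [p q]; rewrite /re /=.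
by simpc; congr (_ +i* _); ring.
Qed.

Section Polygon.
Variables (O : set C) (z0 : C) (B eta : R) (N : nat) (zeta : C).
Hypothesis cO : cvx O.
Hypothesis Oz : O z0.
Hypothesis OB : forall z, O z -> cabs z <= B.
Hypothesis eta0 : 0 < eta.
Hypothesis zN : zeta ^+ N.+1 = 1.
Hypothesis z1 : cabs zeta = 1.
Hypothesis zim : 0 < complex.Im zeta.
Hypothesis zsmall : cabs (zeta - 1) * (2 * (B + eta)) <= 3 / 8 * eta.

Let w (k : 'I_N.+1) : C := zeta ^+ k.

Let w1 k : cabs (w k) = 1.
Proof. by rewrite cabsX z1 expr1n. Qed.

Let wS k : w (ordS k) = w k * zeta.
Proof.
rewrite /w /= -exprSr; have := ltn_ord k; rewrite leq_eqVlt => /orP[/eqP ->|h].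
  by rewrite modnn zN.
by rewrite modn_small.
Qed.

(** Near-maximizers of [O] in the directions [w k] are pushed out by [eta], of which the tolerance
    takes a quarter. Then [x k] is the best of these finitely many points in direction [w k], which
    makes the third property exact although the supremum over [O] may not be attained. *)
Lemma support_vertices : exists x : 'I_N.+1 -> C,
  [/\ forall k, fatten O eta (x k),
      forall k z, O z -> 3 / 4 * eta <= re ((w k)^*%C * (x k - z))
    & forall k l, re ((w k)^*%C * x l) <= re ((w k)^*%C * x k)].
Proof.
have e4 : 0 < eta / 4 by rewrite divr_gt0.
have hz k : exists z, O z /\ forall y, O y ->
    re ((w k)^*%C * y) <= re ((w k)^*%C * z) + eta / 4.
  by have [z Oz' h] := near_maximizer Oz OB e4 (w1 k); exists z.
have [zk hk] := choice hz.
pose y k := zk k + eta%:C * w k.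
have yO k : fatten O eta (y k).
  exists (zk k); first by have [] := hk k.
  by rewrite /y addrAC subrr add0r cabsM w1 mulr1 cabs_real ger0_norm // ltW.
have ysep k z : O z -> 3 / 4 * eta <= re ((w k)^*%C * (y k - z)).
  move=> Oz'; have [_ /(_ _ Oz')] := hk k.
  rewrite /y mulrBr mulrDr mulrCA mulJc w1 expr1n mulr1 reB reD.
  by rewrite {4}/re /=; lra.
pose i k := [arg max_(j > ord0) re ((w k)^*%C * y j)]%O.
have hi k j : re ((w k)^*%C * y j) <= re ((w k)^*%C * y (i k)).
  by rewrite /i; case: arg_maxP => // m _; apply.
exists (fun k => y (i k)); split=> [k|k z Oz'|k l]; first exact: yO.
  apply: le_trans (ysep k z Oz') _.
  by rewrite !mulrBr !reB lerD2r hi.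
exact: hi.
Qed.

Lemma polygon_contours_at : poly_contours O eta.
Proof.
have [x [xO xsep xmax]] := support_vertices.
pose e k := x (ordS k) - x k.
have B0 : 0 <= B by apply: le_trans (cabs_ge0 _) (OB Oz).
have xB k : cabs (x k) <= B + eta.
  have [z Oz' hz] := xO k; rewrite -[x k](subrK z) addrC.
  by apply: le_trans (cabsD _ _) _; apply: lerD => //; apply: OB.
have eB k : cabs (e k) <= 2 * (B + eta).
  by apply: le_trans (cabsB _ _) _; have := xB k; have := xB (ordS k); lra.
(* A vanishing edge has no normal of its own; the direction of its support vertex is used
   instead. *)
pose nv k : C := if e k == 0 then w k else - 'i%C * e k / (cabs (e k))%:C.
have i1 : cabs 'i%C = 1 :> R by rewrite /cabs /= expr0n expr1n add0r sqrtr1.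
have nv1 k : cabs (nv k) = 1.
  rewrite /nv; case: eqP => [_|/eqP ek]; first exact: w1.
  rewrite !cabsM cabsV cabsN i1 mul1r cabs_real ger0_norm ?cabs_ge0 //.
  by rewrite divff // cabs_eq0.
have nve k : 'i%C * ((cabs (e k))%:C * nv k) = e k.
  rewrite /nv; case: eqP => [->|/eqP ek]; first by rewrite cabs0 mul0r mulr0.
  have ek' : (cabs (e k))%:C != 0 by rewrite -cabs_eq0 cabs_real normr_eq0 cabs_eq0.
  have -> : 'i%C * ((cabs (e k))%:C * (- 'i%C * e k / (cabs (e k))%:C))
    = - ('i%C ^+ 2) * e k * ((cabs (e k))%:C / (cabs (e k))%:C) by ring.
  by rewrite divff // mulr1 sqr_i opprK mul1r.
have nvsep k (t : R) z : O z -> 3 / 8 * eta <=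
    re ((nv k)^*%C * (x k + t%:C * e k - z)).
  move=> Oz'; have xs := xsep k z Oz'; have xs' := xsep (ordS k) z Oz'.
  rewrite /nv; case: eqP => [->|/eqP ek].
    by rewrite mulr0 addr0; move: eta0 xs; lra.
  have ce : 0 < cabs (e k) by rewrite cabs_gt0.
  set v := - 'i%C * e k / _.
  have E0 : re (v^*%C * (t%:C * e k)) = 0.
    have -> : v^*%C = (cabs (e k))^-1%:C * ('i%C * (e k)^*%C).
      rewrite /v -fmorphV; case: (e k) => p q /=; move: (_^-1) => c.
      by simpc; congr (_ +i* _); ring.
    have -> : (cabs (e k))^-1%:C * ('i%C * (e k)^*%C) * (t%:C * e k)
      = ((cabs (e k))^-1 * (t * cabs (e k) ^+ 2))%:C * 'i%C.
      by rewrite 2!rmorphM /= -mulJc; ring.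
    by rewrite reMr [re _]/= mulr0.
  rewrite addrAC mulrDr reD E0 addr0.
  (* The coefficients of [edge_normal]. Going from [x (ordS k)] to [x k] loses [b <= 3 / 8 * eta] of
     the separation [3 / 4 * eta], so each direction retains [3 / 8 * eta]; [a + b] is at least the
     length of the scaled normal, so the bound survives normalization. *)
  pose a := - re ((w k)^*%C * e k); pose b := re ((w (ordS k))^*%C * e k).
  have a0 : 0 <= a by rewrite oppr_ge0 mulrBr reB subr_le0.
  have b0 : 0 <= b by rewrite /b mulrBr reB subr_ge0.
  have ba : b <= 3 / 8 * eta.
    have : b <= b + a by rewrite lerDl.
    move/le_trans; apply; rewrite /b /a -reB -mulrBl -rmorphB wS.
    have -> : w k * zeta - w k = w k * (zeta - 1) by ring.
    apply: le_trans (re_le_cabs _) _; rewrite cabsM cabsJ cabsM w1 mul1r.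
    by apply: le_trans zsmall; rewrite ler_wpM2l ?cabs_ge0.
  have := edge_normal (e k) (w1 k) z1; rewrite -wS -/a -/b => En.
  have sE : complex.Im zeta * cabs (e k) <= a + b.
    have -> : complex.Im zeta * cabs (e k)
        = cabs (- 'i%C * (complex.Im zeta)%:C * e k).
      by rewrite !cabsM cabsN i1 mul1r cabs_real gtr0_norm.
    rewrite En; apply: le_trans (cabsD _ _) _.
    by rewrite !cabsM !w1 !mulr1 !cabs_real !ger0_norm // addrC.
  have Ev : (complex.Im zeta * cabs (e k)) * re (v^*%C * (x k - z)) =
     b * re ((w k)^*%C * (x k - z)) + a * re ((w (ordS k))^*%C * (x k - z)).
    rewrite -!reMr -reD !mulrA -mulrDl; congr (re (_ * _)).
    rewrite -[in RHS](conjc_real b) -[in RHS](conjc_real a) -!rmorphM -rmorphD /= -En.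
    rewrite -[(_ * _)%:C]conjc_real -rmorphM; congr (_^*%C)%C.
    have ek' : (cabs (e k))%:C != 0 by rewrite -cabs_eq0 cabs_real normr_eq0 cabs_eq0.
    rewrite /v rmorphM /=; move: ek'; move: (cabs (e k))%:C => q q0; by field.
  have h2 : re ((w (ordS k))^*%C * (x k - z))
      = re ((w (ordS k))^*%C * (x (ordS k) - z)) - b.
    by rewrite /b -reB -mulrBr; congr (re (_ * _)); rewrite /e; ring.
  rewrite h2 in Ev.
  have sp : 0 < complex.Im zeta * cabs (e k) by rewrite mulr_gt0.
  rewrite -(ler_pM2l sp) Ev.
  move: sE xs xs' ba a0 b0; move: (complex.Im zeta * _) => S.
  move: (re (_ * (x k - z))) (re (_ * (x (ordS k) - z))) => X Y.
  move=> sE xs xs' ba a0 b0.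
  have g1 : b * (3 / 4 * eta) <= b * X by rewrite ler_wpM2l.
  have g2 : a * (3 / 8 * eta) <= a * (Y - b) by rewrite ler_wpM2l //; lra.
  have g3 : S * (3 / 8 * eta) <= (a + b) * (3 / 8 * eta).
    by rewrite ler_wpM2r //; move: eta0; lra.
  have g4 : 0 <= b * eta by rewrite mulr_ge0 // ltW.
  by lra.
pose L := \sum_k cabs (e k).
have L0 : 0 <= L by apply: sumr_ge0 => k _; apply: cabs_ge0.
(* If all edges vanished, the vertices would coincide, and the positive numbers
   [re ((w k)^* (x k - z0))] would add up to 0, as the powers [w k] of a root of unity do. *)
have Lp : 0 < L.
  rewrite lt_def L0 andbT; apply/negP => /eqP LE.
  have ek0 k : e k = 0.
    apply/eqP; rewrite -cabs_eq0; move/eqP: LE.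
    rewrite psumr_eq0 => [|j _]; last exact: cabs_ge0.
    by move/allP/(_ k (mem_index_enum k)).
  have xc k : x k = x ord0.
    case: k => k; elim: k => [|k IH] hk; first by congr x; apply: val_inj.
    rewrite -(IH (ltnW hk)); apply/eqP; rewrite -subr_eq0; apply/eqP.
    rewrite -[RHS](ek0 (Ordinal (ltnW hk))) /e; congr (x _ - _); apply: val_inj => /=.
    by rewrite modn_small.
  have : 0 < \sum_k re ((w k)^*%C * (x k - z0)).
    rewrite big_ord_recl ltr_pwDl //.
      by apply: lt_le_trans (xsep _ _ Oz); rewrite mulr_gt0 // divr_gt0.
    apply: sumr_ge0 => k _; apply: le_trans (xsep _ _ Oz).
    by rewrite mulr_ge0 ?(ltW eta0) // divr_ge0.
  under eq_bigr do rewrite xc.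
  rewrite -re_sum -mulr_suml -rmorph_sum /=.
  have -> : \sum_k w k = 0.
    have zn1 : zeta - 1 != 0.
      apply/negP => /eqP; move: zim; case: (zeta) => a b /= b0 [_ /eqP].
      by rewrite subr0 gt_eqF.
    by apply: (mulfI zn1); rewrite mulr0 -subrX1 zN subrr.
  by rewrite rmorph0 mul0r ltxx.
(* The perimeter is both the upper and the lower bound of the length; [3 * (B + eta)] bounds
   [cabs (x k) + cabs (e k)]. *)
exists (3 / 8 * eta), L, (3 * (B + eta)), L; split.
  split=> //; first by rewrite mulr_gt0 // divr_gt0.
  by rewrite mulr_ge0 // addr_ge0 // ltW.
move=> h h0.
(* Cutting each edge into [m] pieces makes every step at most [h]. *)
pose m := (Num.bound (2 * (B + eta) / h)).+1.
have m0 : 0 < m%:R :> R by rewrite ltr0n.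
have hm : 2 * (B + eta) / m%:R <= h.
  rewrite ler_pdivrMr // -ler_pdivrMl // mulrC.
  apply: ltW; apply: lt_le_trans (archi_boundP _) _.
    by rewrite divr_ge0 ?(ltW h0) // mulr_ge0 // addr_ge0 // ltW.
  by rewrite ler_nat.
pose nd (k : 'I_N.+1) (l : nat) : C := x k + (l%:R / m%:R : R)%:C * e k.
have ndB k l : (l <= m)%N -> cabs (nd k l) <= 3 * (B + eta).
  move=> lm; apply: le_trans (cabsD _ _) _.
  rewrite cabsM cabs_real ger0_norm ?divr_ge0 ?ler0n //.
  have q1 : l%:R / m%:R <= 1 :> R by rewrite ler_pdivrMr // mul1r ler_nat.
  have : l%:R / m%:R * cabs (e k) <= 1 * (2 * (B + eta)).
    by rewrite ler_pM ?cabs_ge0 ?divr_ge0 ?ler0n.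
  by have := xB k; lra.
exists ('I_N.+1 * 'I_m)%type, (fun p : 'I_N.+1 * 'I_m => nd p.1 p.2),
  (fun p : 'I_N.+1 * 'I_m => nd p.1 p.2.+1),
  (fun p : 'I_N.+1 * 'I_m => nv p.1),
  (fun p : 'I_N.+1 * 'I_m => cabs (e p.1) / m%:R).
have sumr : \sum_(p : 'I_N.+1 * 'I_m) cabs (e p.1) / m%:R = L.
  rewrite -(pair_big predT predT (fun k (_ : 'I_m) => cabs (e k) / m%:R)) /=.
  apply: eq_bigr => k _; rewrite sumr_const card_ord -[LHS]mulr_natr divfK //.
  by rewrite gt_eqF.
split; last 1 first.
- move=> [k l] /=; have hl := ltn_ord l.
  have : fatten O eta (nd k l).
    have -> : nd k l = (1 - l%:R / m%:R)%:C * x k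
        + (1 - (1 - l%:R / m%:R))%:C * x (ordS k).
      by rewrite /nd /e !rmorphB !rmorph1; ring.
    apply: (fatten_cvx cO); [exact: xO | exact: xO |].
    rewrite subr_ge0 gerBl divr_ge0 ?ler0n // andbT.
    by rewrite ler_pdivrMr // mul1r ler_nat ltnW.
  by [].
- split.
  + move=> V F; apply/eqP; rewrite -subr_eq0 -sumrB; apply/eqP.
    rewrite -(pair_big predT predT
      (fun k (l : 'I_m) => F (nd k l.+1) - F (nd k l))) /=.
    transitivity (\sum_k (F (x (ordS k)) - F (x k))).
      apply: eq_bigr => k _.
      rewrite -(big_mkord predT (fun l => F (nd k l.+1) - F (nd k l))).
      rewrite telescope_sumr //.
      have -> : nd k 0%N = x k by rewrite /nd mul0r rmorph0 mul0r addr0.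
      have -> // : nd k m = x (ordS k).
      by rewrite /nd divff ?gt_eqF // rmorph1 mul1r /e addrC subrK.
    rewrite sumrB; apply/eqP; rewrite subr_eq0; apply/eqP.
    by rewrite [RHS](reindex_inj (@ordS_inj N.+1)).
  + exact: ltW.
  + move=> [k l] /=; rewrite /nd -natr1 mulrDl rmorphD mulrDl addrA; congr (_ + _).
    by rewrite -{1}(nve k) mul1r fmorphV rmorphM fmorphV /=; ring.
  + by move=> [k l]; apply: nv1.
  + move=> [k l] /=; rewrite divr_ge0 ?cabs_ge0 ?ler0n //=.
    by apply: le_trans hm; rewrite ler_wpM2r ?invr_ge0 ?ler0n.
  + by rewrite sumr.
  + by move=> [k l] /=; split; apply: ndB; rewrite // ltnW.
  + by move=> [k l] /= z Oz'; apply: nvsep.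
- by rewrite sumr.
Qed.

End Polygon.

Lemma polygon_contours (O : set C) z0 (B eta : R) : cvx O -> O z0 ->
  (forall z, O z -> cabs z <= B) -> 0 < eta -> poly_contours O eta.
Proof.
move=> cO Oz OB eta0.
have B0 : 0 <= B by apply: le_trans (cabs_ge0 _) (OB _ Oz).
have p : 0 < 2 * (B + eta) by rewrite mulr_gt0 // ltr_wpDl.
have q : 0 < 3 / 8 * eta by rewrite mulr_gt0 // divr_gt0.
have [N [zeta [h1 h2 h3 h4]]] := small_root_of_unity (divr_gt0 q p).
apply: (polygon_contours_at cO Oz OB eta0 h1 h2 h3).
by rewrite -ler_pdivlMr.
Qed.

End PolygonContours.

(** * Rational functions of a matrix *)

Section SpectralRational.
Variable R : realType.
Notation C := R[i].

Lemma conjcM (x y : C) : (x * y)^*%C = x^*%C * y^*%C.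
Proof. exact: rmorphM. Qed.

Lemma near_minimizer (O : set C) (z0 a : C) (e : R) : O z0 -> 0 < e ->
  exists2 z, O z & forall y, O y -> cabs (a - z) ^+ 2 <= cabs (a - y) ^+ 2 + e.
Proof.
move=> Oz e0; pose S : set R := [set cabs (a - z) ^+ 2 | z in O].
have hS : has_inf S.
  split; first by exists (cabs (a - z0) ^+ 2), z0.
  by exists 0 => _ [z _ <-]; apply: sqr_ge0.
have [_ [z Oz' <-] hz] := inf_adherent e0 hS.
exists z => // y Oy; apply: le_trans (ltW hz) _; rewrite lerD2r.
by apply: (ge_inf hS.2); exists y.
Qed.

(** The variational inequality at a near-projection [z1] of [a]: for [u = a - z1], comparison with
    points of the segment from [z1] to [z] gives [re (u^* (z - z1)) <= delta ^+ 2 / 2], at most half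
    of [cabs u ^+ 2]. *)
Lemma convex_separation (O : set C) (z0 a : C) (B delta : R) : cvx O -> O z0 ->
  (forall z, O z -> cabs z <= B) -> 0 < delta ->
  (forall z, O z -> delta <= cabs (a - z)) ->
  exists2 nv, cabs nv = 1 & sep O nv a (delta / 2).
Proof.
move=> cO Oz OB dl0 hd.
have B0 : 0 <= B by apply: le_trans (cabs_ge0 _) (OB _ Oz).
pose D := B + B.
have d20 : 0 < delta ^+ 2 by rewrite exprn_gt0.
have Dd : 0 < 2 * (D ^+ 2 + delta ^+ 2) by rewrite mulr_gt0 // ltr_wpDl ?sqr_ge0.
(* Small enough for [t * D ^+ 2 <= delta ^+ 2 / 2]; the tolerance [t * delta ^+ 2 / 2] of the
   near-minimum contributes the same amount after division by [t]. *)
pose t := delta ^+ 2 / (2 * (D ^+ 2 + delta ^+ 2)).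
have t0 : 0 < t by rewrite divr_gt0.
have tE : t * (2 * (D ^+ 2 + delta ^+ 2)) = delta ^+ 2 by rewrite /t divfK // gt_eqF.
have t1 : t <= 1.
  by rewrite /t ler_pdivrMr // mul1r; have := sqr_ge0 D; lra.
have e0 : 0 < t * delta ^+ 2 / 2 by rewrite divr_gt0 // mulr_gt0.
have [z1 Oz1 hz1] := near_minimizer a Oz e0.
pose u := a - z1.
have u0 : delta <= cabs u by apply: hd.
have up : 0 < cabs u by apply: lt_le_trans u0.
exists ((cabs u)^-1%:C * u).
  by rewrite cabsM cabs_real ger0_norm ?invr_ge0 ?cabs_ge0 // mulVf // gt_eqF.
move=> z Oz'.
have zD : cabs (z - z1) ^+ 2 <= D ^+ 2.
  rewrite lerXn2r ?nnegrE ?cabs_ge0 ?addr_ge0 //.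
  by apply: le_trans (cabsB _ _) _; apply: lerD; apply: OB.
have key : re (u^*%C * (z - z1)) <= delta ^+ 2 / 2.
  have Op : O (t%:C * z + (1 - t)%:C * z1) by apply: cO; rewrite ?(ltW t0).
  have := hz1 _ Op; rewrite -/u.
  have -> : a - (t%:C * z + (1 - t)%:C * z1) = u - t%:C * (z - z1).
    by rewrite /u rmorphB rmorph1; ring.
  rewrite (cabsB2 u) cabsM cabs_real ger0_norm ?(ltW t0) // exprMn.
  have -> : re ((t%:C * (z - z1))^*%C * u) = t * re (u^*%C * (z - z1)).
    rewrite -reJ rmorphM /= conjcK -mulrA reMr; congr (_ * _).
    by rewrite mulrC.
  move: (re _) => X h.
  have h1 : t * (2 * X) <= t * (t * D ^+ 2 + delta ^+ 2 / 2).
    have : t ^+ 2 * cabs (z - z1) ^+ 2 <= t ^+ 2 * D ^+ 2.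
      by rewrite ler_wpM2l ?sqr_ge0.
    by move: h; lra.
  rewrite ler_pM2l // in h1.
  have h2 : t * D ^+ 2 <= delta ^+ 2 / 2.
    have : 0 <= t * delta ^+ 2 by rewrite mulr_ge0 ?sqr_ge0 ?(ltW t0).
    by move: tE; lra.
  by lra.
have -> : ((cabs u)^-1%:C * u)^*%C * (a - z) = (cabs u)^-1%:C * (u^*%C * (a - z)).
  by rewrite conjcM conjc_real mulrA.
rewrite reMr ler_pdivlMl //.
have -> : re (u^*%C * (a - z)) = cabs u ^+ 2 - re (u^*%C * (z - z1)).
  have -> : a - z = u - (z - z1) by rewrite /u; ring.
  by rewrite mulrBr mulJc reB.
have : delta * delta <= cabs u * delta by rewrite ler_wpM2r // ltW.
have : cabs u * delta <= cabs u * cabs u by rewrite ler_wpM2l // ltW.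
by move: key; rewrite !expr2; lra.
Qed.

(** Induction over the roots: a line separates each of them from [O], so its resolvent is a limit of
    polynomials, and [approxM] multiplies the limits. *)
Lemma approx_inv_prod (O : set C) n (A : 'M[C]_n.+1) z0 (B delta : R) (rs : seq C) :
  cvx O -> O z0 -> (forall z, O z -> cabs z <= B) -> num_in A O ->
  spec_bound O A 5 -> 0 < delta ->
  (forall a z, a \in rs -> O z -> delta <= cabs (a - z)) ->
  let q := \prod_(a <- rs) ('X - a%:P) in
  [/\ horner_mx A q \is a GRing.unit,
      forall z, O z -> cabs (q.[z])^-1 <= delta^-1 ^+ size rs
    & approx O A (fun z => (q.[z])^-1) (horner_mx A q)^-1].
Proof.
move=> cO Oz OB An h5 dl0; have B0 : 0 <= B by apply: le_trans (cabs_ge0 _) (OB _ Oz).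
elim: rs => [|a rs IH] hrs /=.
  rewrite big_nil rmorph1 invr1; split=> [|z _|]; first exact: unitr1.
    by rewrite hornerC invr1 cabs1 expr0.
  have := approx_poly O A 1; rewrite rmorph1; apply: approx_ext => z _.
  by rewrite hornerC invr1.
have [|u1 b1 ap1] := IH; first by move=> b z hb; apply: hrs; rewrite inE hb orbT.
rewrite big_cons hmxM hmxB horner_mx_X horner_mx_C.
set q := \prod_(b <- rs) _ in u1 b1 ap1 *.
have da z : O z -> delta <= cabs (a - z) by apply: hrs; rewrite inE eqxx.
have [nv nv1 hs] := convex_separation cO Oz OB dl0 da.
have d20 : 0 < delta / 2 by rewrite divr_gt0.
have [us _] := resolvent_bound d20 nv1 hs An.
have ap := approx_resolvent d20 nv1 hs An OB B0 h5 (ler0n _ 5).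
have us' : A - a%:M \is a GRing.unit by rewrite -opprB unitrN.
have bz z : O z -> cabs (z - a)^-1 <= delta^-1.
  move=> Oz'; rewrite cabsV cabs_distrC lef_pV2 ?posrE ?da //.
  exact: lt_le_trans (da _ Oz').
split.
- by rewrite unitrMl.
- move=> z Oz'; rewrite hornerM hornerXsubC invfM cabsM exprS.
  by apply: ler_pM; rewrite ?cabs_ge0 ?bz ?b1.
- rewrite (invrM us' u1).
  have -> : (A - a%:M)^-1 = (-1) *: (a%:M - A)^-1.
    by rewrite -[A - _]opprB invrN scaleN1r.
  have dm : 0 <= delta^-1 ^+ size rs by rewrite exprn_ge0 // invr_ge0 ltW.
  have di : 0 <= delta^-1 by rewrite invr_ge0 ltW.
  have apN : approx O A (fun z => (z - a)^-1) ((-1) *: (a%:M - A)^-1).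
    apply: approx_ext (approxZ (-1) ap) => z _.
    by rewrite mulN1r -invrN opprB.
  apply: approx_ext (approxM dm di b1 bz ap1 apN) => z _.
  by rewrite hornerM hornerXsubC invfM mulrC.
Qed.

(* The Crouzeix--Palencia bound, with 5 in place of 1 + sqrt 2. *)
Theorem spectral_rational (O : set C) z0 (B M : R) n (A : 'M[C]_n.+1)
    (p q : {poly C}) :
  cvx O -> O z0 -> (forall z, O z -> cabs z <= B) -> num_in A O -> coprimep p q ->
  0 <= M -> (forall z, O z -> cabs p.[z] <= M * cabs q.[z]) ->
  horner_mx A q \is a GRing.unit /\
  opb (horner_mx A p * (horner_mx A q)^-1) (5 * M).
Proof.
move=> cO Oz OB An cpq M0 hpq.
have B0 : 0 <= B by apply: le_trans (cabs_ge0 _) (OB _ Oz).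
have B2 : 0 <= B + 2 by rewrite addr_ge0.
have [[u v] /= uv] := Bezout_eq1_coprimepP _ _ cpq.
have [U U0 hU] := poly_bounded u B0; have [V V0 hV] := poly_bounded v B0.
have [Pb Pb0 hPb] := poly_bounded p B2.
have [Lp Lp0 hLp] := poly_lipschitz p B2; have [Lq Lq0 hLq] := poly_lipschitz q B2.
(* The Bezout identity and [|p| <= M |q|] give [1 <= (U * M + V) * |q|], hence a positive lower
   bound for [|q|] on [O]. *)
pose k := U * M + V + 1.
have k0 : 0 < k by rewrite ltr_wpDl // addr_ge0 // mulr_ge0.
have qk z : O z -> k^-1 <= cabs q.[z].
  move=> Oz'; have zB := OB _ Oz'.
  have := congr1 (horner^~ z) uv; rewrite hornerD !hornerM hornerC => E.
  have : 1 <= cabs (u.[z] * p.[z]) + cabs (v.[z] * q.[z]).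
    by rewrite -(cabs1 R) -E cabsD.
  rewrite !cabsM => h1; rewrite -[k^-1]mulr1 ler_pdivrMl //.
  apply: le_trans h1 _; rewrite /k 2!mulrDl mul1r -mulrA.
  have g1 : cabs u.[z] * cabs p.[z] <= U * (M * cabs q.[z]).
    by apply: ler_pM; rewrite ?cabs_ge0 ?hU ?hpq.
  have g2 : cabs v.[z] * cabs q.[z] <= V * cabs q.[z].
    by rewrite ler_wpM2r ?cabs_ge0 ?hV.
  by have := cabs_ge0 q.[z]; lra.
have main (e : R) : 0 < e -> horner_mx A q \is a GRing.unit /\
    opb (horner_mx A p * (horner_mx A q)^-1) (5 * (M + e)).
  move=> e0.
  pose K := (Lp + (M + 1) * Lq + 1) * k * 2.
  have K0 : 0 < K by rewrite !mulr_gt0 // ltr_wpDl // addr_ge0 // mulr_ge0 // addr_ge0.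
  (* On the [eta]-neighbourhood [|q|] keeps half of its lower bound, and the quotient of [|p|] and
     [|q|] grows by at most [e]. *)
  pose eta := Num.min (1 / K) (Num.min 1 (e / K)).
  have eta0 : 0 < eta by rewrite !lt_min ltr01 !divr_gt0.
  have etaK : eta * K <= 1 by rewrite -ler_pdivlMr // ge_min lexx.
  have eta1 : eta <= 1 by rewrite !ge_min lexx orbT.
  have etae : eta * K <= e by rewrite -ler_pdivlMr // !ge_min lexx !orbT.
  pose O' := fatten O eta.
  have h5 : spec_bound O' A 5.
    exact: (spectral_poly (@polygon_contours R) cO Oz OB An eta0).
  have OO' z : O z -> O' z by move=> Oz'; exists z => //; rewrite subrr cabs0 ltW.
  have O'B z : O' z -> cabs z <= B + 1.
    move=> [y Oy zy]; rewrite -[z](subrK y) addrC; apply: le_trans (cabsD _ _) _.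
    by apply: lerD; [exact: OB | exact: le_trans zy _].
  have O'q z : O' z -> (2 * k)^-1 <= cabs q.[z] /\ cabs p.[z] <= (M + e) * cabs q.[z].
    move=> Oz'; have [y Oy zy] := Oz'.
    have zB : cabs z <= B + 2 by apply: le_trans (O'B _ Oz') _; lra.
    have yB : cabs y <= B + 2 by apply: le_trans (OB _ Oy) _; lra.
    pose W := Lp + (M + 1) * Lq + 1.
    have W0 : 0 <= W by rewrite !addr_ge0 // mulr_ge0 // addr_ge0.
    have kk : 0 < 2 * k by rewrite mulr_gt0.
    have eW1 : eta * W <= (2 * k)^-1.
      by rewrite -[_^-1]mul1r ler_pdivlMr //; move: etaK; rewrite /K -/W; lra.
    have eWe : eta * W <= e * (2 * k)^-1.
      by rewrite ler_pdivlMr //; move: etae; rewrite /K -/W; lra.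
    have hq : cabs (q.[z] - q.[y]) <= eta * Lq.
      by apply: le_trans (hLq _ _ yB zB) _; rewrite mulrC ler_wpM2r.
    have hp : cabs (p.[z] - p.[y]) <= eta * Lp.
      by apply: le_trans (hLp _ _ yB zB) _; rewrite mulrC ler_wpM2r.
    have qzy : cabs q.[y] <= cabs q.[z] + eta * Lq.
      rewrite -[q.[y]](subrK q.[z]) addrC; apply: le_trans (cabsD _ _) _.
      by rewrite lerD2l cabs_distrC.
    have pzy : cabs p.[z] <= cabs p.[y] + eta * Lp.
      rewrite -[p.[z]](subrK p.[y]) addrC; apply: le_trans (cabsD _ _) _.
      by rewrite lerD2l.
    have eL1 : 0 <= eta * Lp by rewrite mulr_ge0 // ltW.
    have eL2 : 0 <= eta * Lq by rewrite mulr_ge0 // ltW.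
    have eL3 : 0 <= eta * (M * Lq) by rewrite !mulr_ge0 // ltW.
    have WE : eta * W = eta * Lp + eta * (M * Lq) + eta * Lq + eta by rewrite /W; ring.
    have k2 : k^-1 = (2 * k)^-1 + (2 * k)^-1 by field; rewrite gt_eqF.
    have q1 : (2 * k)^-1 <= cabs q.[z].
      by have := qk _ Oy; rewrite k2; move: eW1 qzy eta0; rewrite WE; lra.
    split=> //; apply: le_trans pzy _; have := hpq _ Oy.
    have : M * cabs q.[y] <= M * (cabs q.[z] + eta * Lq) by rewrite ler_wpM2l.
    have : e * (2 * k)^-1 <= e * cabs q.[z] by rewrite ler_wpM2l // ltW.
    by move: eWe eta0; rewrite WE; lra.
  have B10 : 0 <= B + 1 by rewrite addr_ge0.
  have cO' : cvx O' by apply: fatten_cvx.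
  have Oz0' := OO' _ Oz.
  have An' : num_in A O' by move=> x x1; apply: OO'; apply: An.
  have [rs qE] := closed_field_poly_normal q.
  have q0 : q != 0.
    apply/negP => /eqP q0; have := qk _ Oz.
    by rewrite q0 horner0 cabs0 leNgt invr_gt0 k0.
  (* [q] is Lipschitz and at least [(2 * k)^-1] on [O'], so its roots stay this far from [O']. *)
  pose delta := Num.min 1 ((2 * k)^-1 / (Lq + 1)).
  have Lq1 : 0 < Lq + 1 by rewrite ltr_wpDl.
  have dl0 : 0 < delta by rewrite lt_min ltr01 divr_gt0 // invr_gt0 mulr_gt0.
  have hrs a z : a \in rs -> O' z -> delta <= cabs (a - z).
    move=> ars Oz'; rewrite leNgt; apply/negP => h.
    have [q1 _] := O'q _ Oz'.
    have zB := O'B _ Oz'.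
    have az1 : cabs (a - z) <= 1.
      by apply: ltW; apply: lt_le_trans h _; rewrite ge_min lexx.
    have aB : cabs a <= B + 2.
      rewrite -[a](subrK z); apply: le_trans (cabsD _ _) _; lra.
    have zB' : cabs z <= B + 2 by lra.
    have qa : q.[a] = 0.
      apply/rootP; rewrite qE rootZ ?lead_coef_eq0 // root_prod_XsubC //.
    have := hLq _ _ zB' aB; rewrite qa sub0r cabsN => h1.
    have h2 : cabs (a - z) * (Lq + 1) < (2 * k)^-1.
      by rewrite -ltr_pdivlMr //; apply: lt_le_trans h _; rewrite ge_min lexx orbT.
    by have := cabs_ge0 (a - z); lra.
  have [u1 b1 ap1] := approx_inv_prod cO' Oz0' O'B An' h5 dl0 hrs.
  set qr := \prod_(a <- rs) _ in u1 b1 ap1 qE.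
  have lc0 : lead_coef q != 0 by rewrite lead_coef_eq0.
  have qA : horner_mx A q = lead_coef q *: horner_mx A qr by rewrite {1}qE horner_mxZ.
  have uq : horner_mx A q \is a GRing.unit by rewrite qA scaler_unit ?unitfE.
  split=> //.
  have apq : approx O' A (fun z => (q.[z])^-1) (horner_mx A q)^-1.
    have -> : (horner_mx A q)^-1 = (lead_coef q)^-1 *: (horner_mx A qr)^-1.
      by rewrite qA invrZ ?unitfE.
    apply: approx_ext (approxZ (lead_coef q)^-1 ap1) => z _.
    by rewrite [in RHS]qE hornerZ invfM.
  have kk : 0 < 2 * k by rewrite mulr_gt0.
  have iq z : O' z -> cabs (q.[z])^-1 <= 2 * k.
    move=> Oz'; have [q1 _] := O'q _ Oz'.
    rewrite cabsV -[2 * k]invrK lef_pV2 ?posrE ?invr_gt0 //.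
    by apply: lt_le_trans q1; rewrite invr_gt0.
  have pP z : O' z -> cabs p.[z] <= Pb.
    by move=> Oz'; apply: hPb; apply: le_trans (O'B _ Oz') _; lra.
  have ap := approxM Pb0 (ltW kk) pP iq (approx_poly O' A p) apq.
  apply: (approx_bound _ _ h5 ap) => //; first by rewrite addr_ge0 // ltW.
  move=> z Oz'; have [q1 pq] := O'q _ Oz'.
  have qp : 0 < cabs q.[z] by apply: lt_le_trans q1; rewrite invr_gt0.
  by rewrite cabsM cabsV ler_pdivrMr.
split; first by have [] := main 1 ltr01.
apply: (@opb_closed _ _ _ _ _ 5) => // e e0; have [_] := main e e0.
by rewrite mulrDr.
Qed.

End SpectralRational.

(** * Numerical range and singular values *)

Section NumericalRange.
Variable R : realType.
Notation C := R[i].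

Lemma unit_normE n (x : 'cV[C]_n) :
  sqrtC (\sum_i `|x i 0| ^+ 2) = 1 <-> vn x = 1.
Proof.
have -> : \sum_i `|x i 0| ^+ 2 = (vn x ^+ 2)%:C.
  by rewrite vn2 rmorph_sum; apply: eq_bigr => i _; rewrite cabsE rmorphXn.
rewrite rmorphXn /= sqrCK ?ler0c ?vn_ge0 //.
by split=> [/complexI|->].
Qed.

Lemma numrangeE n (A : 'M[C]_n) z :
  numrange A z <-> exists2 x, vn x = 1 & z = ip x (A *m x).
Proof.
split=> [[x /unit_normE x1 <-]|[x x1 ->]].
  by exists x => //; rewrite /ip mulmxA.
by exists x; [apply/unit_normE | rewrite /ip mulmxA].
Qed.

(** After a phase change of [x], the form at [p x' + y] with real [p] is the real number
    [p ^+ 2 + p * g], and the squared norm is [p ^+ 2 + 1 + p * gam]. Requiring the quotient [t] is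
    a quadratic equation for [p] with a positive root. *)
Lemma numrange_line n (A : 'M[C]_n) (x y : 'cV[C]_n) (t : R) : vn x = 1 -> vn y = 1 ->
  ip x (A *m x) = 1 -> ip y (A *m y) = 0 -> 0 < t < 1 ->
  exists2 v, vn v = 1 & ip v (A *m v) = t%:C.
Proof.
move=> x1 y1 ax ay /andP[t0 t1].
(* With this phase the sum of the two mixed terms [ip x' (A *m y)] and [ip y (A *m x')] is real. *)
have [u u1 hu] := complex_phase (ip y (A *m x) - (ip x (A *m y))^*%C).
pose x' := u *: x.
have x'1 : vn x' = 1 by rewrite vnZ u1 mul1r.
have ax' : ip x' (A *m x') = 1.
  by rewrite -scalemxAr ipZl ipZr mulrA mulJc u1 expr1n mul1r ax.
pose g := re (ip x' (A *m y) + ip y (A *m x')).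
have gE : ip x' (A *m y) + ip y (A *m x') = g%:C.
  rewrite -scalemxAr ipZl ipZr /g -scalemxAr ipZl ipZr; move: hu.
  case: (u) (ip x _) (ip y _) => [a b] [c d] [p q]; rewrite /re /= => hu.
  move: hu; simpc => -[_ hu]; congr (_ +i* _); lra.
clearbody x'.
pose gam := re (ip x' y + ip y x').
have gamE : ip x' y + ip y x' = gam%:C.
  rewrite /gam -(ipJ x' y); case: (ip x' y) => a b; rewrite /re /=.
  by simpc; congr (_ +i* _); rewrite subrr.
have a0 : 0 < 1 - t by rewrite subr_gt0.
pose b := g - t * gam.
pose disc := b ^+ 2 + 4 * (1 - t) * t.
have at0 : 0 < 4 * (1 - t) * t by rewrite !mulr_gt0.
have disc0 : 0 <= disc by rewrite addr_ge0 ?sqr_ge0 // ltW.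
pose p := (Num.sqrt disc - b) / (2 * (1 - t)).
have sd2 : Num.sqrt disc ^+ 2 = disc by rewrite sqr_sqrtr.
have sdb : b < Num.sqrt disc.
  rewrite real_ltNge ?num_real //; apply/negP => h.
  have sd0 := sqrtr_ge0 disc.
  have : Num.sqrt disc ^+ 2 <= b ^+ 2.
    by rewrite lerXn2r ?nnegrE // (le_trans sd0).
  by rewrite sd2 /disc gerDl leNgt at0.
have p0 : 0 < p by rewrite divr_gt0 ?subr_gt0 // mulr_gt0.
have pE : (1 - t) * p ^+ 2 + b * p - t = 0.
  have -> : (1 - t) * p ^+ 2 + b * p - t
    = (Num.sqrt disc ^+ 2 - b ^+ 2 - 4 * (1 - t) * t) / (4 * (1 - t)).
    by rewrite /p; field; rewrite gt_eqF.
  by rewrite sd2 /disc; field; rewrite gt_eqF.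
pose v := p%:C *: x' + y.
have vA : ip v (A *m v) = (p ^+ 2 + p * g)%:C.
  rewrite mulmxDr -scalemxAr ipDl !ipDr !ipZl !ipZr ax' ay conjc_real.
  have -> : (p ^+ 2 + p * g)%:C = p%:C ^+ 2 + p%:C * (ip x' (A *m y) + ip y (A *m x')).
    by rewrite gE -rmorphM -rmorphXn -rmorphD.
  by ring.
have vv : vn v ^+ 2 = p ^+ 2 + 1 + p * gam.
  apply: complexI; rewrite -ipxx ipDl !ipDr !ipZl !ipZr !ipxx x'1 y1 conjc_real.
  have -> : (p ^+ 2 + 1 + p * gam)%:C = p%:C ^+ 2 + 1 + p%:C * (ip x' y + ip y x').
    by rewrite gamE -rmorphM -rmorphXn -(rmorph1 (real_complex R)) -!rmorphD.
  by rewrite expr1n rmorph1; ring.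
have v0 : v != 0.
  apply/negP => /eqP v0; have yE : y = - (p%:C *: x').
    by apply/eqP; rewrite -subr_eq0 opprK addrC -/v v0.
  move: ay; rewrite yE -scaleNr -scalemxAr ipZl ipZr ax' mulr1 mulJc => /complexI.
  by move/eqP; rewrite sqrf_eq0 cabs_eq0 oppr_eq0 -cabs_eq0 cabs_real normr_eq0 gt_eqF.
have nv : 0 < vn v by rewrite vn_gt0.
exists ((vn v)^-1%:C *: v).
  by rewrite vnZ cabs_real ger0_norm ?invr_ge0 ?vn_ge0 // mulVf // gt_eqF.
rewrite -scalemxAr ipZl ipZr conjc_real vA -!rmorphM /=; congr (_%:C)%C.
have -> : (vn v)^-1 * ((vn v)^-1 * (p ^+ 2 + p * g)) = (p ^+ 2 + p * g) / vn v ^+ 2.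
  by field; rewrite gt_eqF.
have nv2 : 0 < vn v ^+ 2 by rewrite exprn_gt0.
have nv2' : vn v ^+ 2 != 0 by rewrite gt_eqF.
apply: (mulIf nv2'); rewrite divfK // vv.
by move: pE; rewrite /b; lra.
Qed.

(* Toeplitz--Hausdorff. *)
Lemma numrange_cvx n (A : 'M[C]_n) : cvx (numrange A).
Proof.
move=> _ _ t /numrangeE[x x1 ->] /numrangeE[y y1 ->] /andP[t0 t1].
set a := ip x _; set b := ip y _.
have [-> |ab] := eqVneq a b.
  by apply/numrangeE; exists y => //; rewrite -/b rmorphB rmorph1; ring.
have [->|tn0] := eqVneq t 0.
  by apply/numrangeE; exists y => //; rewrite -/b rmorphB rmorph1 rmorph0; ring.
have [->|tn1] := eqVneq t 1.
  by apply/numrangeE; exists x => //; rewrite -/a rmorphB rmorph1; ring.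
have ab0 : a - b != 0 by rewrite subr_eq0.
pose A' := (a - b)^-1 *: (A - b%:M).
have AE z : vn z = 1 -> ip z (A' *m z) = (a - b)^-1 * (ip z (A *m z) - b).
  move=> z1; rewrite /A' -scalemxAl ipZr mulmxBl mul_scalar_mx ipBr ipZr ipxx z1.
  by rewrite expr1n mulr1.
have [|||v v1 hv] := @numrange_line n A' x y t x1 y1.
- by rewrite AE // -/a mulVf.
- by rewrite AE // -/b subrr mulr0.
- by rewrite !lt_def tn0 t0 t1 eq_sym tn1.
apply/numrangeE; exists v => //; rewrite AE // in hv.
have -> : ip v (A *m v) = (a - b) * ((a - b)^-1 * (ip v (A *m v) - b)) + b.
  by rewrite mulrA divff // mul1r subrK.
by rewrite hv rmorphB rmorph1; ring.
Qed.

Lemma numrange_bounded n (A : 'M[C]_n) c z : opb A c -> numrange A z -> cabs z <= c.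
Proof.
move=> hA /numrangeE[x x1 ->]; apply: le_trans (cauchy_schwarz _ _) _.
by rewrite x1 mul1r; have := hA x; rewrite x1 mulr1.
Qed.

End NumericalRange.

(** * Singular values and low-rank approximation *)

Section EckartYoung.
Variable R : realType.
Notation C := R[i].

(** The first [k.+1] entries of the sorted list qualify, and counting is invariant under
    permutation. It supplies enough eigenvectors for the dimension count in [sing_val_approx]. *)
Lemma count_ge_nth_sorted (s : seq R) k : (k < size s)%N ->
  (k < count (fun x => nth 0 (sort >=%R s) k <= x)%R s)%N.
Proof.
move=> ks; have := permEl (perm_sort >=%R s); rewrite perm_sym => /permP ->.
set l := sort _ s; have kl : (k < size l)%N by rewrite size_sort.
rewrite -{2}(cat_take_drop k.+1 l) count_cat; apply: leq_trans (leq_addr _ _).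
set Q := fun x => _.
suff /eqP h : count Q (take k.+1 l) == size (take k.+1 l) by rewrite h size_takel.
rewrite -all_count; apply/(all_nthP 0) => i.
rewrite size_takel // ltnS => ik; rewrite nth_take ?ltnS //.
have srt : sorted >=%R l by apply: sort_sorted => x y; exact: le_total.
have tr : transitive (>=%R : rel R) by move=> a b c h1 h2; exact: le_trans h2 h1.
have rf : reflexive (>=%R : rel R) by move=> a; exact: lexx.
by apply: (sorted_leq_nth tr rf 0 srt); rewrite ?inE ?(leq_ltn_trans ik).
Qed.

Lemma toC_adj p q (M : 'M[R]_(p, q)) : (toC M)^t* = toC M^T.
Proof. by apply/matrixP => i j; rewrite !mxE; apply: conjc_real. Qed.

Lemma toCM p q s (M : 'M[R]_(p, q)) (N : 'M[R]_(q, s)) :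
  toC (M *m N) = toC M *m toC N.
Proof. exact: map_mxM. Qed.

(* The easy half of Eckart--Young--Mirsky. *)
Lemma sing_val_approx p q (M : 'M[R]_(p, q)) (N : 'M[C]_(p, q)) k (c : R) :
  0 <= c -> (\rank N <= k)%N -> opb (toC M - N) c -> sing_val M k.+1 <= c.
Proof.
move=> c0 rN hMN; rewrite /sing_val /= /sing_vals.
set H := toC (M^T *m M); set d := spectral_diag H.
pose f (j : 'I_q) : R := Num.sqrt (re (d 0 j)).
rewrite -[map _ _]/(map f (enum 'I_q)).
have sz : size (map f (enum 'I_q)) = q by rewrite size_map size_enum_ord.
(* Past the length [q] of the list, [nth] returns 0. *)
have [qk|kq] := leqP q k; first by rewrite nth_default // size_sort sz.
have := @count_ge_nth_sorted (map f (enum 'I_q)) k; rewrite sz => /(_ kq).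
set sg := nth _ _ _ => hcount; rewrite leNgt; apply/negP => csg.
rewrite count_map in hcount.
pose J := [set j | sg <= f j]%SET.
have cJ : (k < #|J|)%N.
  apply: leq_trans hcount _; rewrite -sum1_count big_enum_cond -sum1_card.
  by apply: eq_leq; apply: eq_bigl => j; rewrite /= inE.
have Hh : H^t* = H.
  by rewrite /H toC_adj trmx_mul trmxK.
have Hn : H \is normalmx by apply/normalmxP; rewrite Hh.
have HE := orthomx_spectralP Hn.
set P := spectralmx H in HE.
have Pu : P \is unitarymx by exact: spectral_unitarymx.
have PP : P *m P^t* = 1%:M by apply/unitarymxP.
have iP : invmx P = P^t* by apply: invmx_unitary.
pose Bm : 'M[C]_(#|J|, q) := \matrix_(i, j) (enum_val i == j)%:R.
(* [Z] is [N] on the span of the eigenvectors indexed by [J], transposed because [kermx] is a left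
   kernel. Its rank is below [#|J|], so [N] kills a nonzero combination of them. *)
pose Z : 'M[C]_(#|J|, p) := Bm *m (N *m P^t*)^T.
have rZ : (\rank Z <= k)%N.
  apply: leq_trans (mxrankM_maxr _ _) _; rewrite mxrank_tr.
  by apply: leq_trans (mxrankM_maxl _ _) _.
have : kermx Z != 0.
  by rewrite -mxrank_eq0 mxrank_ker subn_eq0 -ltnNge; apply: leq_ltn_trans cJ.
case/rowV0Pn => be /sub_kermxP beZ be0.
pose al : 'cV[C]_q := (be *m Bm)^T.
have alE i : al (enum_val i) 0 = be 0 i.
  rewrite !mxE (bigD1 i) //= mxE eqxx mulr1 big1 ?addr0 // => j ji.
  by rewrite mxE (inj_eq enum_val_inj) (negbTE ji) mulr0.
have al_out j : j \notin J -> al j 0 = 0.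
  move=> jJ; rewrite !mxE big1 // => i _; rewrite mxE.
  have -> : (enum_val i == j) = false; last by rewrite mulr0.
  by apply/negP => /eqP ij; move: jJ; rewrite -ij enum_valP.
have al0 : al != 0.
  apply/negP => /eqP a0; move/negP: be0; apply; apply/eqP/rowP => i.
  by rewrite -alE a0 !mxE.
pose x := P^t* *m al.
have Nx : N *m x = 0.
  rewrite /x mulmxA -[N *m P^t*]trmxK -trmx_mul -mulmxA -/Z beZ.
  by rewrite trmx0.
clearbody al.
have vx : vn x ^+ 2 = vn al ^+ 2.
  apply: complexI; rewrite -!ipxx /x ip_adj trmxCK mulmxA PP mul1mx.
  by [].
have hx : vn (toC M *m x) ^+ 2 = \sum_j cabs (al j 0) ^+ 2 * re (d 0 j).
  have -> : vn (toC M *m x) ^+ 2 = re (ip x (H *m x)).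
    rewrite /H toCM -toC_adj -mulmxA ip_adj trmxCK ipxx.
    by [].
  rewrite HE iP /x -!mulmxA [P *m (P^t* *m _)]mulmxA PP mul1mx ip_adj trmxCK mulmxA PP.
  rewrite mul1mx ipE re_sum; apply: eq_bigr => j _.
  by rewrite mul_diag_mx mxE mulrCA mulJc mulrC reMr.
have lb : sg ^+ 2 * vn al ^+ 2 <= vn (toC M *m x) ^+ 2.
  rewrite hx vn2 mulr_sumr; apply: ler_sum => j _; rewrite mulrC.
  have [jJ|/al_out ->] := boolP (j \in J); last by rewrite cabs0 expr0n /= !mul0r.
  rewrite ler_wpM2l ?sqr_ge0 //; move: jJ; rewrite inE => jJ.
  have sg0 : 0 < sg by apply: le_lt_trans csg.
  have dj : 0 < re (d 0 j) by rewrite -sqrtr_gt0; apply: lt_le_trans jJ.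
  by rewrite -[leRHS]sqr_sqrtr ?(ltW dj) // lerXn2r ?nnegrE ?sqrtr_ge0 ?(ltW sg0).
have ub : vn (toC M *m x) <= c * vn al.
  have -> : toC M *m x = (toC M - N) *m x by rewrite mulmxBl Nx subr0.
  have -> : vn al = vn x.
    by apply/eqP; rewrite -(eqrXn2 (n := 2)) ?vn_ge0 // vx.
  exact: hMN.
have va : 0 < vn al by rewrite vn_gt0.
have : sg ^+ 2 * vn al ^+ 2 <= c ^+ 2 * vn al ^+ 2.
  apply: le_trans lb _; rewrite -exprMn lerXn2r ?nnegrE ?vn_ge0 //.
  by rewrite mulr_ge0 ?vn_ge0.
rewrite ler_pM2r ?exprn_gt0 // leNgt => /negP; apply.
by rewrite ltrXn2r ?nnegrE // (le_trans c0) // ltW.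
Qed.

End EckartYoung.

(** * Sylvester equations *)

Section SylvesterRank.
Variables (K : fieldType) (m p : nat).
Variables (b : 'M[K]_m.+1) (a : 'M[K]_p.+1) (G : 'M[K]_(m.+1, p.+1)).

Let D := b *m G - G *m a.

(** The block Krylov space of [b] and [D], transposed because subspaces are row spaces; its
    dimension is at most [k * \rank D]. *)
Let krylov k := (\sum_(i < k) <<(b ^+ i *m D)^T>>)%MS.

Lemma krylov_mem k i (X : 'M[K]_p.+1) : (i < k)%N ->
  ((b ^+ i *m D *m X)^T <= krylov k)%MS.
Proof.
move=> ik; rewrite trmx_mul; apply: submx_trans (submxMl _ _) _.
by apply: (sumsmx_sup (Ordinal ik)) => //; rewrite genmxE.
Qed.

(** Induction on [l]: [b ^+ l.+1 *m G - G *m a ^+ l.+1] is [b ^+ l *m D] plus the expression for [l]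
    multiplied on the right by [a]. *)
Lemma power_diff_mem k i l (X : 'M[K]_p.+1) : (i + l <= k)%N ->
  ((b ^+ i *m (b ^+ l *m G - G *m a ^+ l) *m X)^T <= krylov k)%MS.
Proof.
elim: l X => [|l IH] X ilk.
  by rewrite !expr0 mul1mx mulmx1 subrr mulmx0 mul0mx trmx0 sub0mx.
have -> : b ^+ i *m (b ^+ l.+1 *m G - G *m a ^+ l.+1) *m X =
   b ^+ (i + l) *m D *m X + b ^+ i *m (b ^+ l *m G - G *m a ^+ l) *m (a *m X).
  have Eb : b ^+ l.+1 = b ^+ l *m b by rewrite exprSr.
  have Ea : a ^+ l.+1 = a ^+ l *m a by rewrite exprSr.
  have Ei : b ^+ (i + l) = b ^+ i *m b ^+ l by rewrite exprD.
  rewrite Eb Ea Ei /D !mulmxBr !mulmxBl !mulmxA.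
  by rewrite addrA subrK.
rewrite linearD /=; apply: addmx_sub; first by apply: krylov_mem; rewrite -addnS.
by apply: IH; apply: leq_trans ilk; rewrite addnS.
Qed.

(** By antisymmetry [j <= i] may be assumed; taking out [b ^+ j] and [a ^+ j] leaves a difference of
    powers. *)
Lemma monomial_mem k i j : (i <= k)%N -> (j <= k)%N ->
  ((b ^+ i *m G *m a ^+ j - b ^+ j *m G *m a ^+ i)^T <= krylov k)%MS.
Proof.
wlog ji : i j / (j <= i)%N => [H|] ik jk.
  have [/H|/ltnW /H h] := leqP j i; first exact.
  rewrite -opprB linearN /= eqmx_opp; exact: h.
have -> : b ^+ i *m G *m a ^+ j - b ^+ j *m G *m a ^+ i =
  b ^+ j *m (b ^+ (i - j) *m G - G *m a ^+ (i - j)) *m a ^+ j.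
  have Eb : b ^+ i = b ^+ j *m b ^+ (i - j) by rewrite -{1}(subnKC ji) exprD.
  have Ea : a ^+ i = a ^+ (i - j) *m a ^+ j by rewrite -{1}(subnK ji) exprD.
  by rewrite Eb Ea !mulmxBr !mulmxBl !mulmxA.
by apply: power_diff_mem; rewrite subnKC.
Qed.

Lemma horner_mx_sum n (A : 'M[K]_n.+1) (P : {poly K}) k : (size P <= k)%N ->
  horner_mx A P = \sum_(i < k) P`_i *: A ^+ i.
Proof.
move=> sP; have {1}-> : P = \poly_(i < k) P`_i.
  apply/polyP => i; rewrite coef_poly; case: ltnP => // ki.
  by rewrite nth_default // (leq_trans sP).
rewrite poly_def rmorph_sum; apply: eq_bigr => i _ /=.
by rewrite horner_mxZ rmorphXn /= horner_mx_X.
Qed.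

(* Up to the sign, this is the Bezoutian of P and Q applied to b and a. *)
Lemma sylvester_rank k (P Q : {poly K}) : (size P <= k.+1)%N -> (size Q <= k.+1)%N ->
  (\rank (horner_mx b P *m G *m horner_mx a Q - horner_mx b Q *m G *m horner_mx a P)%R
     <= k * \rank D)%N.
Proof.
move=> sP sQ; rewrite !(horner_mx_sum _ sP) !(horner_mx_sum _ sQ).
set Z := _ - _.
have -> : Z = \sum_(i < k.+1) \sum_(j < k.+1) (P`_i * Q`_j) *:
   (b ^+ i *m G *m a ^+ j - b ^+ j *m G *m a ^+ i).
  rewrite /Z !mulmx_suml.
  have -> : \sum_(i < k.+1) Q`_i *: b ^+ i *m G *m (\sum_(j < k.+1) P`_j *: a ^+ j) =
    \sum_(i < k.+1) \sum_(j < k.+1) (P`_i * Q`_j) *: (b ^+ j *m G *m a ^+ i).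
    rewrite exchange_big /=; apply: eq_bigr => i _; rewrite mulmx_sumr.
    apply: eq_bigr => j _.
    by rewrite -!scalemxAl -scalemxAr scalerA mulrC.
  rewrite -sumrB; apply: eq_bigr => i _; rewrite mulmx_sumr -sumrB.
  apply: eq_bigr => j _; rewrite scalerBr; congr (_ - _).
  by rewrite -!scalemxAl -scalemxAr scalerA.
rewrite -mxrank_tr; apply: (@leq_trans (\rank (krylov k))).
  apply: mxrankS; rewrite linear_sum /=; apply: summx_sub => i _.
  rewrite linear_sum /=; apply: summx_sub => j _.
  rewrite linearZ /=; apply: scalemx_sub; apply: monomial_mem; by rewrite -ltnS.
rewrite /krylov; have -> : (k * \rank D = \sum_(i < k) \rank D)%N.
  by rewrite sum_nat_const card_ord.
elim/big_rec2: _ => [|i r M _ IH]; first by rewrite mxrank0.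
apply: leq_trans (mxrank_adds_leqif _ _) _; apply: leq_add => //.
by rewrite genmxE mxrank_tr mxrankM_maxr.
Qed.

End SylvesterRank.

Section SylvesterApprox.
Variable R : realType.
Notation C := R[i].

(** [N] is the matrix of [sylvester_rank] between the inverses of [P(b)] and [Q(a)]. The remainder
    [G - N] is then [(Q / P)(b) G (P / Q)(a)], bounded by two uses of [spectral_rational]. *)
Lemma sylvester_approx m p (b : 'M[C]_m) (a : 'M[C]_p) (G : 'M[C]_(m, p))
    (E E' : set C) z0 z0' (B g M M' : R) (P Q : {poly C}) k :
  cvx E -> E z0 -> (forall z, E z -> cabs z <= B) -> num_in a E ->
  cvx E' -> E' z0' -> (forall z, E' z -> cabs z <= B) -> num_in b E' ->
  coprimep P Q -> (size P <= k.+1)%N -> (size Q <= k.+1)%N ->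
  0 <= M -> (forall z, E z -> cabs P.[z] <= M * cabs Q.[z]) ->
  0 <= M' -> (forall z, E' z -> cabs Q.[z] <= M' * cabs P.[z]) ->
  0 <= g -> opb G g ->
  exists2 N : 'M[C]_(m, p), (\rank N <= k * \rank (b *m G - G *m a)%R)%N
    & opb (G - N) (5 * M' * g * (5 * M)).
Proof.
move=> cE Ez EB aE cE' Ez' EB' bE cPQ sP sQ M0 hM M'0 hM' g0 hG.
have bd0 : 0 <= 5 * M' * g * (5 * M) by rewrite !mulr_ge0.
have triv : G = 0 -> exists2 N : 'M[C]_(m, p),
    (\rank N <= k * \rank (b *m G - G *m a)%R)%N & opb (G - N) (5 * M' * g * (5 * M)).
  move=> G0; exists 0; first by rewrite mxrank0.
  by rewrite G0 subr0 => x; rewrite mul0mx vn0 mulr_ge0 ?vn_ge0.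
(* Polynomials of a matrix require positive size; if a dimension is 0, so is [G]. *)
case: m b G bE hG triv => [|m] b G bE hG triv; first by apply: triv; apply: flatmx0.
case: p a G aE hG triv => [|p] a G aE hG triv; first by apply: triv; apply: thinmx0.
have [ua ha] := spectral_rational cE Ez EB aE cPQ M0 hM.
have cQP : coprimep Q P by rewrite coprimep_sym.
have [ub hb] := spectral_rational cE' Ez' EB' bE cQP M'0 hM'.
set Pa := horner_mx a P in ha; set Qa := horner_mx a Q in ua ha.
set Pb := horner_mx b P in ub hb; set Qb := horner_mx b Q in hb.
pose H : 'M[C]_(m.+1, p.+1) := Pb *m G *m Qa - Qb *m G *m Pa.
have iPb : Pb^-1 *m Pb = 1%:M by exact: mulVr.
have iQa : Qa *m Qa^-1 = 1%:M by exact: mulrV.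
have cPQb : Pb^-1 *m Qb = Qb *m Pb^-1.
  exact/esym/commrV/comm_horner_mx2.
exists (Pb^-1 *m H *m Qa^-1).
  apply: leq_trans (mxrankM_maxl _ _) _; apply: leq_trans (mxrankM_maxr _ _) _.
  exact: sylvester_rank.
have -> : G - Pb^-1 *m H *m Qa^-1 = Qb *m Pb^-1 *m G *m (Pa *m Qa^-1).
  rewrite /H mulmxBr mulmxBl !mulmxA iPb mul1mx -[G *m Qa *m _]mulmxA iQa mulmx1.
  by rewrite opprB addrC subrK cPQb.
have b0 : 0 <= 5 * M' by rewrite mulr_ge0.
by apply: opbM; [rewrite mulr_ge0|apply: opbM|].
Qed.

End SylvesterApprox.

(** * Real matrices and their blocks *)

Section RealNorms.
Variable R : realType.
Notation C := R[i].

Let cre n (x : 'cV[C]_n) : 'cV[R]_n := map_mx (fun z => complex.Re z) x.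
Let cim n (x : 'cV[C]_n) : 'cV[R]_n := map_mx (fun z => complex.Im z) x.

Lemma toC_mulE p q (M : 'M[R]_(p, q)) (x : 'cV[C]_q) i :
  (toC M *m x) i 0 = (M *m cre x) i 0 +i* (M *m cim x) i 0.
Proof.
rewrite !mxE; elim/big_ind3: _ => [|x1 x2 x3 y1 y2 y3 -> ->|j _] //.
by rewrite !mxE; case: (x j 0) => u v /=; simpc.
Qed.

Lemma norm2E n (x : 'cV[R]_n) : norm2 x = vn (toC x).
Proof.
congr Num.sqrt; apply: eq_bigr => i _.
by rewrite mxE cabs_real real_normK ?num_real.
Qed.

Lemma opnorm2_real p q (M : 'M[R]_(p, q)) (x : 'cV[R]_q) :
  norm2 (M *m x) <= opnorm2 M * norm2 x.
Proof.
have [->|x0] := eqVneq x 0.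
  have -> : norm2 (0 : 'cV[R]_q) = 0 by rewrite norm2E /toC map_mx0 vn0.
  by rewrite mulmx0 mulr0 norm2E /toC map_mx0 vn0.
have nx : 0 < norm2 x.
  rewrite norm2E vn_gt0; apply: contra x0 => /eqP/matrixP h.
  by apply/eqP/matrixP => i j; have := h i j; rewrite !mxE => /complexI.
pose y := (norm2 x)^-1 *: x.
have nZ n (c : R) (z : 'cV[R]_n) : norm2 (c *: z) = `|c| * norm2 z.
  by rewrite !norm2E /toC map_mxZ vnZ cabs_real.
have ny : norm2 y = 1.
  by rewrite nZ ger0_norm ?invr_ge0 ?(ltW nx) // mulVf // gt_eqF.
have [c c0 hc] := opb_exists (toC M).
have ub : ubound [set norm2 (M *m x) | x in [set x : 'cV[R]_q | norm2 x = 1]] c.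
  move=> _ [z /= z1 <-]; rewrite norm2E /toC map_mxM.
  by have := hc (toC z); rewrite -norm2E z1 mulr1.
have : norm2 (M *m y) <= opnorm2 M.
  by apply: (ub_le_sup (ex_intro _ c ub)); exists y.
rewrite /y -scalemxAr nZ ger0_norm ?invr_ge0 ?(ltW nx) //.
by rewrite ler_pdivrMl // mulrC.
Qed.

Lemma opnorm2_ge0 p q (M : 'M[R]_(p, q)) : 0 <= opnorm2 M.
Proof.
rewrite /opnorm2; set S := [set _ | _ in _].
(* Without a supremum, for instance when [q = 0] and no unit vector exists, [sup] has the value
   0. *)
have [[[y Sy] ub]|hs] := pselect (has_sup S); last by rewrite sup_out.
apply: le_trans (ub_le_sup ub Sy); case: Sy => x _ <-; exact: sqrtr_ge0.
Qed.

Lemma norm2_sqr n (x : 'cV[R]_n) : norm2 x ^+ 2 = \sum_i x i 0 ^+ 2.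
Proof. by rewrite sqr_sqrtr // sumr_ge0 // => i _; apply: sqr_ge0. Qed.

(** A real matrix acts separately on real and imaginary parts, whose squared norms add, so the
    supremum over real vectors also bounds the action on complex ones. *)
Lemma opnorm2P p q (M : 'M[R]_(p, q)) : opb (toC M) (opnorm2 M).
Proof.
move=> x; rewrite -ler_sqr ?nnegrE ?mulr_ge0 ?vn_ge0 ?opnorm2_ge0 //.
rewrite exprMn !vn2.
under eq_bigr do rewrite toC_mulE cabs2 /=.
under [X in _ <= _ * X]eq_bigr do rewrite cabs2.
rewrite !big_split /= mulrDr -!norm2_sqr.
have E (f : C -> R) : \sum_i f (x i 0) ^+ 2 = norm2 (map_mx f x) ^+ 2.
  by rewrite norm2_sqr; apply: eq_bigr => i _; rewrite mxE.
rewrite (E (fun z => complex.Re z)) (E (fun z => complex.Im z)) -!exprMn.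
apply: lerD; rewrite lerXn2r ?nnegrE ?mulr_ge0 ?opnorm2_ge0 ?sqrtr_ge0 //;
  exact: opnorm2_real.
Qed.

Lemma psd_toC n (M : 'M[R]_n) (x : 'cV[C]_n) : psd_mx M -> 0 <= re (ip x (toC M *m x)).
Proof.
move=> [MT hM]; have -> : re (ip x (toC M *m x)) =
    ((cre x)^T *m M *m cre x) 0 0 + ((cim x)^T *m M *m cim x) 0 0.
  rewrite ipE re_sum -!mulmxA !mxE -big_split /=; apply: eq_bigr => i _.
  rewrite toC_mulE !mxE; case: (x i 0) => u v /=; rewrite /re /=.
  by rewrite mulNr opprK.
by rewrite addr_ge0.
Qed.

Lemma herm_ip_real n (H : 'M[C]_n) x : H^t* = H ->
  ip x (H *m x) = (re (ip x (H *m x)))%:C.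
Proof.
move=> HH; have : (ip x (H *m x))^*%C = ip x (H *m x) by rewrite ipJ -{1}HH -ip_adj.
case: (ip x _) => u v; rewrite /re /= => -[h]; congr (_ +i* _).
by lra.
Qed.

End RealNorms.

Section BlockAlgebra.
Variables (R : pzRingType) (n : nat) (s : 'I_n).
Local Notation hd := (@head_idx n s).
Local Notation tl := (@tail_idx n s).

Lemma sum_head_tail (V : nmodType) (F : 'I_n -> V) :
  \sum_i F i = \sum_i F (hd i) + \sum_i F (tl i).
Proof.
have e := subnKC (ltnW (ltn_ord s)).
rewrite (reindex (cast_ord e)) /=; last first.
  by exists (cast_ord (esym e)) => i _; rewrite ?cast_ordK ?cast_ordKV.
rewrite big_split_ord.
by congr (_ + _); apply: eq_bigr => i _; congr F; apply: val_inj.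
Qed.

(** Only the summation index is split; the outer selections are arbitrary, so one formula serves all
    four blocks. *)
Lemma mxsubM p q (f : 'I_p -> 'I_n) (g : 'I_q -> 'I_n) (A B : 'M[R]_n) :
  mxsub f g (A *m B) = mxsub f hd A *m mxsub hd g B + mxsub f tl A *m mxsub tl g B.
Proof.
apply/matrixP => i j; rewrite !mxE sum_head_tail.
by congr (_ + _); apply: eq_bigr => k _; rewrite !mxE.
Qed.

Lemma head_idx_inj : injective hd.
Proof. by move=> i j /cast_ord_inj/lshift_inj. Qed.

Lemma tail_idx_inj : injective tl.
Proof. by move=> i j /cast_ord_inj/rshift_inj. Qed.

Lemma mxsub1_inj p (f : 'I_p -> 'I_n) : injective f ->
  mxsub f f (1%:M : 'M[R]_n) = 1%:M.
Proof. by move=> fi; apply/matrixP => i j; rewrite !mxE (inj_eq fi). Qed.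

Lemma head_tail_neq i j : hd i != tl j.
Proof.
apply/negP => /eqP /cast_ord_inj /(congr1 val) /= h.
by have := ltn_ord i; rewrite h ltnNge leq_addr.
Qed.

Lemma mxsub1_tail_head : mxsub tl hd (1%:M : 'M[R]_n) = 0.
Proof. by apply/matrixP => i j; rewrite !mxE eq_sym (negbTE (head_tail_neq _ _)). Qed.

Lemma mxsub1_head_tail : mxsub hd tl (1%:M : 'M[R]_n) = 0.
Proof. by apply/matrixP => i j; rewrite !mxE (negbTE (head_tail_neq _ _)). Qed.

Lemma trig_head_tail (L : 'M[R]_n) : is_trig_mx L -> mxsub hd tl L = 0.
Proof.
move=> /is_trig_mxP h; apply/matrixP => i j; rewrite !mxE; apply: h => /=.
by apply: leq_trans (ltn_ord i) (leq_addr _ _).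
Qed.

End BlockAlgebra.

Section SubmatrixNorm.
Variable R : realType.
Notation C := R[i].

(** For injective [f] an isometric inclusion of coordinates. Blocks become compressions, which
    inherit norm bounds and the location of the numerical range. *)
Definition incl_mx p n (f : 'I_p -> 'I_n) : 'M[C]_(n, p) :=
  \matrix_(i, j) (i == f j)%:R.

Lemma mxsub_incl p q n m (f : 'I_p -> 'I_n) (g : 'I_q -> 'I_m) (M : 'M[C]_(n, m)) :
  mxsub f g M = (incl_mx f)^t* *m M *m incl_mx g.
Proof.
apply/matrixP => i j; rewrite !mxE (bigD1 (g j)) //= !mxE eqxx mulr1.
rewrite [X in _ + X]big1 ?addr0; last by move=> k kj; rewrite !mxE (negbTE kj) mulr0.
rewrite (bigD1 (f i)) //= !mxE eqxx big1 ?addr0; last first.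
  by move=> k kj; rewrite !mxE (negbTE kj) conjC0 mul0r.
by rewrite conjC1 mul1r.
Qed.

Lemma vn_incl p n (f : 'I_p -> 'I_n) x : injective f -> vn (incl_mx f *m x) = vn x.
Proof.
move=> fi; apply/eqP; rewrite -(eqrXn2 (n := 2)) ?vn_ge0 //; apply/eqP.
have EE : (incl_mx f)^t* *m incl_mx f = 1%:M.
  by rewrite -(mxsub1_inj _ fi) mxsub_incl mulmx1.
by apply: complexI; rewrite -!ipxx ip_adj mulmxA EE mul1mx.
Qed.

Lemma opb_mxsub p q n m (f : 'I_p -> 'I_n) (g : 'I_q -> 'I_m) (M : 'M[C]_(n, m)) c :
  injective f -> injective g -> 0 <= c -> opb M c -> opb (mxsub f g M) c.
Proof.
move=> fi gi c0 hM; rewrite mxsub_incl -[c]mul1r -[1 * c]mulr1.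
have one (k l : nat) (e : 'I_k -> 'I_l) : injective e -> opb (incl_mx e) 1.
  by move=> ei x; rewrite vn_incl // mul1r.
apply: opbM; [by rewrite mul1r | apply: opbM => // | exact: one].
by apply: opb_adj => //; apply: one.
Qed.

Lemma num_in_mxsub p n (f : 'I_p -> 'I_n) (M : 'M[C]_n) O :
  injective f -> num_in M O -> num_in (mxsub f f M) O.
Proof.
move=> fi hM x x1; rewrite mxsub_incl -!mulmxA ip_adj trmxCK.
by apply: hM; rewrite vn_incl.
Qed.

(** The form of [M^T] at [x] equals the form of [M] at the entrywise conjugate of [x]. *)
Lemma num_in_opp_tr n (M : 'M[C]_n) O : num_in M O ->
  num_in (- M^T) [set - z | z in O].
Proof.
move=> hM x x1; pose y : 'cV[C]_n := map_mx (fun z => z^*%C) x.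
have y1 : vn y = 1.
  by rewrite -x1; congr Num.sqrt; apply: eq_bigr => i _; rewrite mxE cabsJ.
exists (ip y (M *m y)); first exact: hM.
rewrite mulNmx ipNr; congr (- _).
rewrite !ipE; under eq_bigr do rewrite !mxE mulr_sumr.
under [RHS]eq_bigr do rewrite !mxE mulr_sumr.
rewrite exchange_big /=; apply: eq_bigr => i _; apply: eq_bigr => j _.
by rewrite !mxE conjcK; ring.
Qed.

End SubmatrixNorm.

(** * The Riccati equation *)

Section CareNorm.
Variable R : realType.
Notation C := R[i].

(* Evaluate the equation at an eigenvector v of H. *)
Lemma care_eigenvalue n (B H Q : 'M[C]_n) (v : 'cV[C]_n) (l c : R) :
  H^t* = H -> H *m v = l%:C *: v -> vn v = 1 -> 0 <= l ->
  B^t* *m H + H *m B - H *m H + Q = 0 ->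
  re (ip v (B *m v)) <= 0 -> opb Q c -> l ^+ 2 <= c.
Proof.
move=> Hh Hv v1 l0 E hB hQ.
have b1 : ip v (B^t* *m H *m v) = l%:C * (ip v (B *m v))^*%C.
  rewrite -mulmxA Hv -scalemxAr ipZr; congr (_ * _).
  by rewrite [RHS]ipJ [LHS]ip_adj trmxCK.
have b2 : ip v (H *m B *m v) = l%:C * ip v (B *m v).
  by rewrite -mulmxA ip_adj Hh Hv ipZl conjc_real.
have b3 : ip v (H *m H *m v) = (l ^+ 2)%:C.
  by rewrite -mulmxA Hv -scalemxAr Hv !ipZr ipxx v1 expr1n mulr1 rmorphXn expr2.
have E' : ip v ((B^t* *m H + H *m B - H *m H + Q) *m v) = 0.
  by rewrite E mul0mx /ip mulmx0 mxE.
rewrite !mulmxDl mulNmx !ipDr ipNr b1 b2 b3 in E'.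
have := congr1 (@re R) E'; rewrite !reD reN !reMr reJ.
have -> : re (l ^+ 2)%:C = l ^+ 2 by [].
have -> : re 0 = 0 :> R by [].
have hq : re (ip v (Q *m v)) <= c.
  apply: le_trans (re_le_cabs _) _; apply: le_trans (cauchy_schwarz _ _) _.
  by rewrite v1 mul1r; have := hQ v; rewrite v1 mulr1.
have lb : l * re (ip v (B *m v)) <= 0 by rewrite mulr_ge0_le0.
by move: hq lb; move: (re _) (l * _) (l ^+ 2) => x y z; lra.
Qed.

(** In an orthonormal eigenbasis of [Y] the value at a unit vector is a convex combination of
    eigenvalues, each bounded by [care_eigenvalue]. *)
Lemma care_norm n (B Q Y : 'M[R]_n) (c : R) : psd_mx Y -> 0 <= c ->
  B^T *m Y + Y *m B - Y *m Y + Q = 0 ->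
  (forall x, vn x = 1 -> re (ip x (toC B *m x)) <= 0) -> opb (toC Q) (c ^+ 2) ->
  forall x, vn x = 1 -> re (ip x (toC Y *m x)) <= c.
Proof.
move=> hY c0 eqY hB hQ x x1.
set H := toC Y; set d := spectral_diag H.
have Hh : H^t* = H by rewrite /H toC_adj; case: hY => ->.
have Hn : H \is normalmx by apply/normalmxP; rewrite Hh.
have HE := orthomx_spectralP Hn.
set P := spectralmx H in HE.
have Pu : P \is unitarymx by exact: spectral_unitarymx.
have PP : P *m P^t* = 1%:M by apply/unitarymxP.
have PP' : P^t* *m P = 1%:M by apply: mulmx1C.
have iP : invmx P = P^t* by apply: invmx_unitary.
rewrite iP in HE.
have dj j : re (d 0 j) <= c.
  pose v : 'cV[C]_n := P^t* *m delta_mx j 0.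
  have v1 : vn v = 1.
    apply/eqP; rewrite -(eqrXn2 (n := 2)) ?vn_ge0 // expr1n; apply/eqP.
    apply: complexI; rewrite -ipxx /v ip_adj trmxCK mulmxA PP mul1mx ipE (bigD1 j) //=.
    rewrite !mxE !eqxx big1 ?addr0; last first.
      by move=> i ij; rewrite !mxE (negbTE ij) mulr0.
    by rewrite mulr1 !rmorph1.
  have Hv : H *m v = d 0 j *: v.
    rewrite {1}HE /v -!mulmxA [P *m (P^t* *m _)]mulmxA PP mul1mx scalemxAr.
    congr (_ *m _); apply/matrixP => i k; rewrite mul_diag_mx !mxE.
    by case: eqP => [->|]; rewrite ?mulr0.
  have dE : d 0 j = (re (d 0 j))%:C.
    by have := herm_ip_real v Hh; rewrite Hv ipZr ipxx v1 expr1n mulr1.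
  have d0 : 0 <= re (d 0 j).
    by have := psd_toC v hY; rewrite -/H Hv ipZr ipxx v1 expr1n mulr1.
  set l := re (d 0 j) in dE d0 *.
  have E : toC B^T *m H + H *m toC B - H *m H + toC Q = 0.
    by rewrite /H -!toCM /toC -map_mxD -map_mxB -map_mxD eqY map_mx0.
  rewrite dE in Hv; rewrite -toC_adj in E.
  have := care_eigenvalue Hh Hv v1 d0 E (hB _ v1) hQ.
  by rewrite ler_sqr ?nnegrE.
pose al := P *m x.
have al1 : vn al = 1.
  apply/eqP; rewrite -(eqrXn2 (n := 2)) ?vn_ge0 // expr1n; apply/eqP.
  by apply: complexI; rewrite -ipxx /al ip_adj mulmxA PP' mul1mx ipxx x1 expr1n.
have -> : re (ip x (H *m x)) = \sum_j cabs (al j 0) ^+ 2 * re (d 0 j).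
  rewrite {1}HE -!mulmxA ip_adj trmxCK ipE re_sum -/al; clearbody al.
  apply: eq_bigr => j _.
  by rewrite mul_diag_mx mxE mulrCA mulJc mulrC reMr.
have -> : c = \sum_j cabs (al j 0) ^+ 2 * c.
  by rewrite -mulr_suml -vn2 al1 expr1n mul1r.
by apply: ler_sum => j _; rewrite ler_wpM2l ?sqr_ge0.
Qed.

End CareNorm.

Section BlockSylvester.
Variable R : realType.

Lemma mxsub_tr p q m k (f : 'I_p -> 'I_m) (g : 'I_q -> 'I_k) (M : 'M[R]_(k, m)) :
  mxsub f g M^T = (mxsub g f M)^T.
Proof. by apply/matrixP => i j; rewrite !mxE. Qed.

(** The quadratic terms [Y21 Y11] and [Y22 Y21] are absorbed into the coefficients [a] and [b], so
    every term on the right contains an off-diagonal block of [B] or [Q] and has small rank. *)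
Lemma care_block_sylvester n (s : 'I_n) (B Y Q : 'M[R]_n) : Y^T = Y ->
  B^T *m Y + Y *m B - Y *m Y + Q = 0 ->
  let hd := @head_idx n s in
  let tl := @tail_idx n s in
  let a := mxsub hd hd (B - Y) in
  let b := - (mxsub tl tl (B - Y))^T in
  let G := mxsub tl hd Y in
  b *m G - G *m a = (mxsub hd tl B)^T *m mxsub hd hd Y
     + mxsub tl tl Y *m mxsub tl hd B + mxsub tl hd Q.
Proof.
move=> YT E hd tl a b G.
have subB (p q : nat) (f : 'I_p -> 'I_n) (g : 'I_q -> 'I_n) (M N : 'M[R]_n) :
    mxsub f g (M - N) = mxsub f g M - mxsub f g N.
  by apply/matrixP => i j; rewrite !mxE.
have subD (p q : nat) (f : 'I_p -> 'I_n) (g : 'I_q -> 'I_n) (M N : 'M[R]_n) :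
    mxsub f g (M + N) = mxsub f g M + mxsub f g N.
  by apply/matrixP => i j; rewrite !mxE.
have e1 : mxsub tl hd (B^T *m Y) = (mxsub hd tl B)^T *m mxsub hd hd Y
     + (mxsub tl tl B)^T *m G by rewrite (mxsubM s) !mxsub_tr.
have e2 := mxsubM s tl hd Y B; have e3 := mxsubM s tl hd Y Y.
have Y22 : (mxsub tl tl Y)^T = mxsub tl tl Y by rewrite -mxsub_tr YT.
have bG : b *m G = mxsub tl tl Y *m G - (mxsub tl tl B)^T *m G.
  by rewrite /b subB linearB /= Y22 opprB mulmxBl.
have Ga : G *m a = G *m mxsub hd hd B - G *m mxsub hd hd Y.
  by rewrite /a subB mulmxBr.
have := congr1 (mxsub tl hd) E; rewrite subD subB subD.
have -> : mxsub tl hd (0 : 'M[R]_n) = 0 by apply/matrixP => i j; rewrite !mxE.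
rewrite e1 e2 e3 bG Ga -/G.
move: ((mxsub hd tl B)^T *m _) ((mxsub tl tl B)^T *m G) (G *m mxsub hd hd B)
  (mxsub tl tl Y *m mxsub tl hd B) (G *m mxsub hd hd Y) (mxsub tl tl Y *m G)
  (mxsub tl hd Q).
move=> X1 X2 X3 X4 X5 X6 X7 /matrixP h; apply/matrixP => i j.
by have := h i j; rewrite !mxE; lra.
Qed.

End BlockSylvester.

(** * The change of variables by the Cholesky factor and its effect on ranks *)

Section CareReduction.
Variables (R : realType) (n : nat) (A F Q X L : 'M[R]_n).
Hypothesis hF : spd_mx F.
Hypothesis hL : cholesky F L.

Let Li := invmx L.
Let B := Li *m A *m L.
Let Y := L^T *m X *m L.
Let Q' := L^T *m Q *m L.

Lemma spd_unit (M : 'M[R]_n) : spd_mx M -> M \in unitmx.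
Proof.
move=> [_ hM]; rewrite unitmxE unitfE; apply/det0P => -[v v0 hv].
have vT0 : v^T != 0 by rewrite -(inj_eq (@trmx_inj _ _ _)) trmxK trmx0.
by have := hM _ vT0; rewrite trmxK hv mul0mx mxE ltxx.
Qed.

Lemma cholesky_unit : L \in unitmx.
Proof. by have := spd_unit hF; case: hL => _ <-; rewrite unitmx_mul => /andP[]. Qed.

(** Congruence of the equation by [L]; the factorization of [F] turns [X F X] into [Y *m Y]. *)
Lemma care_similarity : A^T *m X + X *m A - X *m F *m X + Q = 0 ->
  B^T *m Y + Y *m B - Y *m Y + Q' = 0.
Proof.
have uL := cholesky_unit => E.
have LiT : Li^T *m L^T = 1%:M by rewrite -trmx_mul mulmxV // trmx1.
have e1 : B^T *m Y = L^T *m (A^T *m X) *m L.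
  by rewrite /B /Y !trmx_mul !mulmxA -[_ *m Li^T *m L^T]mulmxA LiT mulmx1.
have e2 : Y *m B = L^T *m (X *m A) *m L.
  by rewrite /B /Y !mulmxA -[_ *m L *m Li]mulmxA mulmxV // mulmx1.
have e3 : Y *m Y = L^T *m (X *m F *m X) *m L.
  by rewrite /Y; case: hL => _ <-; rewrite !mulmxA.
by rewrite e1 e2 e3 /Q' -!(mulmxBl, mulmxDl) -!(mulmxBr, mulmxDr) E mulmx0 mul0mx.
Qed.

Variable s : 'I_n.
Local Notation hd := (@head_idx n s).
Local Notation tl := (@tail_idx n s).

Let L12 : mxsub hd tl L = 0.
Proof. by case: hL => h _; apply: trig_head_tail. Qed.

Let LLi : L *m Li = 1%:M. Proof. by rewrite mulmxV // cholesky_unit. Qed.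
Let LiL : Li *m L = 1%:M. Proof. by rewrite mulVmx // cholesky_unit. Qed.

Lemma chol_head : mxsub hd hd L *m mxsub hd hd Li = 1%:M.
Proof.
have := mxsubM s hd hd L Li.
rewrite LLi L12 mul0mx addr0 mxsub1_inj => [->|] //; exact: head_idx_inj.
Qed.

Lemma chol_headV : mxsub hd hd Li *m mxsub hd hd L = 1%:M.
Proof. exact: mulmx1C chol_head. Qed.

Lemma cholV_head_tail : mxsub hd tl Li = 0.
Proof.
have := mxsubM s hd tl L Li; rewrite LLi L12 mul0mx addr0 mxsub1_head_tail => E.
by rewrite -[LHS]mul1mx -chol_headV -mulmxA -E mulmx0.
Qed.

Lemma chol_tail : mxsub tl tl L *m mxsub tl tl Li = 1%:M.
Proof.
have := mxsubM s tl tl L Li.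
rewrite LLi cholV_head_tail mulmx0 add0r mxsub1_inj => [->|] //; exact: tail_idx_inj.
Qed.

(** The (2,1) block of [L L^T] is [L21 L11^T], and [L11] is invertible. *)
Lemma rank_chol_tail_head : (\rank (mxsub tl hd L) <= \rank (mxsub tl hd F))%N.
Proof.
have := mxsubM s tl hd L L^T; case: hL => _ ->.
rewrite !mxsub_tr L12 trmx0 mulmx0 addr0 => E.
have -> : mxsub tl hd L = mxsub tl hd F *m (mxsub hd hd Li)^T.
  by rewrite E -mulmxA -trmx_mul chol_headV trmx1 mulmx1.
exact: mxrankM_maxl.
Qed.

(** The (2,1) block of [Li *m L = 1] gives [Li21 = - Li22 L21 Li11]. *)
Lemma rank_cholV_tail_head : (\rank (mxsub tl hd Li) <= \rank (mxsub tl hd F))%N.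
Proof.
have := mxsubM s tl hd Li L; rewrite LiL mxsub1_tail_head => E.
have -> : mxsub tl hd Li = - (mxsub tl tl Li *m mxsub tl hd L) *m mxsub hd hd Li.
  have -> : mxsub tl tl Li *m mxsub tl hd L = - (mxsub tl hd Li *m mxsub hd hd L).
    by apply/eqP; rewrite -addr_eq0 addrC -E.
  by rewrite opprK -mulmxA chol_head mulmx1.
apply: leq_trans (mxrankM_maxl _ _) _; rewrite mxrank_opp.
by apply: leq_trans (mxrankM_maxr _ _) _; apply: rank_chol_tail_head.
Qed.

(** Since [L] and [Li] are lower triangular, this block is [Li11 A12 L22], and [F] adds nothing to
    the rank. *)
Lemma rank_sim_head_tail : (\rank (mxsub hd tl B) <= \rank (mxsub hd tl A))%N.
Proof.
rewrite /B -mulmxA (mxsubM s) cholV_head_tail mul0mx addr0.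
apply: leq_trans (mxrankM_maxr _ _) _.
by rewrite (mxsubM s) L12 mulmx0 add0r mxrankM_maxl.
Qed.

Lemma rank_mulmx_tail_head (M : 'M[R]_n) : (\rank (mxsub tl hd (M *m L))
  <= \rank (mxsub tl hd M) + \rank (mxsub tl hd F))%N.
Proof.
rewrite (mxsubM s); apply: leq_trans (mxrank_add _ _) _; apply: leq_add.
  exact: mxrankM_maxl.
by apply: leq_trans (mxrankM_maxr _ _) _; apply: rank_chol_tail_head.
Qed.

(** The blocks [Li21] and [L21] enter once each, and each costs at most the rank of [F21]. *)
Lemma rank_sim_tail_head : (\rank (mxsub tl hd B)
  <= \rank (mxsub tl hd A) + 2 * \rank (mxsub tl hd F))%N.
Proof.
rewrite /B -mulmxA (mxsubM s); apply: leq_trans (mxrank_add _ _) _.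
rewrite mulSn mul1n addnCA; apply: leq_add.
  by apply: leq_trans (mxrankM_maxl _ _) _; apply: rank_cholV_tail_head.
by apply: leq_trans (mxrankM_maxr _ _) _; apply: rank_mulmx_tail_head.
Qed.

Lemma rank_congr_tail_head (M : 'M[R]_n) : (\rank (mxsub tl hd (L^T *m M *m L))
  <= \rank (mxsub tl hd M) + \rank (mxsub tl hd F))%N.
Proof.
rewrite -mulmxA (mxsubM s) mxsub_tr L12 trmx0 mul0mx add0r.
by apply: leq_trans (mxrankM_maxr _ _) _; apply: rank_mulmx_tail_head.
Qed.

(** The (2,1) block of [Y] is [L22^T (X21 L11 + X22 L21)]; solving for [X21] leaves one correction
    term, with the factor [L21]. *)
Lemma tail_head_from_congr : mxsub tl hd X =
  (mxsub tl tl Li)^T *m mxsub tl hd Y *m mxsub hd hd Li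
   - mxsub tl tl X *m mxsub tl hd L *m mxsub hd hd Li.
Proof.
have -> : mxsub tl hd Y = (mxsub tl tl L)^T *m
    (mxsub tl hd X *m mxsub hd hd L + mxsub tl tl X *m mxsub tl hd L).
  by rewrite /Y -mulmxA (mxsubM s) mxsub_tr L12 trmx0 mul0mx add0r mxsub_tr (mxsubM s).
rewrite mulmxA -trmx_mul chol_tail trmx1 mul1mx mulmxDl.
rewrite -[_ *m mxsub hd hd L *m _]mulmxA.
by rewrite chol_head mulmx1 addrK.
Qed.

End CareReduction.

(** * Low-rank approximation of the off-diagonal blocks of the solution *)

Section OffDiagonal.
Variable R : realType.
Notation C := R[i].

(** The square of [vn (T *m x)] is the form of [T^t* *m T] at [x]. Applied to the Cholesky factor,
    this bounds [L] and its inverse by square roots of the norms of [F] and its inverse. *)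
Lemma opb_sqrt m n (T : 'M[C]_(m, n)) (c : R) : 0 <= c ->
  opb (T^t* *m T) c -> opb T (Num.sqrt c).
Proof.
move=> c0 h x.
have E : vn (T *m x) ^+ 2 = re (ip x ((T^t* *m T) *m x)).
  by rewrite -mulmxA ip_adj trmxCK ipxx.
have le : vn (T *m x) ^+ 2 <= c * vn x ^+ 2.
  rewrite E; apply: le_trans (re_le_cabs _) _; apply: le_trans (cauchy_schwarz _ _) _.
  by rewrite expr2 mulrCA; apply: ler_wpM2l; [exact: vn_ge0 | exact: h].
rewrite -(sqr_sqrtr c0) -exprMn in le.
by rewrite -ler_sqr ?nnegrE ?mulr_ge0 ?vn_ge0 ?sqrtr_ge0.
Qed.

Lemma mink_interval_cvx (W : set C) (r : R) : cvx W ->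
  cvx [set w + x%:C | w in W & x in [set x : R | - r <= x <= 0]].
Proof.
move=> cW _ _ t [w1 W1 [x1 /= /andP[a1 b1] <-]] [w2 W2 [x2 /= /andP[a2 b2] <-]].
case/andP=> t0 t1.
exists (t%:C * w1 + (1 - t)%:C * w2); first by apply: cW => //; rewrite t0.
have t1' : 0 <= 1 - t by rewrite subr_ge0.
exists (t * x1 + (1 - t) * x2).
  apply/andP; split.
    have -> : - r = t * (- r) + (1 - t) * (- r) by ring.
    by apply: lerD; apply: ler_wpM2l.
  have -> : (0 : R) = t * 0 + (1 - t) * 0 by ring.
  by apply: lerD; apply: ler_wpM2l.
have -> : (t * x1 + (1 - t) * x2)%:C = t%:C * x1%:C + (1 - t)%:C * x2%:C.
  by rewrite -!rmorphM -rmorphD.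
by ring.
Qed.

Lemma opp_cvx (W : set C) : cvx W -> cvx [set (- z)%R | z in W].
Proof.
move=> cW _ _ t [w1 W1 <-] [w2 W2 <-] t01.
exists (t%:C * w1 + (1 - t)%:C * w2); [exact: cW | by ring].
Qed.

Lemma ex_unit_vector n : (0 < n)%N -> exists x : 'cV[C]_n, vn x = 1.
Proof.
case: n => // n _; exists (delta_mx 0 0).
rewrite /vn (bigD1 ord0) //= big1 ?addr0; last first.
  by move=> i i0; rewrite mxE (negbTE i0) cabs0 expr0n.
by rewrite mxE !eqxx cabs1 expr1n sqrtr1.
Qed.

Lemma cond2_ge1 n (F : 'M[R]_n) : (0 < n)%N -> F \in unitmx -> 1 <= cond2 F.
Proof.
move=> n0 uF; have [x x1] := ex_unit_vector n0.
have := opbM (opnorm2_ge0 F) (opnorm2P F) (opnorm2P (invmx F)) x.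
by rewrite -toCM mulmxV // /toC map_mx1 mul1mx x1 mulr1.
Qed.

Section Cholesky.
Variables (n : nat) (F L : 'M[R]_n).
Hypothesis hF : spd_mx F.
Hypothesis hL : cholesky F L.

Lemma opb_chol_tr : opb (toC L^T) (Num.sqrt (opnorm2 F)).
Proof.
apply: opb_sqrt; first exact: opnorm2_ge0.
by rewrite toC_adj trmxK -toCM; case: hL => _ ->; apply: opnorm2P.
Qed.

Lemma opb_chol : opb (toC L) (Num.sqrt (opnorm2 F)).
Proof.
by rewrite -[L]trmxK -toC_adj; apply: opb_adj opb_chol_tr; apply: sqrtr_ge0.
Qed.

Lemma opb_cholV : opb (toC (invmx L)) (Num.sqrt (opnorm2 (invmx F))).
Proof.
apply: opb_sqrt; first exact: opnorm2_ge0.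
rewrite toC_adj -toCM; suff -> : (invmx L)^T *m invmx L = invmx F by apply: opnorm2P.
have uL := cholesky_unit hF hL; have uF := spd_unit hF.
have E : (invmx L)^T *m invmx L *m F = 1%:M.
  case: hL => _ <-; rewrite -mulmxA [invmx L *m _]mulmxA mulVmx // mul1mx.
  by rewrite -trmx_mul mulmxV // trmx1.
by rewrite -[LHS]mulmx1 -(mulmxV uF) mulmxA E mul1mx.
Qed.

Lemma opb_congr (M : 'M[R]_n) :
  opb (toC (L^T *m M *m L)) (opnorm2 F * opnorm2 M).
Proof.
have s0 := sqrtr_ge0 (opnorm2 F).
have -> : opnorm2 F * opnorm2 M
    = Num.sqrt (opnorm2 F) * opnorm2 M * Num.sqrt (opnorm2 F).
  by rewrite mulrAC -expr2 sqr_sqrtr ?opnorm2_ge0.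
rewrite !toCM; apply: opbM opb_chol; first by rewrite mulr_ge0 ?opnorm2_ge0.
exact: opbM s0 opb_chol_tr (opnorm2P M).
Qed.

End Cholesky.

Lemma toC_mxsub p q n m (f : 'I_p -> 'I_n) (g : 'I_q -> 'I_m) (M : 'M[R]_(n, m)) :
  toC (mxsub f g M) = mxsub f g (toC M).
Proof. by apply/matrixP => i j; rewrite !mxE. Qed.

Lemma toC_oppT p q (M : 'M[R]_(p, q)) : toC (- M^T) = - (toC M)^T.
Proof. by apply/matrixP => i j; rewrite !mxE rmorphN. Qed.

Lemma toC_rank p q (M : 'M[R]_(p, q)) : \rank (toC M) = \rank M.
Proof. exact: mxrank_map. Qed.

Lemma quasiseparable_lower n (A : 'M[R]_n) r (s : 'I_n) : quasiseparable A r ->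
  (0 < s)%N -> (\rank (mxsub (@tail_idx n s) (@head_idx n s) A) <= r)%N.
Proof.
move=> <- s0; apply: (@leq_trans
  (maxn (\rank (lower_block A s)) (\rank (upper_block A s)))); first exact: leq_maxl.
exact: (leq_bigmax_cond (F := fun s : 'I_n =>
  maxn (\rank (lower_block A s)) (\rank (upper_block A s)))).
Qed.

Lemma quasiseparable_upper n (A : 'M[R]_n) r (s : 'I_n) : quasiseparable A r ->
  (0 < s)%N -> (\rank (mxsub (@head_idx n s) (@tail_idx n s) A) <= r)%N.
Proof.
move=> <- s0; apply: (@leq_trans
  (maxn (\rank (lower_block A s)) (\rank (upper_block A s)))); first exact: leq_maxr.
exact: (leq_bigmax_cond (F := fun s : 'I_n =>
  maxn (\rank (lower_block A s)) (\rank (upper_block A s)))).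
Qed.

Lemma size_sqr_poly (p : {poly C}) h : (size p <= h.+1)%N ->
  (size (p ^+ 2)%R <= (2 * h).+1)%N.
Proof.
move=> ph; apply: leq_trans (size_poly_exp_leq _ _) _.
by case: (size p) ph => [|k] /=; rewrite ?mul0n // ltnS ltnS mulnC leq_pmul2l.
Qed.

Section Main.
Variables (n ra rf rq : nat) (A F Q X L : 'M[R]_n).
Hypothesis hA : quasiseparable A ra.
Hypothesis hF : spd_mx F.
Hypothesis hFr : quasiseparable F rf.
Hypothesis hQr : quasiseparable Q rq.
Hypothesis hXp : psd_mx X.
Hypothesis hX : A^T *m X + X *m A - X *m F *m X + Q = 0.
Hypothesis hL : cholesky F L.
Let B := invmx L *m A *m L.
Hypothesis hWL : numrange (toC B) `<=` @Cminus R.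
Variable r : R.
Hypothesis hr : Num.sqrt (opnorm2 F * opnorm2 Q) <= r.
Let E : set C :=
  [set w + x%:C | w in numrange (toC B) & x in [set x : R | - r <= x <= 0]].
Let Y := L^T *m X *m L.

Lemma psd_congr : psd_mx Y.
Proof.
case: hXp => XT Xp; split=> [|x].
  by rewrite /symmetric_mx /Y !trmx_mul trmxK XT mulmxA.
have -> : x^T *m Y *m x = (L *m x)^T *m X *m (L *m x) by rewrite /Y trmx_mul !mulmxA.
exact: Xp.
Qed.

(** The form of [B - Y] is a point of the numerical range of [B] minus a real number that is
    nonnegative, as [Y] is positive semidefinite, and at most [r] by [care_norm]. *)
Lemma closed_loop_num_in : num_in (toC (B - Y)) E.
Proof.
move=> x x1.
have eqY := care_similarity hF hL hX.
have hB y : vn y = 1 -> re (ip y (toC B *m y)) <= 0.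
  move=> y1; apply: ltW.
  have /hWL : numrange (toC B) (ip y (toC B *m y)) by apply/numrangeE; exists y.
  by [].
have s0 := sqrtr_ge0 (opnorm2 F * opnorm2 Q).
have hQ' : opb (toC (L^T *m Q *m L)) (Num.sqrt (opnorm2 F * opnorm2 Q) ^+ 2).
  by rewrite sqr_sqrtr ?mulr_ge0 ?opnorm2_ge0 //; apply: opb_congr.
have yr := care_norm psd_congr s0 eqY hB hQ' x1.
have y0 := psd_toC x psd_congr.
have YH : (toC Y)^t* = toC Y by rewrite toC_adj; case: psd_congr => ->.
have -> : ip x (toC (B - Y) *m x) = ip x (toC B *m x) + (- re (ip x (toC Y *m x)))%:C.
  rewrite /toC map_mxB mulmxBl ipBr rmorphN; congr (_ - _); exact: herm_ip_real.
exists (ip x (toC B *m x)); first by apply/numrangeE; exists x.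
exists (- re (ip x (toC Y *m x))) => //=.
by rewrite lerN2 oppr_le0 y0 andbT; apply: le_trans yr hr.
Qed.

Lemma E_bounded : exists D, forall z, E z -> cabs z <= D.
Proof.
have [c c0 hc] := opb_exists (toC B); exists (c + r).
move=> _ [w hw [x /= /andP[x1 x2] <-]].
apply: le_trans (cabsD _ _) _; apply: lerD; first exact: numrange_bounded hw.
by rewrite cabs_real ler0_norm // lerNl.
Qed.

(** Each of the two rational functions contributes a 5 to the constant 25. In [cond2 F], the factor
    [opnorm2 F] comes from the bound for [Y21], and two square roots of [opnorm2 (invmx F)] come
    from transforming back by [L^-1]. *)
Lemma off_block_approx (s : 'I_n) (p q : {poly C}) h (M M' : R) : (0 < s)%N ->
  coprimep p q -> (size p <= h.+1)%N -> (size q <= h.+1)%N ->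
  0 <= M -> (forall z, E z -> cabs p.[z] <= M * cabs q.[z]) ->
  0 <= M' -> (forall z, [set (- z)%R | z in E] z -> cabs q.[z] <= M' * cabs p.[z]) ->
  exists2 N : 'M[C]_(n - s, s),
    (\rank N <= h * (4 * ra + 6 * rf + 2 * rq) + rf)%N
    & opb (toC (lower_block X s) - N) (cond2 F * opnorm2 X * (25 * (M * M') ^+ 2)).
Proof.
move=> s0 cpq sp sq M0 hM M'0 hM'.
pose hd := @head_idx n s; pose tl := @tail_idx n s.
have hdi : injective hd by exact: head_idx_inj.
have tli : injective tl by exact: tail_idx_inj.
have [XT _] := hXp; have [YT _] := psd_congr.
have n0 : (0 < n)%N by apply: leq_ltn_trans (ltn_ord s).
have [x x1] := ex_unit_vector n0.
have Ex := closed_loop_num_in x1.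
have [D hD] := E_bounded.
have cE : cvx E by apply: mink_interval_cvx; apply: numrange_cvx.
pose E' := [set (- z)%R | z in E].
have cE' : cvx E' by apply: opp_cvx.
have Ex' : E' (- ip x (toC (B - Y) *m x)) by exists (ip x (toC (B - Y) *m x)).
have hD' z : E' z -> cabs z <= D by move=> [y Ey <-]; rewrite cabsN hD.
pose a := mxsub hd hd (B - Y); pose b := - (mxsub tl tl (B - Y))^T.
pose G := mxsub tl hd Y.
have aE : num_in (toC a) E.
  by rewrite toC_mxsub; apply: num_in_mxsub closed_loop_num_in.
have bE : num_in (toC b) E'.
  rewrite toC_oppT toC_mxsub; apply: num_in_opp_tr.
  exact: num_in_mxsub closed_loop_num_in.
(* The squares have degree at most [2 * h]; the right-hand side of the Sylvester equation has rank
   at most half of [4 * ra + 6 * rf + 2 * rq], which compensates the doubling. *)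
have cpq2 : coprimep (p ^+ 2)%R (q ^+ 2)%R by rewrite coprimep_expl // coprimep_expr.
have M20 : 0 <= M ^+ 2 by apply: sqr_ge0.
have M'20 : 0 <= M' ^+ 2 by apply: sqr_ge0.
have hM2 z : E z -> cabs (p ^+ 2)%R.[z] <= M ^+ 2 * cabs (q ^+ 2)%R.[z].
  move=> Ez; rewrite !horner_exp !cabsX -exprMn.
  by rewrite lerXn2r ?nnegrE ?mulr_ge0 ?cabs_ge0 ?hM.
have hM'2 z : E' z -> cabs (q ^+ 2)%R.[z] <= M' ^+ 2 * cabs (p ^+ 2)%R.[z].
  move=> Ez; rewrite !horner_exp !cabsX -exprMn.
  by rewrite lerXn2r ?nnegrE ?mulr_ge0 ?cabs_ge0 ?hM'.
have g0 : 0 <= opnorm2 F * opnorm2 X by rewrite mulr_ge0 ?opnorm2_ge0.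
have hG : opb (toC G) (opnorm2 F * opnorm2 X).
  by rewrite toC_mxsub; apply: opb_mxsub => //; apply: opb_congr.
have [N rN hN] := sylvester_approx cE Ex hD aE cE' Ex' hD' bE cpq2
  (size_sqr_poly sp) (size_sqr_poly sq) M20 hM2 M'20 hM'2 g0 hG.
have rD : (\rank (toC b *m toC G - toC G *m toC a)%R <= 2 * ra + 3 * rf + rq)%N.
  rewrite -!toCM /toC -map_mxB -/(toC _) toC_rank.
  rewrite (care_block_sylvester s YT (care_similarity hF hL hX)).
  have rA := quasiseparable_lower hA s0; have rA' := quasiseparable_upper hA s0.
  have rF := quasiseparable_lower hFr s0; have rQ := quasiseparable_lower hQr s0.
  apply: leq_trans (mxrank_add _ _) _.
  have h1 : (\rank (mxsub tl hd (L^T *m Q *m L)) <= rq + rf)%N.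
    by apply: leq_trans (rank_congr_tail_head hF hL s Q) _; apply: leq_add.
  have h2 : (\rank ((mxsub hd tl B)^T *m mxsub hd hd Y) <= ra)%N.
    apply: leq_trans (mxrankM_maxl _ _) _; rewrite mxrank_tr.
    by apply: leq_trans (rank_sim_head_tail _ hF hL s) _.
  have h3 : (\rank (mxsub tl tl Y *m mxsub tl hd B) <= ra + 2 * rf)%N.
    apply: leq_trans (mxrankM_maxr _ _) _.
    apply: leq_trans (rank_sim_tail_head _ hF hL s) _.
    by apply: leq_add => //; rewrite leq_mul2l.
  apply: leq_trans (leq_add (leq_trans (mxrank_add _ _) (leq_add h2 h3)) h1) _.
  by lia.
pose Li := invmx L; have hLi := opb_cholV hF hL.
have l0 := sqrtr_ge0 (opnorm2 (invmx F)).
have hLi11 : opb (toC (mxsub hd hd Li)) (Num.sqrt (opnorm2 (invmx F))).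
  by rewrite toC_mxsub; apply: opb_mxsub.
have hLi22 : opb (toC (mxsub tl tl Li)^T) (Num.sqrt (opnorm2 (invmx F))).
  by rewrite -toC_adj; apply: opb_adj => //; rewrite toC_mxsub; apply: opb_mxsub.
(* The approximation of [Y21] is carried back to [X21] by [tail_head_from_congr]; the correction, of
   rank at most [rf], is kept exactly. *)
exists (toC (mxsub tl tl Li)^T *m N *m toC (mxsub hd hd Li)
    - toC (mxsub tl tl X *m mxsub tl hd L *m mxsub hd hd Li)).
  apply: leq_trans (mxrank_add _ _) _; rewrite mxrank_opp toC_rank; apply: leq_add.
    apply: leq_trans (mxrankM_maxl _ _) _; apply: leq_trans (mxrankM_maxr _ _) _.
    apply: leq_trans rN _; apply: leq_trans (leq_mul (leqnn _) rD) _.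
    by rewrite -mulnA mulnCA leq_mul2l; apply/orP; right; lia.
  apply: leq_trans (mxrankM_maxl _ _) _; apply: leq_trans (mxrankM_maxr _ _) _.
  by apply: leq_trans (rank_chol_tail_head hF hL s) _; apply: quasiseparable_lower.
have -> : toC (lower_block X s) =
    toC (mxsub tl tl Li)^T *m toC G *m toC (mxsub hd hd Li)
    - toC (mxsub tl tl X *m mxsub tl hd L *m mxsub hd hd Li).
  rewrite /lower_block (tail_head_from_congr X hF hL s) -/hd -/tl -/Li -/G.
  by rewrite {1}/toC map_mxB -/(toC _) -/(toC _) !toCM.
rewrite opprB addrA subrK -mulmxBl -mulmxBr.
have := opbM _ (opbM l0 hLi22 hN) hLi11.
have -> : Num.sqrt (opnorm2 (invmx F)) *
   (5 * M' ^+ 2 * (opnorm2 F * opnorm2 X) * (5 * M ^+ 2)) *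
   Num.sqrt (opnorm2 (invmx F)) = cond2 F * opnorm2 X * (25 * (M * M') ^+ 2).
  rewrite mulrAC -expr2 sqr_sqrtr ?opnorm2_ge0 // /cond2; ring.
by apply; rewrite !mulr_ge0 ?opnorm2_ge0.
Qed.

End Main.
End OffDiagonal.

(** * From block approximations to the Zolotarev bound *)

Theorem corollary2p8 (R : realType) (n ra rf rq : nat)
    (A F Q X L : 'M[R]_n)
    (hA : quasiseparable A ra) (hWA : numrange (toC A) `<=` @Cminus R)
    (hF : spd_mx F) (hFr : quasiseparable F rf)
    (hQ : psd_mx Q) (hQr : quasiseparable Q rq)
    (hX : stabilizing_solution A F Q X)
    (hL : cholesky F L)
    (hWL : numrange (toC (invmx L *m A *m L)) `<=` @Cminus R) :
  let t := (4 * ra + 6 * rf + 2 * rq)%N in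
  let W := numrange (toC (invmx L *m A *m L)) in
  let tau : R := `|real_min W| in
  let E : set R[i] := [set w + x%:C | w in W & x in
              [set x : R | - tau - Num.sqrt (tau ^+ 2 + opnorm2 F * opnorm2 Q)
                             <= x <= 0]] in
  forall (p q : nat) (M : 'M[R]_(p, q)), Off X M ->
  forall h : nat, (1 <= h)%N ->
  ((sing_val M (h * t + rf + 1) / opnorm2 X)%:E <=
     (cond2 F * (1 + Num.sqrt 2) ^+ 2)%:E
       * zolotarev h E [set (- z)%R | z in E])%E.
Proof.
move=> t W tau E p q M offM h _.
have [Xp eqX _] := hX.
pose r := tau + Num.sqrt (tau ^+ 2 + opnorm2 F * opnorm2 Q).
have tau0 : 0 <= tau by apply: normr_ge0.
have FQ0 : 0 <= opnorm2 F * opnorm2 Q by rewrite mulr_ge0 ?opnorm2_ge0.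
have hr : Num.sqrt (opnorm2 F * opnorm2 Q) <= r.
  apply: (@le_trans _ _ (Num.sqrt (tau ^+ 2 + opnorm2 F * opnorm2 Q))).
    by rewrite ler_wsqrtr // lerDr sqr_ge0.
  by rewrite lerDr.
have EE : E = [set w + x%:C | w in W & x in [set x : R | - r <= x <= 0]].
  by rewrite /E /r opprD.
have uF := spd_unit hF.
have [n0 opbM_X] : (0 < n)%N /\ opb (toC M) (opnorm2 X).
  by case: offM => s s0; split; rewrite ?(leq_ltn_trans _ (ltn_ord s)) // toC_mxsub;
    apply: opb_mxsub (opnorm2_ge0 X) (opnorm2P X);
    (exact: head_idx_inj || exact: tail_idx_inj).
have k1 := cond2_ge1 n0 uF.
pose S := (1 + Num.sqrt 2 : R) ^+ 2.
have S5 : 5 <= S.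
  have s2 : Num.sqrt 2 ^+ 2 = 2 :> R by rewrite sqr_sqrtr.
  have s1 : 1 <= Num.sqrt 2 :> R by rewrite -{1}sqrtr1 ler_wsqrtr // ler1n.
  have -> : S = 1 + 2 * Num.sqrt 2 + Num.sqrt 2 ^+ 2 by rewrite /S; ring.
  by rewrite s2; lra.
have S0 : 0 < S by apply: lt_le_trans S5.
have kS : 0 < cond2 F * S by rewrite mulr_gt0 // (lt_le_trans ltr01).
have X0 := opnorm2_ge0 X.
set sg := sing_val M _.
(* Approximation by the zero matrix. *)
have sgX : sg <= opnorm2 X.
  rewrite /sg addn1; apply: (@sing_val_approx _ _ _ _ 0 _ _ X0).
    by rewrite mxrank0.
  by rewrite subr0.
rewrite -lee_pdivrMl // -EFinM; apply/ereal_infP => _ [P [T [ratPT supE infE ->]]].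
have [sP sT T0 cPT] := ratPT.
set Sm := ereal_sup _ in supE *; set Im := ereal_inf _ in infE *.
have [x x1] := ex_unit_vector R n0.
have Ex : E (ip x (toC (invmx L *m A *m L - L^T *m X *m L) *m x)).
  by rewrite EE; apply: (closed_loop_num_in hF Xp eqX hL hWL hr x1).
have nn z : (0 <= ratfun_abs P T z)%E.
  rewrite /ratfun_abs; case: ifP => _; first exact: leey.
  by rewrite lee_fin normc_cabs cabs_ge0.
have Sm0 : (0 <= Sm)%E.
  apply: le_trans (nn _) (ereal_sup_ubound _).
  by exists (ip x (toC (invmx L *m A *m L - L^T *m X *m L) *m x)).
have [m mE] : exists m, Sm = m%:E.
  by move: supE Sm0; case: (Sm) => // m; exists m.
have m0 : 0 <= m by rewrite -lee_fin -mE.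
(* [m'] is the inverse of the infimum over [-E]. If that infimum is [+oo], then [m' = 0] and [T]
   vanishes on all of [-E]; the value 0 is excluded by [infE]. *)
have [m' m'E m'0] : exists2 m', (Im^-1)%E = m'%:E & 0 <= m' /\
    forall z, [set (- z)%R | z in E] z -> cabs T.[z] <= m' * cabs P.[z].
  have lb z : [set (- z)%R | z in E] z -> (Im <= ratfun_abs P T z)%E.
    by move=> Ez; apply: ereal_inf_lbound; exists z.
  case: inveP infE lb => [|_ lb|//|i i0 infE lb]; first by rewrite ltxx.
    exists 0 => //; split=> // z /lb; rewrite /ratfun_abs.
    by case: ifP => [/rootP -> _|//]; rewrite cabs0 mul0r.
  have ip : 0 < i by rewrite -lte_fin.
  exists i^-1 => //; split; first by rewrite invr_ge0 ltW.
  move=> z /lb; rewrite /ratfun_abs; case: ifP => [/rootP -> _|rT].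
    by rewrite cabs0 mulr_ge0 ?cabs_ge0 // invr_ge0 ltW.
  rewrite lee_fin normc_cabs cabsM cabsV => h1.
  have Tp : 0 < cabs T.[z] by rewrite cabs_gt0 -[_ == 0]/(root T z) rT.
  by rewrite ler_pdivlMl // -ler_pdivlMr.
have hE z : E z -> cabs P.[z] <= m * cabs T.[z].
  move=> Ez; have : (ratfun_abs P T z <= m%:E)%E.
    by rewrite -mE; apply: ereal_sup_ubound; exists z.
  rewrite /ratfun_abs; case: ifP => // rT; rewrite lee_fin normc_cabs cabsM cabsV.
  have Tp : 0 < cabs T.[z] by rewrite cabs_gt0 -[_ == 0]/(root T z) rT.
  by rewrite ler_pdivrMr.
rewrite mE m'E -EFinM lee_fin.
have [m'0' hE'] := m'0.
set rho := m * m'.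
have rho0 : 0 <= rho by rewrite mulr_ge0.
rewrite ler_pdivrMl //.
(* If [opnorm2 X = 0], its inverse is 0 by convention, and so is the quotient. *)
have [Xz|Xnz] := eqVneq (opnorm2 X) 0.
  by rewrite Xz invr0 mulr0 mulr_ge0 // ltW.
have Xp0 : 0 < opnorm2 X by rewrite lt_def Xnz.
(* A bound of at least 1 follows from [sgX]; otherwise [small] allows exchanging [rho ^+ 2] for
   [rho]. *)
have [big|small] := leP 1 (cond2 F * S * rho).
  by apply: le_trans big; rewrite ler_pdivrMr // mul1r.
have main : sg <= cond2 F * opnorm2 X * (25 * rho ^+ 2).
  have bd0 : 0 <= cond2 F * opnorm2 X * (25 * rho ^+ 2).
    by rewrite !mulr_ge0 ?opnorm2_ge0 ?sqr_ge0.
  have approx_lower (s : 'I_n) : (0 < s)%N -> exists2 N : 'M[R[i]]_(n - s, s),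
      (\rank N <= h * t + rf)%N
      & opb (toC (lower_block X s) - N) (cond2 F * opnorm2 X * (25 * rho ^+ 2)).
    move=> s0; apply: (off_block_approx hA hF hFr hQr Xp eqX hL hWL hr s0 cPT sP sT);
      by rewrite -?EE.
  rewrite /sg addn1.
  case: offM => s s0.
    have [N rN hN] := approx_lower s s0.
    exact: sing_val_approx bd0 rN hN.
  (* By symmetry of [X] the upper block is the transpose of the lower one, so the adjoint of [N]
     approximates it. *)
  have [N rN hN] := approx_lower s s0.
  apply: (sing_val_approx (N := N^t*) bd0).
    by rewrite mxrank_map mxrank_tr.
  have -> : toC (upper_block X s) - N^t* = (toC (lower_block X s) - N)^t*.
    rewrite ctrB toC_adj; congr (toC _ - _).
    by case: Xp => XT _; rewrite /lower_block -mxsub_tr XT.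
  exact: opb_adj.
rewrite ler_pdivrMr //; apply: le_trans main _.
have -> : cond2 F * opnorm2 X * (25 * rho ^+ 2)
    = cond2 F * (opnorm2 X * rho) * (25 * rho) by ring.
have -> : cond2 F * S * rho * opnorm2 X = cond2 F * (opnorm2 X * rho) * S by ring.
apply: ler_wpM2l; first by rewrite !mulr_ge0 ?opnorm2_ge0.
(* Follows from [small] because [cond2 F] is at least 1. Then [5 * rho <= 1], so
   [25 * rho <= 5 <= S]. *)
have sr : S * rho <= 1.
  apply: le_trans (ltW small); rewrite -mulrA ler_peMl // mulr_ge0 //; exact: ltW.
have : 5 * rho <= S * rho by rewrite ler_wpM2r.
by lra.
Qed.
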